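(* Let $V\subset H\cong H^*\subset V^*$ be a Gelfand triple, $\mathcal{A}:V\to V^*$ a Borel function, and $\nu$ a $\sigma$-finite measure on $H$ with $\nu(\{0\})=0$ and $\int_H(\|z\|_H^2\wedge 1)\,\nu(dz)<\infty$. Suppose there exist constants $\alpha>1$, $\beta\ge 0$, $\theta>0$, $C>0$, $\widetilde C>0$, $\varpi>0$, $F>0$ and a measurable function $\rho:V\to[0,+\infty)$, bounded on balls, such that for all $v,v_1,v_2\in V$: (Hemicontinuity) the map $s\mapsto {}_{V^*}\langle\mathcal{A}(v_1+sv_2),v\rangle_V$ is continuous on $\mathbb{R}$; (Local monotonicity) $2\,{}_{V^*}\langle\mathcal{A}(v_1)-\mathcal{A}(v_2),v_1-v_2\rangle_V\le (C+\rho(v_2))\|v_1-v_2\|_H^2$; (Coercivity) $2\,{}_{V^*}\langle\mathcal{A}(v),v\rangle_V+\theta\|v\|_V^{\alpha}\le F+C\|v\|_H^2$; (Growth) $\|\mathcal{A}(v)\|_{V^*}^{\frac{\alpha}{\alpha-1}}\le (F+C\|v\|_V^{\alpha})(1+\|v\|_H^{\beta})$; (Bound on $\rho$) $\rho(v)\le C(1+\|v\|_V^{\alpha})(1+\|v\|_H^{\beta})$; (Dissipation) $2\,{}_{V^*}\langle\mathcal{A}(v),v\rangle_V+\widetilde C\|v\|_H^{\varpi}\le 0$. Assume also that $\nu$ is symmetric, i.e. $\nu(B)=\nu(-B)$ for all $B\in\mathcal{B}(H)$. Then the solution $\{X^x\}_{x\in H}$ of $$dX(t)=\mathcal{A}(X(t))\,dt+dL(t),\quad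 X(0)=x\in H,$$ where $$L(t)=\int_0^t\int_{0<\|z\|_H\le 1}z\,\tilde N(dz,ds)+\int_0^t\int_{\|z\|_H>1}z\,N(dz,ds),\quad t\ge0,$$ is accessible to zero.
   Context: Setting: $(\Omega,\mathcal{F},\mathbb{F},\mathbb{P})$ with $\mathbb{F}=\{\mathcal{F}_t\}_{t\ge 0}$ is a filtered probability space satisfying the usual conditions. $V\subset H\cong H^*\subset V^*$ is a Gelfand triple ($H$ a separable Hilbert space identified with its dual, $V$ a reflexive Banach space densely and continuously embedded in $H$), and ${}_{V^*}\langle\cdot,\cdot\rangle_V$ is the duality pairing. $N$ is a time-homogeneous Poisson random measure on $H\times\mathbb{R}^+$ (relative to $\mathbb{F}$) with intensity measure $\nu$, i.e. with compensator $\nu(dz)\,dt$, and $\tilde N(dz,dt)=N(dz,dt)-\nu(dz)\,dt$. Solution: an $H$-valued càdlàg $\mathbb{F}$-adapted process $X^x$ is a solution with initial data $x\in H$ if (I) $X^x(t,\omega)\in V$ for $dt\otimes\mathbb{P}$-almost all $(t,\omega)\in[0,\infty)\times\Omega$; (II) $\int_0^t\|\mathcal{A}(X^x(s))\|_{V^*}\,ds<\infty$ for all $t\ge0$, $\mathbb{P}$-a.s.; (III) $\mathbb{P}$-a.s., as an equation in $V^*$, $X^x(t)=x+\int_0^t\mathcal{A}(X^x(s))\,ds+L(t)$ for all $t\ge 0$. It is a known result (which the paper cites) that under the first five conditions on $\mathcal{A}$ and $\rho$ listed in the claim (all except the dissipation condition) the equation is well-posed: for every $x\in H$ there is a unique solution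 $X^x$, and $X^x\in D([0,\infty);H)\cap L^\alpha_{loc}([0,\infty);V)$ $\mathbb{P}$-a.s., where $D([0,\infty);H)$ is the space of càdlàg paths in $H$. The same holds for the equation with $L$ replaced by $\int_0^t\int_{0<\|z\|_H\le\epsilon}z\,\tilde N(dz,ds)$, $\epsilon\in(0,1]$, and the noise-free equation $dY(t)=\mathcal{A}(Y(t))\,dt$ has a unique solution $Y^x\in C([0,\infty);H)\cap L^\alpha_{loc}([0,\infty);V)$. Accessibility: an $H$-valued Markov process $\{X^x(t),t\ge0;x\in H\}$ (where $X^x$ starts from $x$) is said to be accessible to $x_0\in H$ if, for $\lambda>0$ arbitrary, $$R_\lambda(x,U)=\lambda\int_0^\infty e^{-\lambda t}\,\mathbb{P}(X^x(t)\in U)\,dt>0$$ for all $x\in H$ and all neighborhoods $U$ of $x_0$. *)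

(* Defs.v *)
From HB Require Import structures.
From mathcomp Require Import all_boot all_order all_algebra.
From mathcomp Require Import all_classical all_reals all_analysis.
From mathcomp Require Import measurable_realfun.

Set Implicit Arguments.
Unset Strict Implicit.
Unset Printing Implicit Defensive.

Import Order.TTheory GRing.Theory Num.Theory.
Import numFieldNormedType.Exports.

Local Open Scope classical_set_scope.
Local Open Scope ring_scope.

(** * Gelfand triples *)

Record is_inner_product (R : realType) (H : normedModType R)
    (ip : H -> H -> R) : Prop := IsInnerProduct {
  ip_linear : forall (a : R) (x y z : H),
    ip (a *: x + y) z = a * ip x z + ip y z ;
  ip_sym : forall x y : H, ip x y = ip y x ;
  ip_norm : forall x : H, ip x x = `|x| ^+ 2
}.

(* [pair] identifies [W] isometrically with the topological dual of [V]:
   the last three fields say that the norm of [W] is the dual norm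
   (the least Lipschitz bound) and that every continuous linear functional
   on [V] is represented. *)
Record is_dual (R : realType) (V W : normedModType R)
    (pair : W -> {scalar V}) : Prop := IsDual {
  dual_linear : forall (a : R) (f g : W) (v : V),
    pair (a *: f + g) v = a * pair f v + pair g v ;
  dual_norm_ub : forall (f : W) (v : V), `|pair f v| <= `|f| * `|v| ;
  dual_norm_least : forall (f : W) (c : R), 0 <= c ->
    (forall v : V, `|pair f v| <= c * `|v|) -> `|f| <= c ;
  dual_onto : forall g : {scalar V}, continuous (g : V -> R) ->
    exists f : W, forall v : V, pair f v = g v
}.

(* [V c H ~ H^* c W] where [W] is the dual of [V].  The embeddings are
   explicit: [embV : V -> H], and [embH : H -> W], which sends [h] to the
   functional [(h, embV _)_H]. *)
Record gelfand_triple (R : realType) (V H : completeNormedModType R)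
    (W : normedModType R) := GelfandTriple {
  inner : H -> H -> R ;
  embV : {linear V -> H} ;
  pairing : W -> {scalar V} ;
  embH : H -> W ;
  innerP : is_inner_product inner ;
  separableH : exists D : set H, countable D /\ dense D ;
  embV_inj : injective embV ;
  embV_continuous : continuous (embV : V -> H) ;
  embV_dense : dense (range embV) ;
  pairingP : is_dual pairing ;
  reflexiveV : forall Phi : {scalar W}, continuous (Phi : W -> R) ->
    exists v : V, forall f : W, Phi f = pairing f v ;
  embHE : forall (h : H) (v : V), pairing (embH h) v = inner h (embV v)
}.

(* Inverse of the embedding of [V] in [H], with value [0] outside [V]. *)
Definition toV (R : realType) (V H : completeNormedModType R)
    (W : normedModType R) (G : gelfand_triple V H W) (h : H) : V :=
  xget 0 [set v : V | embV G v = h].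

(* A normed space with its Borel sigma-algebra. *)
Notation borel T := (g_sigma_algebraType (@open T)).

(** * Bochner integral *)

(* The step function \sum_i 1_(step_set i) c_i; the sets may overlap. *)
Record step_fun (T E : Type) := StepFun {
  step_size : nat ;
  step_set : 'I_step_size -> set T ;
  step_val : 'I_step_size -> E
}.

Definition step_eval (R : realType) (T : Type) (E : normedModType R)
    (s : step_fun T E) (x : T) : E :=
  \sum_(i < step_size s) (\1_(step_set i) x : R) *: step_val i.

Definition step_in (R : realType) (d : measure_display) (T : measurableType d)
    (E : Type) (mu : set T -> \bar R) (D : set T) (s : step_fun T E) : Prop :=
  forall i : 'I_(step_size s), [/\ measurable (step_set i),
    step_set i `<=` D & (mu (step_set i) < +oo)%E].

Definition step_integral (R : realType) (T : Type) (E : normedModType R)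
    (mu : set T -> \bar R) (s : step_fun T E) : E :=
  \sum_(i < step_size s) fine (mu (step_set i)) *: step_val i.

(* [f] is Bochner integrable on [D], with integral [y].  The almost everywhere
   convergence makes [f] strongly measurable, so that the integral of the norm
   below is the genuine one. *)
Definition is_bochner (R : realType) (d : measure_display)
    (T : measurableType d) (E : normedModType R)
    (mu : {measure set T -> \bar R}) (D : set T) (f : T -> E) (y : E) : Prop :=
  exists s : nat -> step_fun T E,
  [/\ forall n, step_in mu D (s n),
      {ae mu, forall x, D x -> step_eval (s n) x @[n --> \oo] --> f x},
      (\int[mu]_(x in D) (`|f x - step_eval (s n) x|)%:E)%E @[n --> \oo]
        --> 0%E &
      step_integral mu (s n) @[n --> \oo] --> y].

(** * Filtrations and processes; time is [0, +oo[ inside [R] *)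

Record usual_conditions (R : realType) (d : measure_display)
    (Omega : measurableType d) (P : probability Omega R)
    (F : R -> set (set Omega)) : Prop := UsualConditions {
  filt_sigma_algebra : forall t, 0 <= t -> sigma_algebra setT (F t) ;
  filt_measurable : forall t, 0 <= t -> F t `<=` measurable ;
  filt_mono : forall s t, 0 <= s -> s <= t -> F s `<=` F t ;
  filt_right_continuous : forall t, 0 <= t ->
    forall A, (forall s, t < s -> F s A) -> F t A ;
  filt_complete : forall A, P.-negligible A -> F 0 A
}.

Definition adapted (R : realType) (Omega : Type) (F : R -> set (set Omega))
    (E : normedModType R) (X : R -> Omega -> E) : Prop :=
  forall t, 0 <= t -> forall B : set (borel E), measurable B ->
    F t (X t @^-1` B).

Definition cadlag (R : realType) (E : normedModType R) (f : R -> E) : Prop :=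
  (forall t, 0 <= t -> f s @[s --> t^'+] --> f t) /\
  (forall t, 0 < t -> cvg (f s @[s --> t^'-])).

(** * Poisson random measures on [H * [0, +oo[] *)

Notation marks_times H R := (borel H * measurableTypeR R)%type.

Definition intensity (R : realType) (H : completeNormedModType R)
    (nu : {sigma_finite_measure set (borel H) -> \bar R}) :
    {measure set (marks_times H R) -> \bar R} :=
  (nu \x (@lebesgue_measure R))%E.

Section poisson_random_measure.
Context (R : realType) (H : completeNormedModType R) (d : measure_display)
  (Omega : measurableType d) (P : probability Omega R)
  (F : R -> set (set Omega))
  (nu : {sigma_finite_measure set (borel H) -> \bar R})
  (N : Omega -> {measure set (marks_times H R) -> \bar R}).

Definition after (s : R) : set (marks_times H R) := [set p | s < p.2].

Definition upto (t : R) : set (marks_times H R) := [set p | 0 <= p.2 <= t].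

Definition nonneg_time : set (marks_times H R) := [set p | 0 <= p.2].

(* sigma(N(B) : B included in H * ]s, +oo[) *)
Definition future (s : R) : set (set Omega) :=
  <<s [set E | exists (B : set (marks_times H R)) (C : set (\bar R)),
        [/\ measurable B, B `<=` after s, measurable C &
            E = [set w | C (N w B)]]] >>.

(* The marks-times space is [H * [0, +oo[]; the ambient type is [H * R], but
   only sets of nonnegative times are constrained in law, and only such sets
   are integrated over below. *)
Record poisson_random_measure : Prop := PoissonRandomMeasure {
  prm_counting : forall w (B : set (marks_times H R)), measurable B ->
    N w B = +oo%E \/ exists n : nat, N w B = (n%:R)%:E ;
  prm_poisson : forall B : set (marks_times H R),
    measurable B -> B `<=` nonneg_time ->
    (intensity nu B < +oo)%E -> forall n : nat,
    P [set w | N w B = (n%:R)%:E] =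
      poisson_prob (fine (intensity nu B)) n [set n] ;
  prm_infinite : forall B : set (marks_times H R),
    measurable B -> B `<=` nonneg_time ->
    intensity nu B = +oo%E -> P [set w | N w B = +oo%E] = 1%E ;
  prm_independent : forall (n : nat) (B : 'I_n -> set (marks_times H R))
      (C : 'I_n -> set (\bar R)),
    (forall i, measurable (B i) /\ B i `<=` nonneg_time) ->
    trivIset setT B -> (forall i, measurable (C i)) ->
    P (\bigcap_(i in [set: 'I_n]) [set w | C i (N w (B i))]) =
      (\prod_(i < n) P [set w | C i (N w (B i))])%E ;
  prm_adapted : forall t, 0 <= t ->
    forall (B : set (marks_times H R)) (C : set (\bar R)), measurable B ->
    B `<=` upto t -> measurable C ->
    F t [set w | C (N w B)] ;
  prm_future_independent : forall s, 0 <= s -> forall A B, F s A ->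
    future s B -> P (A `&` B) = (P A * P B)%E
}.

(* [Y] is the L^2 stochastic integral over [D] of the deterministic integrand
   [f] against the compensated measure N - intensity: an L^2(P)-limit of the
   integrals of step functions that converge to [f] in L^2(intensity). *)
Definition is_compensated_integral (D : set (marks_times H R))
    (f : marks_times H R -> H) (Y : Omega -> H) : Prop :=
  exists s : nat -> step_fun (marks_times H R) H,
  [/\ forall n, step_in (intensity nu) D (s n),
      (\int[intensity nu]_(p in D) (`|f p - step_eval (s n) p| ^+ 2)%:E)%E
        @[n --> \oo] --> 0%E &
      (\int[P]_w (`|Y w - (step_integral (N w) (s n) -
                           step_integral (intensity nu) (s n))| ^+ 2)%:E)%E
        @[n --> \oo] --> 0%E].

Definition small_jumps (t : R) : set (marks_times H R) :=
  [set p | 0 < `|p.1 : H| <= 1 /\ 0 < p.2 <= t].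

Definition large_jumps (t : R) : set (marks_times H R) :=
  [set p | 1 < `|p.1 : H| /\ 0 < p.2 <= t].

(* L(t) = \int_0^t \int_(0 < |z| <= 1) z (N - intensity)(dz, ds)
          + \int_0^t \int_(|z| > 1) z N(dz, ds),
   with the cadlag version [M] of the first term. *)
Definition is_levy_noise (L : R -> Omega -> H) : Prop :=
  exists M : R -> Omega -> H,
  [/\ adapted F M,
      {ae P, forall w, cadlag (M ^~ w)},
      (forall t, 0 <= t ->
        is_compensated_integral (small_jumps t) (fun p => p.1) (M t)) &
      {ae P, forall w, forall t, 0 <= t -> exists J : H,
        is_bochner (N w) (large_jumps t) (fun p => p.1 : H) J /\
        L t w = M t w + J}].

End poisson_random_measure.

(** * Solutions of dX = A(X) dt + dL, X(0) = x *)

Section solution.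
Context (R : realType) (V H : completeNormedModType R) (W : normedModType R)
  (G : gelfand_triple V H W) (A : V -> W)
  (d : measure_display) (Omega : measurableType d) (P : probability Omega R)
  (F : R -> set (set Omega)) (L : R -> Omega -> H).

Record is_solution (x : H) (X : R -> Omega -> H) : Prop := IsSolution {
  sol_adapted : adapted F X ;
  sol_cadlag : {ae P, forall w, cadlag (X ^~ w)} ;
  sol_in_V : {ae ((@lebesgue_measure R) \x P)%E,
    forall p : measurableTypeR R * Omega,
      0 <= p.1 -> range (embV G) (X p.1 p.2)} ;
  sol_integrable : {ae P, forall w, forall t : R, 0 <= t ->
    (\int[@lebesgue_measure R]_(s in `[0%R, t])
       (`|A (toV G (X s w))|)%:E < +oo)%E} ;
  sol_equation : {ae P, forall w, forall t : R, 0 <= t -> exists I : W,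
    is_bochner (@lebesgue_measure R) `[0, t]
      (fun s : R => A (toV G (X s w))) I /\
    embH G (X t w) = embH G x + I + embH G (L t w)}
}.

(* Almost all paths lie in L^alpha_loc([0, +oo[; V).  Strong measurability in
   [V] is automatic for a cadlag path in [H], because [embV] is a Borel
   isomorphism onto its range. *)
Definition paths_Lloc (alpha : R) (X : R -> Omega -> H) : Prop :=
  {ae P, forall w, forall t : R, 0 <= t ->
    {ae (@lebesgue_measure R), forall s : R, 0 <= s <= t ->
      range (embV G) (X s w)} /\
    (\int[@lebesgue_measure R]_(s in `[0%R, t])
       (`|toV G (X s w)| `^ alpha)%:E < +oo)%E}.

End solution.

(** * Accessibility *)

Section accessibility.
Context (R : realType) (H : completeNormedModType R)
  (d : measure_display) (Omega : measurableType d) (P : probability Omega R)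
  (X : H -> R -> Omega -> H).
Local Open Scope ereal_scope.

Definition resolvent (lambda : R) (x : H) (U : set H) : \bar R :=
  lambda%:E * \int[@lebesgue_measure R]_(t in `[0%R, +oo[)
    ((expR (- lambda * t))%:E * P (X x t @^-1` U)).

(* The neighbourhoods are Borel so that P(X^x(t) \in U) makes sense. *)
Definition accessible (x0 : H) : Prop :=
  forall lambda : R, (0 < lambda)%R -> forall (x : H) (U : set H),
    nbhs x0 U -> measurable (U : set (borel H)) -> 0 < resolvent lambda x U.

End accessibility.

(* Main.v *)
(* If the resolvent vanished, almost every path would satisfy |X(t)| >= r for
   almost every t, so that dissipation would remove energy at rate at least
   Ct * r^varpi.  To contradict this, condition on the absence of jumps of norm
   > eps up to time T + 1.  Under the conditional law Q the noise L coincides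
   with M, N is still Poisson on the remaining region, and by symmetry of nu the
   compensator of the jumps of norm in ]eps, 1] does not contribute: the
   increments m_h(s) = M(s + h) - M(s) satisfy
   E_Q |m_h(s)|^2 <= 4 h s2(eps), where s2(eps), the integral of |z|^2 over
   0 < |z| <= eps, tends to 0, and they are centered given the past.

   No Ito formula is needed.  In |X(s + h)|^2 - |X(s)|^2 the noise enters through
   2 (X(s), m_h(s)) + |m_h(s)|^2.  Divide by h and integrate over s in [0, T],
   stopping when |X| leaves the ball of radius K: by orthogonality of the
   increments both contributions are small with Q-probability at least 1/2, for
   every h = 1/(n + 1), hence for infinitely many n along some path.  On this
   path the drift part converges as h -> 0, by Lebesgue differentiation and
   Fatou's lemma, and gives
   |X(tau)|^2 <= |x|^2 - Ct * r^varpi * tau + 2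
   at the exit time tau; this is absurd for K and T large. *)
Require Import Defs.
From mathcomp Require Import all_boot all_order all_algebra.
From mathcomp Require Import all_classical all_reals all_analysis.
From mathcomp Require Import measurable_realfun ring lra ssrAC.

Set Implicit Arguments.
Unset Strict Implicit.
Unset Printing Implicit Defensive.

Import Order.TTheory GRing.Theory Num.Theory.
Import numFieldNormedType.Exports.

Local Open Scope classical_set_scope.
Local Open Scope ring_scope.

(** * Measurability of vector-valued maps *)

(** The state lies in [V] only for almost every time and the drift only in [W], so no chain rule
    applies to |X|^2. With x = X(s), y = X(s + h) and noise increment z, |y|^2 - |x|^2 = 2 (y - x -
    z, y) + 2 (x, z) + |z|^2 - |y - x - z|^2. Testing the drift increment at the right end y gives
    the discarded square a favourable sign and turns the drift term into a mean of
    [pairing G (a r) (v t)] over [[t - h, t]]. Fatou needs a majorant of these means. On a ball of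
    [H], growth and coercivity bound the pairing of different points by the work at each of them, so
    the dissipated energy controls itself. In the integrated noise term one factor h comes from the
    variance of an increment and one from orthogonality beyond time distance h, which offsets the
    division by h in mean square. The radius and the horizon depend only on the starting point and
    the neighbourhood, so [eps] is chosen last. The inverse embedding [toV] is not known to be
    measurable, whence the use of norm measurability, of strongly measurable versions and of lower
    integrals. *)

Lemma measurable_set_bool d (T : measurableType d) (b : T -> bool) :
  measurable_fun setT b -> measurable [set x | b x].
Proof. by move=> /(_ measurableT [set true]); rewrite setTI; apply. Qed.

(* In a separable space this is Borel measurability, but it is stable under
   pointwise limits for free. *)
Definition norm_measurable (R : realType) (d : measure_display)
    (T : measurableType d) (E : normedModType R) (D : set T) (f : T -> E) :=
  forall y : E, measurable_fun D (fun x => `|f x - y|).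

Section norm_measurable.
Context (R : realType) (d : measure_display) (T : measurableType d).
Context (E : normedModType R).
Implicit Types (D : set T) (f g : T -> E).

Lemma norm_measurable_norm D f : norm_measurable D f ->
  measurable_fun D (fun x => `|f x|).
Proof.
move=> /(_ 0); apply: eq_measurable_fun => x _ /=; by rewrite subr0.
Qed.

Lemma norm_measurableN D f : norm_measurable D f ->
  norm_measurable D (fun x => - f x).
Proof.
move=> mf z; apply: (eq_measurable_fun (fun x => `|f x - - z|)) => //.
by move=> x _; rewrite opprK -opprD normrN.
Qed.

Lemma norm_measurable_cst D (y : E) : norm_measurable D (fun=> y).
Proof. by move=> z; exact: measurable_cst. Qed.

Lemma norm_measurable_scale D (f : T -> R) (y : E) : measurable_fun D f ->
  norm_measurable D (fun x => f x *: y).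
Proof.
move=> mf z.
have cf : continuous (fun r : R => `|r *: y - z|).
  move=> r; apply: cvg_norm; apply: cvgB; last exact: cvg_cst.
  exact: (cvgZr_tmp cvg_id).
have /(@continuous_measurable_fun _ _)/measurableT_comp := cf.
by apply.
Qed.

Lemma norm_measurable_cvg D (h : nat -> T -> E) f : measurable D ->
  (forall n, norm_measurable D (h n)) ->
  (forall x, D x -> h n x @[n --> \oo] --> f x) -> norm_measurable D f.
Proof.
move=> mD mh hf y.
apply: (@measurable_fun_cvg _ _ _ _ (fun n x => `|h n x - y|)).
  by move=> n; exact: mh.
move=> x Dx; apply: cvg_norm; apply: cvgB; [exact: hf|exact: cvg_cst].
Qed.

(** Allows a measurable choice among countably many maps: a preimage splits along the fibres of the
    selector [k]. *)
Lemma measurable_fun_glue (U : countType) d' (T' : measurableType d')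
    (k : T -> U) (F : U -> T -> T') :
  (forall u, measurable (k @^-1` [set u])) ->
  (forall u, measurable_fun setT (F u)) ->
  measurable_fun setT (fun x => F (k x) x).
Proof.
move=> mk mF _ B mB; rewrite setTI.
rewrite [X in measurable X](_ : _ =
  \bigcup_u (k @^-1` [set u] `&` F u @^-1` B)).
  apply: countable_bigcupT_measurable => //.
  by move=> u; apply: measurableI => //; rewrite -[X in measurable X]setTI; exact: mF.
apply/seteqP; split=> [x /= Bx|x [u _ [/= <-]]//].
by exists (k x).
Qed.

End norm_measurable.

Definition separable_space (E : topologicalType) :=
  exists D : set E, countable D /\ dense D.

Lemma countable_enumeration (T : pointedType) (D : set T) : countable D ->
  exists e : nat -> T, D `<=` range e.
Proof.
move=> /countable_injP [f finj].
exists (fun n => xget point [set x | D x /\ f x = n]) => x Dx.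
exists (f x) => //; case: xgetP => [y _ [Dy fyx]|/(_ x)]; last by case.
by apply: finj => //; rewrite inE.
Qed.

Lemma separable_seq (R : realType) (E : normedModType R) :
  separable_space E -> exists e : nat -> E,
    forall x (r : R), 0 < r -> exists n, `|x - e n| < r.
Proof.
move=> [D [cD dD]]; have [e De] := countable_enumeration cD.
exists e => x r r0; have [||y [/= xy Dy]] := dD (ball x r).
- by exists x; exact: ballxx.
- exact: ball_open.
- by have [n _ en] := De _ Dy; exists n; rewrite en; rewrite -ball_normE in xy.
Qed.

Section separable.
Context (R : realType) (d : measure_display) (T : measurableType d).
Context (E : normedModType R).
Hypothesis sepE : separable_space E.
Implicit Types (f g : T -> E).

(* [f] is approximated by maps with values in a fixed countable set, and the
   claim is clear when [f] is countably valued. *)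
Lemma norm_measurableD f g : norm_measurable setT f -> norm_measurable setT g ->
  norm_measurable setT (fun x => f x + g x).
Proof.
move=> mf mg; have [e he] := separable_seq sepE.
pose P n x k := `|f x - e k| < n.+1%:R^-1 :> R.
have exP n x : exists k, P n x k by apply: he; rewrite invr_gt0 ltr0n.
(* Taking the least admissible index makes each fibre of [k n] a Boolean combination of finitely
   many sets [P n]. *)
pose k n x := ex_minn (exP n x).
have kP n x : P n x (k n x) by rewrite /k; case: ex_minnP.
have mP n j : measurable [set x | P n x j].
  by apply: measurable_set_bool; apply: measurable_fun_ltr.
apply: (@norm_measurable_cvg _ _ _ _ _ (fun n x => e (k n x) + g x)) => //.
  move=> n y.
  apply: (@measurable_fun_glue _ _ _ _ _ (k n) (fun j x => `|e j + g x - y|)).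
    move=> j; rewrite (_ : _ @^-1` _ =
        [set x | P n x j] `&` \bigcap_(i in [set i | (i < j)%N]) ~` [set x | P n x i]).
      apply: measurableI => //; apply: bigcap_measurableType => i _.
      exact: measurableC.
    apply/seteqP; split=> x /=.
      rewrite /k; case: ex_minnP => m Pm mle <-; split => // i /= im Pi.
      by have := mle _ Pi; rewrite leqNgt im.
    move=> [Pj hj]; rewrite /k; case: ex_minnP => m Pm mle.
    apply/eqP; rewrite eqn_leq mle//= leqNgt; apply/negP => mj.
    exact: (hj _ mj).
  (* On a fibre [f] is replaced by the constant [e j], which only moves the test point from [y] to
     [y - e j]. *)
  move=> j; apply: (eq_measurable_fun (fun x => `|g x - (y - e j)|)) => //.
  by move=> x _; rewrite opprB addrCA addrA (addrC (e j)).
move=> x _; apply: cvgD; last exact: cvg_cst.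
apply/cvgrPdist_lt => eps eps0.
near=> n; rewrite (lt_trans (kP n x))//; near: n.
by apply: (near_infty_natSinv_lt (PosNum eps0)).
Unshelve. all: by end_near. Qed.

Lemma norm_measurable_sub f g : norm_measurable setT f ->
  norm_measurable setT g -> norm_measurable setT (fun x => f x - g x).
Proof. by move=> mf mg; apply: norm_measurableD => //; exact: norm_measurableN. Qed.

Lemma norm_measurable_sum I (r : seq I) (F : I -> T -> E) :
  (forall i, norm_measurable setT (F i)) ->
  norm_measurable setT (fun x => \sum_(i <- r) F i x).
Proof.
move=> mF; elim: r => [|i r IH].
  by under eq_fun do rewrite big_nil; exact: norm_measurable_cst.
by under eq_fun do rewrite big_cons; exact: norm_measurableD.
Qed.

End separable.

(** * Inner products *)

Section inner_product.
Context (R : realType) (H : normedModType R) (ip : H -> H -> R).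
Hypothesis ipP : is_inner_product ip.

Lemma ipDl x y z : ip (x + y) z = ip x z + ip y z.
Proof. by have := ip_linear ipP 1 x y z; rewrite scale1r mul1r. Qed.

Lemma ip0l z : ip 0 z = 0.
Proof. by apply: (@addrI _ (ip 0 z)); rewrite -ipDl !addr0. Qed.

Lemma ipZl a x z : ip (a *: x) z = a * ip x z.
Proof. by have := ip_linear ipP a x 0 z; rewrite addr0 ip0l addr0. Qed.

Lemma ipNl x z : ip (- x) z = - ip x z.
Proof. by rewrite -scaleN1r ipZl mulN1r. Qed.

Lemma ipBl x y z : ip (x - y) z = ip x z - ip y z.
Proof. by rewrite ipDl ipNl. Qed.

Lemma ipDr x y z : ip z (x + y) = ip z x + ip z y.
Proof. by rewrite !(ip_sym ipP z) ipDl. Qed.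

Lemma ipZr a x z : ip z (a *: x) = a * ip z x.
Proof. by rewrite !(ip_sym ipP z) ipZl. Qed.

Lemma ip0r z : ip z 0 = 0.
Proof. by rewrite ip_sym// ip0l. Qed.

Lemma ipNr x z : ip z (- x) = - ip z x.
Proof. by rewrite !(ip_sym ipP z) ipNl. Qed.

Lemma ipBr x y z : ip z (x - y) = ip z x - ip z y.
Proof. by rewrite ipDr ipNr. Qed.

Lemma ip_suml I (r : seq I) (F : I -> H) z :
  ip (\sum_(i <- r) F i) z = \sum_(i <- r) ip (F i) z.
Proof.
elim: r => [|i r IH]; first by rewrite !big_nil ip0l.
by rewrite !big_cons ipDl IH.
Qed.

Lemma ip_sumr I (r : seq I) (F : I -> H) z :
  ip z (\sum_(i <- r) F i) = \sum_(i <- r) ip z (F i).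
Proof. by rewrite ip_sym// ip_suml; apply: eq_bigr => i _; exact: ip_sym. Qed.

Lemma sqr_normD x y : `|x + y| ^+ 2 = `|x| ^+ 2 + `|y| ^+ 2 + 2 * ip x y.
Proof.
rewrite -!(ip_norm ipP) ipDl !ipDr (ip_sym ipP y x); ring.
Qed.

(** Polarization; it reduces the measurability of an inner product to that of three norms. *)
Lemma ipE x y : ip x y = 2^-1 * (`|x + y| ^+ 2 - `|x| ^+ 2 - `|y| ^+ 2).
Proof. by rewrite sqr_normD; lra. Qed.

Lemma ip_le x y : `|ip x y| <= `|x| * `|y|.
Proof.
have [->|y0] := eqVneq y 0; first by rewrite ip0r !normr0 mulr0.
have ny : 0 < `|y| by rewrite normr_gt0.
rewrite -(ler_pXn2r (_ : 0 < 2)%N) ?nnegrE ?mulr_ge0// real_normK ?num_real//.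
(* The vector is [|y|^2] times the component of [x] orthogonal to [y]; its square is [|y|^2] times
   the Cauchy-Schwarz defect. *)
have : 0 <= ip ((`|y| ^+ 2) *: x - ip x y *: y) ((`|y| ^+ 2) *: x - ip x y *: y).
  by rewrite (ip_norm ipP) sqr_ge0.
rewrite ipBl !ipBr !ipZl !ipZr !(ip_norm ipP) (ip_sym ipP y x).
set a := `|x|; set b := `|y|; set c := ip x y => h.
have {}h : 0 <= b ^+ 2 * ((a * b) ^+ 2 - c ^+ 2).
  by apply: (le_trans h); rewrite le_eqVlt; apply/orP; left; apply/eqP; ring.
by rewrite -subr_ge0 -(pmulr_rge0 _ (_ : 0 < b ^+ 2))// exprn_gt0.
Qed.

Lemma norm_measurable_ip d (T : measurableType d) (f g : T -> H) :
  separable_space H -> norm_measurable setT f -> norm_measurable setT g ->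
  measurable_fun setT (fun x => ip (f x) (g x)).
Proof.
move=> sepH mf mg; under eq_fun do rewrite ipE.
have m2 (h : T -> H) : norm_measurable setT h ->
    measurable_fun setT (fun x => `|h x| ^+ 2).
  by move=> mh; apply: measurable_funX; exact: norm_measurable_norm.
apply: measurable_funM => //; apply: measurable_funB; last exact: m2.
apply: measurable_funB; last exact: m2.
by apply: m2; exact: norm_measurableD.
Qed.

End inner_product.

(** * Moments of Poisson variables *)

Section independence.
Context (R : realType) (d : measure_display) (T : measurableType d).
Variable P : probability T R.

(** Independence makes the joint law a product, so Fubini integrates the centred factor [g] first.
    The orthogonality relations below rest on this. *)
Lemma integral_indep_eq0 (f g : T -> R) :
  measurable_fun setT f -> measurable_fun setT g ->
  (forall A B, measurable A -> measurable B ->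
    P (f @^-1` A `&` g @^-1` B) = (P (f @^-1` A) * P (g @^-1` B))%E) ->
  P.-integrable setT (EFin \o g) ->
  P.-integrable setT (EFin \o (f \* g)) ->
  (\int[P]_w (g w)%:E = 0)%E -> (\int[P]_w (f w * g w)%:E = 0)%E.
Proof.
move=> mf mg ind ig ifg g0.
pose X : {mfun T >-> R} := mfun_Sub (mem_set mf).
pose Y : {mfun T >-> R} := mfun_Sub (mem_set mg).
have mXY : measurable_fun setT (fun w => (f w, g w)) by exact: measurable_fun_pair.
pose Z : {mfun T >-> (R * R)%type} := mfun_Sub (mem_set mXY).
pose m1 := distribution P X; pose m2 := distribution P Y.
have mE A : measurable A -> (m1 \x m2)%E A = distribution P Z A.
  by apply: product_measure_unique => /= B C mB mC; rewrite /distribution /pushforward/= -ind.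
pose F (p : (R * R)%type) : \bar R := (p.1 * p.2)%:E.
have mF : measurable_fun setT F.
  by apply/measurable_EFinP; apply: measurable_funM.
have iF : (m1 \x m2)%E.-integrable setT F.
  have := integrable_pushforward mXY mF ifg measurableT.
  move=> /integrableP [_ h]; apply/integrableP; split => //.
  apply: le_lt_trans h; rewrite le_eqVlt; apply/orP; left; apply/eqP.
  by apply: eq_measure_integral => /= A mA _; exact: mE.
transitivity (\int[distribution P Z]_p F p)%E.
  by rewrite integral_distribution.
transitivity (\int[m1 \x m2]_p F p)%E.
  by apply: eq_measure_integral => /= A mA _; rewrite mE.
rewrite -integral12_prod_meas1//= /fubini_F /F/=.
have ig' : m2.-integrable setT EFin by exact: integrable_pushforward.
under eq_integral => x _.
  under eq_integral do rewrite EFinM.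
  rewrite integralZl//= (_ : \int[m2]_y y%:E = 0)%E ?mule0; first over.
  by rewrite integral_distribution.
by rewrite integral0.
Qed.

End independence.

Section poisson_moments.
Context (R : realType) (d : measure_display) (T : measurableType d).
Variable P : probability T R.
Variables (Y : T -> R) (r : R).
Hypothesis mY : measurable_fun setT Y.
Hypothesis r0 : 0 <= r.
Hypothesis YP : forall n : nat, P [set w | Y w = n%:R] = poisson_prob r n [set n].
Local Open Scope ereal_scope.

Let D n := Y @^-1` [set n%:R].

Let mD n : measurable (D n).
Proof. by rewrite /D -[X in measurable X]setTI; exact: mY. Qed.

Let poisson_probE n : poisson_prob r n [set n] =
  (if (0 < r)%R then poisson_pmf r n else (n == 0%N)%:R)%:E.
Proof.
rewrite /poisson_prob; case: ifPn => _.
  by rewrite esum_set1// lee_fin poisson_pmf_ge0.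
by rewrite diracE in_set1 eq_sym.
Qed.

(** The degenerate rate [r = 0], where the law is the point mass at 0, is kept: it occurs for sets
    of intensity zero. *)
Let q n : R := if (0 < r)%R then poisson_pmf r n else (n == 0%N)%:R.

Let q0 n : (0 <= q n)%R.
Proof. by rewrite /q; case: ifPn => _; rewrite ?poisson_pmf_ge0. Qed.

Let tD : trivIset setT D.
Proof.
apply/trivIsetP => i j _ _ ij; apply/seteqP; split => // w [/= h1 h2].
have /eqP := etrans (esym h1) h2; by rewrite eqr_nat (negbTE ij).
Qed.

Let sum_q : \sum_(n <oo) (q n)%:E = 1.
Proof.
rewrite -(@probability_setT _ _ _ (poisson_prob r 0)).
rewrite (_ : setT = \bigcup_(n in setT) [set n]); last first.
  by apply/seteqP; split => // n _; exists n.
rewrite measure_bigcup//=; last first.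
  by apply/trivIsetP => i j _ _ ij; apply/seteqP; split => // n [/= -> /eqP]; rewrite (negbTE ij).
rewrite [RHS](@eq_eseriesl _ _ predT); last by move=> n; rewrite mem_set.
by apply: eq_eseriesr => n _; rewrite -poisson_probE.
Qed.

Let qS n : (n.+1%:R * q n.+1 = r * q n)%R.
Proof.
rewrite /q; case: ltrP => [rp|]; last first.
  by move=> rle; rewrite (_ : r = (0 : R)%R) ?mulr0 ?mul0r//; apply/eqP; rewrite eq_le rle r0.
rewrite /poisson_pmf rp exprS factS natrM invfM.
have : (n.+1%:R != 0 :> R)%R by rewrite pnatr_eq0.
have : (n`!%:R != 0 :> R)%R by rewrite pnatr_eq0 -lt0n fact_gt0.
by move=> h1 h2; field; apply/andP.
Qed.

Let PD : P (\bigcup_n D n) = 1.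
Proof.
rewrite measure_bigcup//=.
rewrite -sum_q [LHS](@eq_eseriesl _ _ predT); last by move=> n; rewrite mem_set.
apply: eq_eseriesr => n _.
by rewrite /D -poisson_probE -YP.
Qed.

Let ge0_integral_poisson (f : R -> R) : measurable_fun setT f ->
  (forall n, 0 <= f n%:R)%R -> (forall w, 0 <= f (Y w))%R ->
  \int[P]_w (f (Y w))%:E = \sum_(n <oo) (f n%:R * q n)%:E.
Proof.
move=> mf f0 fY0.
have mfY : measurable_fun setT (fun w => (f (Y w))%:E).
  by apply/measurable_EFinP; exact: measurableT_comp mf mY.
transitivity (\int[P]_(w in \bigcup_n D n) (f (Y w))%:E).
  have mU : measurable (\bigcup_n D n) by exact: bigcup_measurable.
  rewrite -(setvU (\bigcup_n D n)) ge0_integral_setU//=; last 4 first.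
  - exact: measurableC.
  - by rewrite setvU.
  - by move=> w _; rewrite lee_fin.
  - by rewrite disj_set2E setICl.
  rewrite [X in X + _](_ : _ = 0) ?add0e//.
  have P0 : P (~` (\bigcup_n D n)) = 0 by rewrite probability_setC// PD subee.
  apply: null_set_integral => //; first exact: measurableC.
  exact: measurable_funTS.
rewrite ge0_integral_bigcup//=; last 2 first.
- exact: measurable_funTS.
- by move=> w _; rewrite lee_fin.
apply: eq_eseriesr => n _.
rewrite (eq_integral (fun=> (f n%:R)%:E)); last by move=> w; rewrite inE /D/= => ->.
by rewrite integral_cst//= /q EFinM -poisson_probE -YP.
Qed.

(** The identity E[Y f(Y)] = r E[f(Y + 1)], obtained from the recursion [qS] by a shift of index.
    The first two moments are its cases f = 1 and f(n) = n. *)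
Let sum_shift (f : nat -> R) : (forall n, 0 <= f n)%R ->
  \sum_(n <oo) (n%:R * f n * q n)%:E = r%:E * \sum_(n <oo) (f n.+1 * q n)%:E.
Proof.
move=> f0.
rewrite -nneseriesZl//=; last by move=> n _; rewrite lee_fin mulr_ge0.
have E : (fun n => \sum_(0 <= k < n.+1) (k%:R * f k * q k)%:E) =
    (fun n => \sum_(0 <= k < n) (r%:E * (f k.+1 * q k)%:E)).
  apply/funext => n; rewrite big_nat_recl// !mul0r add0e.
  by apply: eq_bigr => k _; rewrite -EFinM mulrCA -qS; congr EFin; ring.
apply: cvg_lim => //; rewrite -cvg_shiftS E.
by apply: is_cvg_nneseries => n _ _; rewrite mule_ge0// lee_fin mulr_ge0.
Qed.

Let sum1 : \sum_(n <oo) (n%:R * q n)%:E = r%:E.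
Proof.
transitivity (\sum_(n <oo) (n%:R * 1 * q n)%:E).
  by apply: eq_eseriesr => n _; rewrite mulr1.
rewrite (@sum_shift (fun=> 1%R))//.
by under eq_eseriesr do rewrite mul1r; rewrite sum_q mule1.
Qed.

Let sum2 : \sum_(n <oo) (n%:R ^+ 2 * q n)%:E = (r ^+ 2 + r)%:E.
Proof.
transitivity (\sum_(n <oo) (n%:R * n%:R * q n)%:E).
  by apply: eq_eseriesr => n _; rewrite expr2.
rewrite (@sum_shift (fun n => n%:R))//.
under eq_eseriesr do rewrite -natr1 mulrDl mul1r EFinD.
rewrite nneseriesD; [|by move=> n _ _; rewrite lee_fin ?mulr_ge0..].
by rewrite sum1 sum_q -EFinD -EFinM mulrDr mulr1.
Qed.

Let aeY : {ae P, forall w, 0 <= Y w}%R.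
Proof.
exists (~` (\bigcup_n D n)); split.
- by apply: measurableC; exact: bigcup_measurable.
- by rewrite probability_setC ?PD ?subee//; exact: bigcup_measurable.
- by move=> w /= hw [n _ /= Yn]; apply: hw; rewrite Yn.
Qed.

Let int2 : \int[P]_w (Y w ^+ 2)%:E = (r ^+ 2 + r)%:E.
Proof.
by rewrite (@ge0_integral_poisson (fun x => (x ^+ 2)%R))//; move=> *; exact: sqr_ge0.
Qed.

Let int1 : \int[P]_w `|Y w|%:E = r%:E.
Proof.
rewrite (@ge0_integral_poisson (fun x => Num.norm x))//.
by under eq_eseriesr => n _ do rewrite ger0_norm//.
Qed.

Lemma poisson_integrable : P.-integrable setT (EFin \o Y).
Proof.
by apply/integrableP; split; [exact/measurable_EFinP|rewrite int1 ltry].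
Qed.

Lemma poisson_mean : \int[P]_w (Y w)%:E = r%:E.
Proof.
rewrite -int1; apply: ae_eq_integral => //.
- exact/measurable_EFinP.
- by apply/measurable_EFinP; exact: measurableT_comp.
- by apply: filterS aeY => w Yw _; rewrite ger0_norm.
Qed.

Lemma poisson_variance : \int[P]_w ((Y w - r) ^+ 2)%:E = r%:E.
Proof.
have i2 : P.-integrable setT (fun w => (Y w ^+ 2)%:E).
  apply/integrableP; split; first by apply/measurable_EFinP; exact: measurable_funX.
  by under eq_integral do rewrite gee0_abs ?lee_fin ?sqr_ge0//; rewrite int2 ltry.
have i1 : P.-integrable setT (fun w => ((- 2 * r)%:E * (Y w)%:E)).
  by apply: integrableZl => //; exact: poisson_integrable.
have ic : P.-integrable setT (fun w => (r ^+ 2)%:E).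
  exact: finite_measure_integrable_cst.
rewrite (eq_integral (fun w => ((Y w ^+ 2)%:E + (- 2 * r)%:E * (Y w)%:E) + (r ^+ 2)%:E)); last first.
  by move=> w _; rewrite -EFinM -!EFinD; congr EFin; ring.
rewrite integralD//; last exact: integrableD.
rewrite integralD// integralZl//; last exact: poisson_integrable.
rewrite poisson_mean int2 integral_cst// [X in _ + _ * X](_ : _ = 1) ?mule1; last exact: probability_setT.
by rewrite -EFinM -!EFinD; congr EFin; ring.
Qed.

End poisson_moments.

(** * Processes and time translation *)

Section translation.
Context (R : realType).
Local Notation mu := (@lebesgue_measure R).

Lemma measurable_addr_cst (h : R) :
  measurable_fun setT ((fun x => x + h) : measurableTypeR R -> measurableTypeR R).
Proof. by apply: measurable_funD. Qed.

(** Lebesgue measure is determined by its values on half-open intervals. *)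
Lemma lebesgue_measureD (h : R) (A : set R) : measurable A ->
  pushforward mu ((fun x => x + h) : measurableTypeR R -> measurableTypeR R) A = mu A.
Proof.
move=> mA; apply/esym/lebesgue_measure_unique => //=; first exact: measurable_addr_cst.
move=> _ _ [[a b]] _ <-.
have E : (fun x => x + h) @^-1` `]a, b]%classic = `]a - h, b - h]%classic.
  by apply/seteqP; split => x /=; rewrite !in_itv/= ltrBlDr lerBrDr.
rewrite /pushforward/= E !lebesgue_measure_itv/= !lte_fin ltrD2r -!EFinB.
by rewrite (_ : b - h - (a - h) = b - a)//; ring.
Qed.

Lemma preimage_addr_itvcc (a b h : R) :
  ((fun x => x + h) : measurableTypeR R -> measurableTypeR R) @^-1` `[a + h, b + h] = `[a, b]%classic.
Proof. by apply/seteqP; split => x /=; rewrite !in_itv/= !lerD2r. Qed.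

Lemma ge0_integral_shift (f : R -> \bar R) (a b h : R) :
  measurable_fun `[a + h, b + h]%classic f ->
  {in `[a + h, b + h]%classic, forall x, (0 <= f x)%E} ->
  (\int[mu]_(x in `[a, b]) f (x + h)%R = \int[mu]_(x in `[(a + h)%R, (b + h)%R]) f x)%E.
Proof.
move=> mf f0.
rewrite -(preimage_addr_itvcc a b h) -(@ge0_integral_pushforward _ _ _ _ _ (fun x : measurableTypeR R => x + h : measurableTypeR R) (measurable_addr_cst h))//.
apply: eq_measure_integral => [|? A mA AS]; first exact: measurable_addr_cst.
exact: lebesgue_measureD.
Qed.

Lemma integral_shift (f : R -> R) (a b h : R) :
  measurable_fun `[a + h, b + h]%classic f ->
  \int[mu]_(x in `[a, b]) f (x + h) = \int[mu]_(x in `[a + h, b + h]) f x.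
Proof.
move=> /measurable_EFinP mf; rewrite /Rintegral; congr fine.
rewrite [LHS]integralE [RHS]integralE; congr (_ - _)%E.
  apply: etrans (@ge0_integral_shift (EFin \o f)^\+%E _ _ _ _ _).
  - by apply: eq_integral => x _; rewrite ?funeposE ?funenegE.
  - exact: measurable_funepos.
  - by move=> x _; exact: funepos_ge0.
apply: etrans (@ge0_integral_shift (EFin \o f)^\-%E _ _ _ _ _).
- by apply: eq_integral => x _; rewrite ?funeposE ?funenegE.
- exact: measurable_funeneg.
- by move=> x _; exact: funeneg_ge0.
Qed.

Lemma integrable_shift (f : R -> R) (a b h : R) :
  mu.-integrable `[a + h, b + h] (EFin \o f) ->
  mu.-integrable `[a, b] (fun x => (f (x + h))%:E).
Proof.
move=> /integrableP[mf fi]; apply/integrableP; split; last first.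
  rewrite -(@ge0_integral_shift (fun x => `|(f x)%:E|%E)) in fi => //.
  exact: measurableT_comp.
have := @measurable_comp _ _ _ _ _ _ `[a + h, b + h]%classic _ `[a, b]%classic (fun x : measurableTypeR R => x + h : measurableTypeR R) _ _ mf.
apply => //; last exact: measurable_funTS (measurable_addr_cst h).
move=> _ [x /= + <-]; by rewrite !in_itv/= !lerD2r.
Qed.

End translation.

Section joint_measurability.
Context (R : realType) (d : measure_display) (T : measurableType d).
Context (E : normedModType R).

(** The first grid point strictly to the right of [s] when [k] is the floor of [(n + 1) s]. *)
Let step_time (n : nat) (k : int) : R := (k + 1)%:~R / n.+1%:R.

(** Sampling at the next grid point gives jointly measurable maps, because the sampling index takes
    countably many values; right continuity passes to the limit. *)
Lemma norm_measurable_process (Z : R -> T -> E) :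
  (forall t, norm_measurable setT (Z t)) ->
  (forall t w, Z s w @[s --> t^'+] --> Z t w) ->
  norm_measurable setT (fun p : (measurableTypeR R * T)%type => Z p.1 p.2).
Proof.
move=> mZ rc.
pose k (n : nat) (p : (measurableTypeR R * T)%type) : int := Num.floor (n.+1%:R * p.1).
have mk n j : measurable (k n @^-1` [set j]).
  rewrite (_ : _ @^-1` _ = [set s : R | j%:~R <= n.+1%:R * s < (j + 1)%:~R] `*` setT).
    apply: measurableX => //.
    rewrite (_ : [set s | _] = [set s : measurableTypeR R | j%:~R <= n.+1%:R * s] `&`
       [set s : measurableTypeR R | n.+1%:R * s < (j + 1)%:~R]).
      apply: measurableI; apply: measurable_set_bool.
        by apply: measurable_fun_ler => //; exact: measurable_funM.
      by apply: measurable_fun_ltr => //; exact: measurable_funM.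
    by apply/seteqP; split => s /= => [/andP[]|[-> ->]].
  apply/seteqP; split => -[s w] /=; rewrite /k/=.
    by move=> <-; rewrite Num.Theory.floor_itv.
  by move=> [h _]; apply: Num.Theory.floor_def.
apply: (@norm_measurable_cvg _ _ _ _ _ (fun n p => Z (step_time n (k n p)) p.2)) => //.
  move=> n y.
  apply: (@measurable_fun_glue _ _ _ _ _ (k n) (fun j p => `|Z (step_time n j) p.2 - y|)) => // j.
  exact: measurableT_comp (mZ (step_time n j) y) _.
move=> [s w] _ /=.
apply: (@cvg_comp _ _ _ (fun n => step_time n (k n (s, w))) (Z^~ w)); last exact: (rc s w).
have gt_s n : s < step_time n (k n (s, w)).
  rewrite /step_time ltr_pdivlMr ?ltr0n// mulrC.
  by have /andP[] := Num.Theory.floor_itv (n.+1%:R * s).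
have le_s n : step_time n (k n (s, w)) <= s + n.+1%:R^-1.
  rewrite /step_time ler_pdivrMr ?ltr0n// mulrDl mulVf ?pnatr_eq0//.
  rewrite intrD lerD2r mulrC.
  by have /andP[] := Num.Theory.floor_itv (n.+1%:R * s).
have cv : step_time n (k n (s, w)) @[n --> \oo] --> s.
  apply: (@squeeze_cvgr _ _ _ _ (fun=> s) (fun n => s + n.+1%:R^-1)).
  - by near=> n; rewrite le_s ltW.
  - exact: cvg_cst.
  - rewrite -[X in _ --> X]addr0; apply: cvgD; first exact: cvg_cst.
    exact: cvg_harmonic.
(* The filter [s^'+] excludes [s] itself, so convergence of the sampling times is not enough: they
   must stay strictly above [s], which is [gt_s]. *)
move=> A hA; pose u n := step_time n (k n (s, w)).
apply: (@filterS _ \oo _ (fun n => s < u n -> A (u n))); last exact: (cv _ hA).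
by move=> n; apply; exact: gt_s.
Unshelve. all: by end_near. Qed.

End joint_measurability.

Section change_of_probability.
Context (R : realType) (d : measure_display) (T : measurableType d).
Local Open Scope ereal_scope.

(** Serves to carry L^2 estimates from [P] to the conditional law, which is dominated by a multiple
    of [P]. *)
Lemma ge0_integral_le_scale (P Q : {measure set T -> \bar R}) (c : R) :
  (0 <= c)%R -> (forall A, measurable A -> Q A <= c%:E * P A) ->
  forall f : T -> \bar R, measurable_fun setT f -> (forall x, 0 <= f x) ->
  \int[Q]_x f x <= c%:E * \int[P]_x f x.
Proof.
move=> c0 QP f mf f0.
have -> : c%:E * \int[P]_x f x = \int[mscale (NngNum c0) P]_x f x.
  by rewrite ge0_integral_mscale.
by apply: ge0_le_measure_integral => // A mA; exact: QP.
Qed.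

End change_of_probability.

(** * Time averages of orthogonal families *)

Section mean_square.
Context (R : realType) (d : measure_display) (T : measurableType d).
Variable P : probability T R.
Variables (g : R -> T -> R) (a c h : R).
Local Notation mu := (@lebesgue_measure R).
Local Notation RT := (measurableTypeR R * T)%type.
Hypothesis a0 : 0 < a.
Hypothesis c0 : 0 <= c.
Hypothesis h0 : 0 < h.
Hypothesis mg : measurable_fun setT (fun p : RT => g p.1 p.2).
Hypothesis g0 : forall s w, ~ (0 <= s <= a) -> g s w = 0.
Hypothesis g2 : forall s, 0 <= s <= a -> (\int[P]_w (g s w ^+ 2)%:E <= c%:E)%E.
Hypothesis g_orth : forall s t, 0 <= s -> s + h <= t -> t <= a ->
  (\int[P]_w (g s w * g t w)%:E = 0)%E.
Local Open Scope ereal_scope.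

Let I : set (measurableTypeR R) := `[0%R, a]%classic.

Let mI : measurable I. Proof. exact: measurable_itv. Qed.

Let muI : mu I = a%:E.
Proof. by rewrite /I lebesgue_measure_itv/= lte_fin a0 sube0. Qed.

Let int_I : \int[mu]_s (\1_I s)%:E = a%:E.
Proof. by rewrite integral_indic// setIT; exact: muI. Qed.

Let iI : mu.-integrable setT (fun s => (\1_I s)%:E).
Proof.
apply/integrableP; split; first by apply/measurable_EFinP; exact: measurable_indic.
by under eq_integral do rewrite gee0_abs//; rewrite int_I ltry.
Qed.

Let II s : \1_I s = (if (0 <= s <= a)%R then 1 else 0 : R)%R.
Proof.
rewrite indicE; case: ifPn => sI; first by rewrite mem_set// /I/= in_itv.
by rewrite memNset// /I/= in_itv/=; exact/negP.
Qed.

Let mgs s : measurable_fun setT (g s).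
Proof.
apply: (@measurableT_comp _ _ _ _ _ _ (fun p : RT => g p.1 p.2) _ (fun w => (s, w))) => //.
exact: pair1_measurable.
Qed.

Let g2I s : \int[P]_w (g s w ^+ 2)%:E <= (c * \1_I s)%:E.
Proof.
rewrite II; case: ifPn => sI.
  by rewrite mulr1 g2.
rewrite mulr0 integral0_eq// => w _; rewrite g0 ?expr0n//; exact/negP.
Qed.

Let int_cI : \int[mu]_s (c * \1_I s)%:E = (c * a)%:E.
Proof.
under eq_integral do rewrite EFinM.
rewrite ge0_integralZl//; first by rewrite int_I.
by apply/measurable_EFinP; exact: measurable_indic.
Qed.

Let mg2 : measurable_fun setT (fun p : RT => (g p.1 p.2 ^+ 2)%:E).
Proof. by apply/measurable_EFinP; exact: measurable_funX. Qed.

Let int_g2 : \int[mu]_s \int[P]_w (g s w ^+ 2)%:E <= (c * a)%:E.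
Proof.
rewrite -int_cI; apply: ge0_le_integral => //.
- by move=> s _; apply: integral_ge0 => w _; rewrite lee_fin sqr_ge0.
- apply: (@measurable_fun_fubini_tonelli_F _ _ _ _ _ P (fun p : RT => (g p.1 p.2 ^+ 2)%:E)) => //.
  by move=> p; rewrite lee_fin sqr_ge0.
- by apply/measurable_EFinP; apply: measurable_funM => //; exact: measurable_indic.
Qed.

Let ig2 : (mu \x P)%E.-integrable setT (fun p : RT => (g p.1 p.2 ^+ 2)%:E).
Proof.
apply/integrable12ltyP => //=.
under eq_integral do under eq_integral do rewrite ger0_norm ?sqr_ge0//.
exact: le_lt_trans int_g2 (ltry _).
Qed.

Let integrable_prodI (Z : T -> R) : measurable_fun setT Z ->
  \int[P]_w (Z w ^+ 2)%:E < +oo ->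
  (mu \x P)%E.-integrable setT (fun p : RT => (\1_I p.1 * Z p.2 ^+ 2)%:E).
Proof.
move=> mZ Z2; apply/integrable12ltyP => //=.
  apply/measurable_EFinP; apply: measurable_funM.
    exact: (@measurableT_comp _ _ _ _ _ _ (\1_I : _ -> R) _ fst).
  by apply: measurable_funX; exact: measurableT_comp.
have Z0 : 0 <= \int[P]_w (Z w ^+ 2)%:E.
  by apply: integral_ge0 => w _; rewrite lee_fin sqr_ge0.
have mZ2 : measurable_fun setT (fun w => (Z w ^+ 2)%:E).
  by apply/measurable_EFinP; exact: measurable_funX.
rewrite (eq_integral (fun s => (\1_I s)%:E * \int[P]_w (Z w ^+ 2)%:E)); last first.
  move=> s _; rewrite -ge0_integralZl//; last by move=> w _; rewrite lee_fin sqr_ge0.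
  apply: eq_integral => w _; rewrite -EFinM; congr EFin; apply: ger0_norm; apply: mulr_ge0; [by rewrite indicE ler0n | exact: sqr_ge0].
rewrite ge0_integralZr//; first by rewrite int_I lte_mul_pinfty// lee_fin ltW.
by apply/measurable_EFinP; exact: measurable_indic.
Qed.

(** On [[0, a]] the product is bounded by [Z^2 + g^2], and [g] vanishes elsewhere. *)
Let iZg (Z : T -> R) : measurable_fun setT Z ->
  \int[P]_w (Z w ^+ 2)%:E < +oo ->
  (mu \x P)%E.-integrable setT (fun p : RT => (Z p.2 * g p.1 p.2)%:E).
Proof.
move=> mZ Z2.
apply: (le_integrable measurableT _ _ (integrableD measurableT (integrable_prodI mZ Z2) ig2)) => //.
  by apply/measurable_EFinP; apply: measurable_funM => //; exact: measurableT_comp.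
move=> [s w] _ /=; rewrite lee_fin [leRHS]ger0_norm; last first.
  by apply: addr_ge0; [apply: mulr_ge0; rewrite ?indicE ?ler0n|]; rewrite ?sqr_ge0.
rewrite II; case: ifPn => sI.
  rewrite mul1r; set x := Z w; set y := g s w.
  have := sqr_ge0 (x - y); have := sqr_ge0 (x + y); rewrite sqrrB sqrrD => *.
  by rewrite ler_norml; apply/andP; split; nra.
by rewrite mul0r add0r g0 ?mulr0 ?normr0 ?sqr_ge0//; exact/negP.
Qed.

Let ig : (mu \x P)%E.-integrable setT (fun p : RT => (g p.1 p.2)%:E).
Proof.
have i1 : \int[P]_(w in setT) ((fun _ : T => 1%R) w ^+ 2)%:E < +oo :> \bar R.
  under eq_integral do rewrite expr1n.
  by rewrite integral_cst// mul1e (le_lt_trans (probability_le1 _ _)) ?ltry.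
have := iZg (measurable_cst _) i1; apply: eq_integrable => // p _ /=.
by rewrite mul1r.
Qed.

Let z w : R := fine (\int[mu]_s (g s w)%:E).

Let mz : measurable_fun setT z.
Proof.
apply: measurableT_comp; first exact: fine_measurable.
exact: (measurable_fubini_G ig).
Qed.

(** Used twice to open the square of [z] into a double time integral: with [Z = z], then with
    [Z = g s]. *)
Let swap (Z : T -> R) : measurable_fun setT Z ->
  \int[P]_w (Z w ^+ 2)%:E < +oo ->
  \int[P]_w (Z w * z w)%:E = \int[mu]_s \int[P]_w (Z w * g s w)%:E.
Proof.
move=> mZ Z2; rewrite (Fubini (iZg mZ Z2)).
have mL : measurable_fun setT (fun w => (Z w * z w)%:E).
  by apply/measurable_EFinP; exact: measurable_funM.
apply: ae_eq_integral => //; first exact: (measurable_fubini_G (iZg mZ Z2)).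
have := ae_integrable2 ig; apply: filterS => w /= iw _.
under eq_integral do rewrite EFinM.
by rewrite integralZl// EFinM fineK// integrable_fin_num.
Qed.

Let gs2_lty s : \int[P]_w (g s w ^+ 2)%:E < +oo.
Proof. exact: le_lt_trans (g2I s) (ltry _). Qed.

Let z2 : \int[P]_w (z w ^+ 2)%:E < +oo.
Proof.
have h2 : \int[P]_w (a%:E * \int[mu]_s (g s w ^+ 2)%:E) < +oo.
  rewrite ge0_integralZl//; last 3 first.
  - apply: (@measurable_fun_fubini_tonelli_G _ _ _ _ _ mu (fun p : RT => (g p.1 p.2 ^+ 2)%:E)) => //.
    by move=> p; rewrite lee_fin sqr_ge0.
  - by move=> w _; apply: integral_ge0 => s _; rewrite lee_fin sqr_ge0.
  - by rewrite lee_fin ltW.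
  rewrite lte_mul_pinfty ?lee_fin ?ltW//.
  rewrite -(@fubini_tonelli _ _ _ _ _ _ _ (fun p : RT => (g p.1 p.2 ^+ 2)%:E))//.
    exact: le_lt_trans int_g2 (ltry _).
  by move=> p; rewrite lee_fin sqr_ge0.
apply: le_lt_trans h2; apply: ae_ge0_le_integral => //.
- by move=> w _; rewrite lee_fin sqr_ge0.
- by apply/measurable_EFinP; exact: measurable_funX.
- move=> w _; apply: mule_ge0; first by rewrite lee_fin ltW.
  by apply: integral_ge0 => s _; rewrite lee_fin sqr_ge0.
- apply: emeasurable_funM => //.
  apply: (@measurable_fun_fubini_tonelli_G _ _ _ _ _ mu (fun p : RT => (g p.1 p.2 ^+ 2)%:E)) => //.
  by move=> p; rewrite lee_fin sqr_ge0.
have := ae_integrable2 ig2; have := ae_integrable2 ig.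
apply: filterS2 => w /= i1 i2 _.
have zE : \int[mu]_s (g s w)%:E = (z w)%:E by rewrite fineK// integrable_fin_num.
have yE : \int[mu]_s (g s w ^+ 2)%:E = (fine (\int[mu]_s (g s w ^+ 2)%:E))%:E.
  by rewrite fineK// integrable_fin_num.
rewrite yE; set y := fine _ in yE *; rewrite -EFinM lee_fin.
(* The integral of [(g s w - z w / a)^2] over [[0, a]] is nonnegative; expanded, this is
   Cauchy-Schwarz in time, [z^2 <= a * y]. *)
pose k1 : R := (- 2 * z w / a)%R; pose k2 : R := (z w ^+ 2 / a ^+ 2)%R.
have : 0 <= \int[mu]_s ((g s w ^+ 2)%:E + k1%:E * (g s w)%:E + k2%:E * (\1_I s)%:E).
  apply: integral_ge0 => s _; rewrite -!EFinM -!EFinD lee_fin II.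
  case: ifPn => sI; last by rewrite g0 ?mulr0 ?addr0 ?sqr_ge0//; exact/negP.
  rewrite (_ : _ + _ = (g s w - z w / a) ^+ 2)%R ?sqr_ge0//.
  by rewrite /k1 /k2; field; rewrite gt_eqF.
rewrite integralD//; last 2 first.
- by apply: integrableD => //; exact: integrableZl.
- exact: integrableZl.
rewrite integralD//; last exact: integrableZl.
rewrite !integralZl// int_I zE yE -!EFinM -!EFinD lee_fin.
rewrite (_ : _ + _ = (a * y - z w ^+ 2) / a)%R; last by rewrite /k1 /k2; field; rewrite gt_eqF.
by rewrite pmulr_lge0 ?invr_gt0// subr_ge0.
Qed.

(** The square is a double integral of covariances of [g s] and [g t]. Orthogonality confines it to
    the band [|s - t| <= h], of area at most [2 * h * a], where each covariance is at most [c].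
    Compared with the trivial bound [a^2 * c], a factor [h] is gained. *)
Lemma mean_square_time_integral0 :
  \int[P]_w (z w ^+ 2)%:E <= (2 * h * a * c)%:E.
Proof.
have Ik s t : `|\int[P]_w (g s w * g t w)%:E| <= c%:E * (\1_(`[(s - h)%R, (s + h)%R]) t)%:E.
  have [st|st] := boolP (t \in `[(s - h)%R, (s + h)%R]%classic); last first.
    have [sI|sI] := pselect (0 <= s <= a)%R; last first.
      by rewrite integral0_eq => [|w _]; rewrite ?abse0 ?mule_ge0 ?lee_fin// g0// mul0r.
    have [tI|tI] := pselect (0 <= t <= a)%R; last first.
      by rewrite integral0_eq => [|w _]; rewrite ?abse0 ?mule_ge0 ?lee_fin// (g0 _ tI) mulr0.
    have : (s + h <= t)%R \/ (t + h <= s)%R.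
      move: st; rewrite notin_setE/= in_itv/= => /negP; rewrite negb_and -!ltNge => /orP[]; lra.
    case/andP: sI => s0 sa; case/andP: tI => t0 ta.
    case=> st'.
      by rewrite g_orth// abse0 mule_ge0// lee_fin.
    under eq_integral do rewrite mulrC.
    by rewrite g_orth// abse0 mule_ge0// lee_fin.
  rewrite indicE st mule1.
  have mst : measurable_fun setT (fun w => (g s w * g t w)%:E).
    by apply/measurable_EFinP; exact: measurable_funM.
  apply: (le_trans (le_abse_integral _ _ _)) => //.
  apply: (@le_trans _ _ (\int[P]_w ((2^-1)%:E * ((g s w ^+ 2)%:E + (g t w ^+ 2)%:E)))).
    apply: ge0_le_integral => //.
    - exact: measurableT_comp.
    - apply: emeasurable_funM => //; apply: emeasurable_funD; apply/measurable_EFinP; exact: measurable_funX.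
    move=> w _; rewrite -EFinD -EFinM lee_fin.
    set x := g s w; set y := g t w.
    have := sqr_ge0 (x - y); have := sqr_ge0 (x + y); rewrite sqrrB sqrrD => *.
    by rewrite ler_norml; apply/andP; split; lra.
  have m2 r : measurable_fun setT (fun w => (g r w ^+ 2)%:E).
    by apply/measurable_EFinP; exact: measurable_funX.
  rewrite ge0_integralZl//; last 2 first.
  - exact: emeasurable_funD.
  - by move=> w _; rewrite -EFinD lee_fin addr_ge0 ?sqr_ge0.
  rewrite ge0_integralD//; [|by move=> w _; rewrite lee_fin sqr_ge0..].
  have gc r : \int[P]_w (g r w ^+ 2)%:E <= c%:E.
    apply: (le_trans (g2I r)); rewrite lee_fin indicE.
    by case: (_ \in _); rewrite ?mulr1 ?mulr0.
  rewrite (_ : c%:E = (2^-1)%:E * (c%:E + c%:E)); last first.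
    by rewrite -EFinD -EFinM; congr EFin; lra.
  by rewrite lee_pmul2l// leeD.
have Ez s : \int[P]_w (g s w * z w)%:E <= (2 * h * c)%:E.
  rewrite swap//; apply: le_trans (lee_abs _) _.
  apply: (le_trans (le_abse_integral _ _ _)) => //.
    exact: (measurable_fubini_F (iZg (mgs s) (gs2_lty s))).
  apply: (@le_trans _ _ (\int[mu]_t (c%:E * (\1_(`[(s - h)%R, (s + h)%R]) t)%:E))).
    apply: ge0_le_integral => //.
    - apply: measurableT_comp => //.
      exact: (measurable_fubini_F (iZg (mgs s) (gs2_lty s))).
    - by apply: emeasurable_funM => //; apply/measurable_EFinP; exact: measurable_indic.
  rewrite ge0_integralZl//; last by apply/measurable_EFinP; exact: measurable_indic.
  rewrite (_ : integral _ _ _ = (2 * h)%:E); first by rewrite -EFinM lee_fin; lra.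
  have ml : mu `[(s - h)%R, (s + h)%R]%classic = (2 * h)%:E.
    rewrite lebesgue_measure_itv/= lte_fin ifT; last by rewrite ltrD2l gtrN.
    by rewrite -EFinB; congr EFin; lra.
  by rewrite integral_indic// setIT; exact: ml.
under eq_integral do rewrite expr2.
rewrite swap//.
apply: le_trans (_ : \int[mu]_s (2 * h * c * \1_I s)%:E <= _); last first.
  under eq_integral do rewrite EFinM.
  rewrite ge0_integralZl//; last 2 first.
  - by apply/measurable_EFinP; exact: measurable_indic.
  - by rewrite lee_fin !mulr_ge0// ltW.
  by rewrite int_I -EFinM lee_fin; lra.
have k0 : (0 <= 2 * h * c)%R by rewrite !mulr_ge0// ltW.
apply: le_integral => //.
- exact: (integrable_fubini_F (iZg mz z2)).
- by under eq_fun do rewrite EFinM; exact: integrableZl.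
move=> s _; rewrite II; case: ifPn => sI.
  rewrite mulr1; under eq_integral do rewrite mulrC; exact: Ez.
rewrite mulr0 integral0_eq// => w _; rewrite g0 ?mulr0//; exact/negP.
Qed.

End mean_square.

(** * Bochner integrals *)

Section lower_integral.
Context (R : realType) (d : measure_display) (T : measurableType d).
Variable mu : {measure set T -> \bar R}.
Local Open Scope ereal_scope.

(* No measurability is needed: the integral of a nonnegative function is the
   supremum of the integrals of the simple functions below it. *)
Lemma ge0_integral_mono (D : set T) (f g : T -> \bar R) :
  (forall x, D x -> 0 <= f x) -> (forall x, D x -> f x <= g x) ->
  \int[mu]_(x in D) f x <= \int[mu]_(x in D) g x.
Proof.
move=> f0 fg; have g0 x : D x -> 0 <= g x by move=> Dx; exact: le_trans (f0 _ Dx) (fg _ Dx).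
rewrite !ge0_integralE//; apply: le_ereal_sup => _ [h /= hf <-].
exists h => //= x; apply: (le_trans (hf x)); rewrite !patchE.
by case: ifPn => //; rewrite inE => /fg.
Qed.

End lower_integral.

Section strong_measurability.
Context (R : realType) (d : measure_display) (T : measurableType d).
Context (E : normedModType R).

(** Convergence is asked at every point and no measure enters; a Bochner integrand is brought to
    this form by changing it on a null set and outside the domain. *)
Definition strongly_measurable (g : T -> E) := exists s : nat -> step_fun T E,
  (forall n (i : 'I_(step_size (s n))), measurable (step_set i)) /\
  forall x, step_eval (s n) x @[n --> \oo] --> g x.

(** The sets of a step function may overlap, so its value at a point depends on the whole membership
    pattern and not on one index; there are finitely many patterns. *)
Definition step_pattern (s : step_fun T E) (x : T) : {ffun 'I_(step_size s) -> bool} :=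
  [ffun i => x \in step_set i].

Definition step_pattern_val (s : step_fun T E) (u : {ffun 'I_(step_size s) -> bool}) : E :=
  \sum_(i < step_size s) ((u i)%:R : R) *: step_val i.

Lemma step_evalE (s : step_fun T E) x :
  step_eval s x = step_pattern_val (step_pattern s x).
Proof. by apply: eq_bigr => i _; rewrite indicE ffunE. Qed.

Lemma measurable_fun_step_pattern (s : step_fun T E) d' (T' : measurableType d')
    (F : {ffun 'I_(step_size s) -> bool} -> T -> T') :
  (forall i : 'I_(step_size s), measurable (step_set i)) ->
  (forall u, measurable_fun setT (F u)) ->
  measurable_fun setT (fun x => F (step_pattern s x) x).
Proof.
move=> ms mF; apply: measurable_fun_glue => // u.
rewrite (_ : _ @^-1` _ = \bigcap_(i in [set: 'I_(step_size s)])
    (if u i then step_set i else ~` step_set i)).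
  apply: fin_bigcap_measurable; first exact: finite_finset.
  by move=> i _; case: (u i) => //; exact: measurableC.
apply/seteqP; split=> x /=.
  move=> <- i _; rewrite ffunE; case: ifPn; first by rewrite inE.
  by rewrite notin_setE.
move=> h; apply/ffunP => i; rewrite ffunE; have := h i I; case: (u i) => hx.
  by rewrite mem_set.
by rewrite memNset.
Qed.

Lemma measurable_fun_step (s : step_fun T E) d' (T' : measurableType d') (F : E -> T') :
  (forall i : 'I_(step_size s), measurable (step_set i)) ->
  measurable_fun setT (fun x => F (step_eval s x)).
Proof.
move=> ms; under eq_fun do rewrite step_evalE.
exact: (@measurable_fun_step_pattern s _ _ (fun u _ => F (step_pattern_val u))).
Qed.

Lemma strongly_measurable_norm_measurable g :
  strongly_measurable g -> norm_measurable setT g.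
Proof.
move=> [s [ms sg]]; apply: (@norm_measurable_cvg _ _ _ _ _ (fun n => step_eval (s n))) => //.
by move=> n y; apply: (measurable_fun_step (fun z => `|z - y|)).
Qed.

(** The approximants take countably many values altogether. This stands in for a separability
    assumption on the dual [W]. *)
Lemma strongly_measurable_separable g : strongly_measurable g ->
  exists e : nat -> E, forall x r, 0 < r -> exists k, `|g x - e k| < r.
Proof.
move=> [s [ms sg]].
pose U := {n : nat & {ffun 'I_(step_size (s n)) -> bool}}.
pose V (u : U) := step_pattern_val (tagged u).
have cV : countable (range V) by exact: (sub_countable (card_image_le _ _) (countableP _)).
have [e De] := countable_enumeration cV.
exists e => x r r0; have /cvgrPdist_lt/(_ _ r0) := sg x.
move=> [n _ /(_ n (leqnn n)) /= hn].
have [|k _ ek] := De (step_eval (s n) x).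
  exists (Tagged (fun n => {ffun 'I_(step_size (s n)) -> bool}) (step_pattern (s n) x)) => //.
  by rewrite step_evalE.
by exists k; rewrite ek.
Qed.

Lemma strongly_measurable_functional g (phi : E -> R) :
  strongly_measurable g -> continuous phi -> measurable_fun setT (phi \o g).
Proof.
move=> [s [ms sg]] cphi.
apply: (@measurable_fun_cvg _ _ _ _ (fun n => phi \o step_eval (s n))).
  by move=> n; exact: measurable_fun_step.
by move=> x _; apply: (@cvg_comp _ _ _ (fun n => step_eval (s n) x) phi _ _ _ (sg x)); exact: cphi.
Qed.

Definition step_restrict (s : step_fun T E) (D : set T) : step_fun T E :=
  @StepFun T E (step_size s) (fun i => @step_set _ _ s i `&` D) (@step_val _ _ s).

Lemma step_eval_restrict s D x :
  step_eval (step_restrict s D) x = (\1_D x : R) *: step_eval s x.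
Proof.
rewrite /step_eval scaler_sumr; apply: eq_bigr => i _ /=.
by rewrite indicI/= scalerA mulrC.
Qed.

End strong_measurability.

Section bochner.
Context (R : realType) (d : measure_display) (T : measurableType d).
Context (E : normedModType R) (mu : {measure set T -> \bar R}).
Variables (D : set T) (mD : measurable D).
Local Open Scope ereal_scope.

(** Setting the integrand to 0 off [D] and on the exceptional null set, and restricting the step
    functions accordingly, turns almost everywhere convergence into convergence everywhere. *)
Lemma bochner_strongly_measurable (f : T -> E) y : is_bochner mu D f y ->
  exists g : T -> E, strongly_measurable g /\
   exists N, [/\ measurable N, mu N = 0, (forall x, D x -> ~ N x -> g x = f x) &
     (forall x, ~ (D `\` N) x -> g x = 0%R)].
Proof.
move=> [s [ms sf _ _]]; have [N [mN N0 hN]] := sf.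
exists (fun x => (\1_(D `\` N) x : R) *: f x)%R; split.
  exists (fun n => step_restrict (s n) (D `\` N)); split.
    move=> n i /=; have [mi _ _] := ms n i.
    by apply: measurableI => //; exact: measurableD.
  move=> x; under eq_fun do rewrite step_eval_restrict.
  have [h|h] := pselect ((D `\` N) x); last first.
    by rewrite indicE memNset// !scale0r; under eq_fun do rewrite scale0r; exact: cvg_cst.
  rewrite indicE mem_set//= !scale1r; under eq_fun do rewrite scale1r.
  by case: h => Dx Nx; apply: contrapT => hx; apply: Nx; apply: hN => /= /(_ Dx).
exists N; split => // x Nx; rewrite indicE.
  by move=> nNx; rewrite mem_set ?scale1r//.
by rewrite memNset ?scale0r.
Qed.

Lemma integrable_step_indic (S : set T) : measurable S -> mu S < +oo ->
  mu.-integrable D (fun x => (\1_S x)%:E).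
Proof.
move=> mS Soo; apply: (integrableS measurableT mD) => //.
apply/integrableP; split; first by apply/measurable_EFinP; exact: measurable_indic.
under eq_integral do rewrite gee0_abs ?lee_fin//.
by rewrite integral_indic// setIT.
Qed.

Lemma step_integral_functional (s : step_fun T E) (phi : E -> R) :
  (forall a x y, phi (a *: x + y) = a * phi x + phi y)%R -> step_in mu D s ->
  mu.-integrable D (fun x => (phi (step_eval s x))%:E) /\
  \int[mu]_(x in D) (phi (step_eval s x))%:E = (phi (step_integral mu s))%:E.
Proof.
move=> lphi ms.
have phi0 : phi 0%R = 0%R.
  have := lphi 1%R 0%R 0%R; rewrite scaler0 addr0 mul1r => h.
  by apply: (@addrI _ (phi 0%R)); rewrite addr0 -h.
have phiS I (r : seq I) (c : I -> R) (z : I -> E) :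
    phi (\sum_(i <- r) c i *: z i)%R = (\sum_(i <- r) c i * phi (z i))%R.
  by elim: r => [|i r IH]; rewrite ?big_nil// !big_cons lphi IH.
have iI (i : 'I_(step_size s)) : mu.-integrable D (fun x => (phi (step_val i))%:E * (\1_(step_set i) x)%:E).
  have [mi Di fi] := ms i.
  by apply: integrableZl => //; exact: integrable_step_indic.
under eq_fun => x do rewrite /step_eval phiS -sumEFin.
split.
  apply: integrable_sum => // i _; apply: eq_integrable (iI i) => // x _.
  by rewrite -EFinM mulrC.
rewrite integral_sum//; last first.
  by move=> i; apply: eq_integrable (iI i) => // x _; rewrite -EFinM mulrC.
rewrite /step_integral phiS -sumEFin; apply: eq_bigr => i _.
have [mi Di fi] := ms i.
under eq_integral do rewrite mulrC EFinM.
rewrite integralZl//; last first.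
  exact: integrable_step_indic.
rewrite integral_indic// (setIidl Di) mulrC EFinM fineK// ge0_fin_numE//.
Qed.

(** Clear for step functions, then a limit in L^1. The integrand of the conclusion is a strongly
    measurable version [g], since [is_bochner] controls [f] only up to a null set. *)
Lemma bochner_functional (f g : T -> E) y (phi : E -> R) (c : R) :
  is_bochner mu D f y -> strongly_measurable g ->
  {ae mu, forall x, D x -> g x = f x} ->
  (forall a x y, phi (a *: x + y) = a * phi x + phi y)%R ->
  (forall x, `|phi x| <= c * `|x|)%R -> (0 <= c)%R ->
  mu.-integrable D (fun x => (phi (g x))%:E) /\
  \int[mu]_(x in D) (phi (g x))%:E = (phi y)%:E.
Proof.
move=> bf smg gf lphi bphi c0.
have lB x z : phi (x - z)%R = (phi x - phi z)%R.
  by rewrite addrC -scaleN1r lphi mulN1r addrC.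
have cphi : continuous phi.
  move=> x; apply/cvgrPdist_le => eps eps0; near=> z.
  rewrite -lB; apply: (le_trans (bphi _)).
  (* The bound [c] may vanish, whence the radius [eps / (c + 1)]. *)
  apply: (@le_trans _ _ (c * (eps / (c + 1)))%R).
    apply: ler_wpM2l => //; near: z; apply: cvgr_dist_le; first exact: cvg_id.
    by rewrite divr_gt0// ltr_wpDl.
  have c1 : (0 < c + 1)%R by rewrite ltr_wpDl.
  by rewrite mulrA ler_pdivrMr// mulrC ler_wpM2l ?lerDl// ltW.
have [s [ms _ sf0 sy]] := bf.
have mphig : measurable_fun setT (fun x => phi (g x)) by exact: (strongly_measurable_functional smg cphi).
have mgs n : measurable_fun setT (fun x => `|g x - step_eval (s n) x|%R).
  under eq_fun => x do rewrite (step_evalE (s n)).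
  apply: (@measurable_fun_step_pattern _ _ _ _ (s n) _ _ (fun u x => `|g x - step_pattern_val u|%R)).
    by move=> i; have [] := ms n i.
  by move=> u; exact: strongly_measurable_norm_measurable.
have gf0 n : \int[mu]_(x in D) (`|g x - step_eval (s n) x|)%:E <=
             \int[mu]_(x in D) (`|f x - step_eval (s n) x|)%:E.
  have [N [mN N0 hN]] := gf.
  (* The indicator of the complement of [N] does not change the integral of the measurable side, and
     it puts the integrand below that of [f] at every point of [D], as monotonicity of lower
     integrals requires. *)
  have mh : measurable_fun setT (fun x => (\1_(~` N) x * `|g x - step_eval (s n) x|)%R).
    by apply: measurable_funM => //; apply: measurable_indic; exact: measurableC.
  rewrite (_ : \int[mu]_(x in D) _ =
      \int[mu]_(x in D) (\1_(~` N) x * `|g x - step_eval (s n) x|)%:E); last first.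
    apply: ae_eq_integral => //.
    - by apply/measurable_EFinP; exact: measurable_funTS (mgs n).
    - by apply/measurable_EFinP; exact: measurable_funTS.
    exists N; split => // x /= hx; apply: contrapT => Nx; apply: hx => _.
    by rewrite indicE mem_set// mul1r.
  apply: ge0_integral_mono => x Dx; first by rewrite lee_fin mulr_ge0// indicE ler0n.
  rewrite lee_fin indicE; have [Nx|Nx] := pselect (N x).
    by rewrite memNset ?mul0r//=; exact.
  rewrite mem_set// mul1r (_ : g x = f x)//; apply: contrapT => h.
  by apply: Nx; apply: hN => /= /(_ Dx).
have g0 : \int[mu]_(x in D) (`|g x - step_eval (s n) x|)%:E @[n --> \oo] --> 0.
  apply: (@squeeze_cvge _ _ _ _ (fun=> 0) _ _ _ _ _ sf0); last exact: cvg_cst.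
  near=> n; rewrite gf0 andbT; apply: integral_ge0 => x _; by rewrite lee_fin.
have ids n : \int[mu]_(x in D) (`|g x - step_eval (s n) x|)%:E < +oo ->
    mu.-integrable D (fun x => (phi (g x) - phi (step_eval (s n) x))%:E).
  move=> oo.
  apply: (@le_integrable _ _ _ mu D mD _ (fun x => (c * `|g x - step_eval (s n) x|)%:E)).
  - apply/measurable_EFinP; apply: measurable_funTS; apply: measurable_funB => //.
    by apply: measurable_fun_step => i; have [] := ms n i.
  - move=> x _; rewrite /= lee_fin -lB.
    by rewrite [leRHS]ger0_norm ?mulr_ge0.
  under eq_fun do rewrite EFinM; apply: integrableZl => //.
  apply/integrableP; split; first by apply/measurable_EFinP; exact: measurable_funTS (mgs n).
  by under eq_integral do rewrite gee0_abs ?lee_fin//.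
(* From some index on the L^1 distance is finite; one such step function already shows that
   [phi \o g] is integrable. *)
have [n0 _ hn0] : \forall n \near \oo, \int[mu]_(x in D) (`|g x - step_eval (s n) x|)%:E < +oo.
  have /fine_cvgP[+ _] := g0; apply: filterS => n; by rewrite fin_numElt => /andP[].
have ig : mu.-integrable D (fun x => (phi (g x))%:E).
  have := integrableD mD (ids n0 (hn0 _ (leqnn _))) (step_integral_functional lphi (ms n0)).1.
  by apply: eq_integrable => // x _; rewrite /= -EFinD subrK.
split => //.
have dist n : (n0 <= n)%N ->
  `|\int[mu]_(x in D) (phi (g x))%:E - (phi (step_integral mu (s n)))%:E| <=
  c%:E * \int[mu]_(x in D) (`|g x - step_eval (s n) x|)%:E.
  move=> nn; have [is1 <-] := step_integral_functional lphi (ms n).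
  rewrite -integralB//.
  apply: (le_trans (le_abse_integral _ _ _)) => //.
    by apply: measurable_int; exact: (ids n (hn0 _ nn)).
  rewrite -ge0_integralZl//; last first.
    by apply/measurable_EFinP; exact: measurable_funTS (mgs n).
  apply: ge0_le_integral => //.
  - apply: measurableT_comp => //; apply: measurable_int; exact: (ids n (hn0 _ nn)).
  - by apply: emeasurable_funM => //; apply/measurable_EFinP; exact: measurable_funTS (mgs n).
  - by move=> x _; rewrite -EFinM -EFinB abse_EFin lee_fin -lB.
have ifin : \int[mu]_(x in D) (phi (g x))%:E \is a fin_num by exact: integrable_fin_num.
rewrite -(fineK ifin); congr EFin; apply/eqP; rewrite eq_sym; apply/eqP.
set I := fine _ in dist *.
have c1 : phi (step_integral mu (s n)) @[n --> \oo] --> phi y.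
  by apply: (@cvg_comp _ _ _ (fun n => step_integral mu (s n)) phi _ _ _ sy); exact: cphi.
apply: (cvg_unique _ c1) => //; apply/subr_cvg0; apply/norm_cvg0P.
have /fine_cvgP[gfin gcv] := g0.
have ch : (c * fine (\int[mu]_(x in D) (`|g x - step_eval (s n) x|)%:E))%R @[n --> \oo] --> 0%R.
  by rewrite -(mulr0 c); apply: cvgMr.
apply: (@squeeze_cvgr _ _ _ _ (fun=> 0%R) _ _ _ _ (cvg_cst _) ch).
near=> n; rewrite normr_ge0/=.
have nn : (n0 <= n)%N by near: n; exists n0.
have := dist n nn; rewrite -(fineK ifin) -/I -EFinB abse_EFin.
have fI : \int[mu]_(x in D) (`|g x - step_eval (s n) x|)%:E \is a fin_num by near: n.
by rewrite -(fineK fI) -EFinM lee_fin distrC.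
Unshelve. all: by end_near. Qed.

End bochner.

(** * Lebesgue differentiation *)

Section averages.
Context (R : realType).
Local Notation mu := (@lebesgue_measure R).
Local Open Scope ereal_scope.

Lemma lebesgue_measure_segment (a b : R) : (a <= b)%R ->
  mu `[a, b]%classic = (b - a)%:E.
Proof.
rewrite lebesgue_measure_itv/= lte_fin le_eqVlt => /predU1P[->|->].
  by rewrite ltxx subrr.
by rewrite EFinB.
Qed.

Let left_segment (t : R) (n : nat) : set R := `[(t - n.+1%:R^-1)%R, t]%classic.

Let left_segment_shrinking (t : R) : nicely_shrinking t (left_segment t).
Proof.
have h0 n : (0 < 2 / n.+1%:R :> R)%R by rewrite divr_gt0 ?ltr0n.
have i0 n : (0 < n.+1%:R^-1 :> R)%R by rewrite invr_gt0 ltr0n.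
split; first by move=> n; exact: measurable_itv.
(* The segment has length [1 / (n + 1)] and lies in the ball of radius [2 / (n + 1)], whose measure
   [4 / (n + 1)] is 4 times as large. *)
exists (4%R, fun n => PosNum (h0 n)); split => //=.
- rewrite -[X in _ --> X](mulr0 2%R); apply: cvgMr; exact: cvg_harmonic.
- move=> n r; rewrite /left_segment/= in_itv/= => /andP[r1 r2].
  rewrite /ball/= ger0_norm ?subr_ge0//.
  apply: (@le_lt_trans _ _ (n.+1%:R^-1)%R); first by rewrite lerBlDr addrC -lerBlDr.
  by rewrite ltr_pMl// ltr1n.
- move=> n; rewrite lebesgue_measure_ball; last exact: ltW.
  rewrite lebesgue_measure_segment; last by rewrite lerBlDr lerDl ltW.
  by rewrite -EFinM lee_fin opprB addrCA subrr addr0 -mulrnAl ler_wpM2r ?invr_ge0// -mulr_natr -natrM.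
Qed.

(** The windows end at [t] because the equation will be tested against the value at their right
    end. *)
Lemma left_average_cvg (phi : R -> R) : locally_integrable setT phi ->
  {ae mu, forall t : R, (n.+1%:R * \int[mu]_(r in `[(t - n.+1%:R^-1)%R, t]) phi r)%R
     @[n --> \oo] --> phi t}.
Proof.
move=> lphi; have := lebesgue_differentiation lphi.
apply: filterS; first exact: (ae_filter_ringOfSetsType mu).
move=> t pt.
have := nice_lebesgue_differentiation left_segment_shrinking lphi pt.
move=> /fine_cvgP[_]; apply: cvg_trans; apply: near_eq_cvg; apply: nearW => n /=.
rewrite /left_segment lebesgue_measure_segment ?lerBlDr ?lerDl ?invr_ge0//.
rewrite opprB addrCA subrr addr0 inver invr_eq0 pnatr_eq0/= invrK.
have int_phi : mu.-integrable `[(t - n.+1%:R^-1)%R, t] (EFin \o phi).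
  have [mphi _ lp] := lphi; apply/integrableP; split.
    by apply/measurable_EFinP; exact: measurable_funTS.
  apply: lp => //; exact: segment_compact.
by rewrite fineM// integrable_fin_num.
Qed.


(** Almost every point is a Lebesgue point of a vector-valued map: the scalar theorem applies to the
    countably many functions [|g - e k|], where [e] approximates the range of [g]. *)
Lemma left_average_cvg0 (E : normedModType R) (g : measurableTypeR R -> E) :
  strongly_measurable g -> \int[mu]_r (`|g r|)%:E < +oo ->
  {ae mu, forall t : R,
    (n.+1%:R * \int[mu]_(r in `[(t - n.+1%:R^-1)%R, t]) `|g r - g t|)%R
     @[n --> \oo] --> 0%R}.
Proof.
move=> smg ig; have [e he] := strongly_measurable_separable smg.
have nmg := strongly_measurable_norm_measurable smg.
have lk k : locally_integrable setT (fun r => `|g r - e k|%R).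
  split; [exact: nmg|exact: openT|move=> K _ cK].
  have mK := compact_measurable cK.
  have K0 x : K x -> 0 <= `|g x|%:E by move=> _; rewrite lee_fin.
  apply: (@le_lt_trans _ _ (\int[mu]_(x in K) (`|g x|%:E + `|e k|%:E))).
    apply: ge0_integral_mono => x Kx; rewrite ?lee_fin//.
    by rewrite normr_id ler_normB.
  have mgK : measurable_fun K (fun x => `|g x|%:E).
    by apply/measurable_EFinP; apply: measurable_funTS; exact: norm_measurable_norm.
  rewrite ge0_integralD// integral_cst//.
  apply: lte_add_pinfty; last first.
    by rewrite lte_mul_pinfty//; exact: compact_finite_measure.
  apply: le_lt_trans ig; apply: ge0_subset_integral => //.
  by apply/measurable_EFinP; exact: norm_measurable_norm.
have /ae_foralln : forall k, {ae mu, forall t : R,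
    (n.+1%:R * \int[mu]_(r in `[(t - n.+1%:R^-1)%R, t]) `|g r - e k|)%R
    @[n --> \oo] --> `|g t - e k|%R}.
  by move=> k; exact: (left_average_cvg (lk k)).
apply: filterS => t ht.
have int_cst n (c : R) : mu.-integrable `[(t - n.+1%:R^-1)%R, t] (fun=> c%:E).
  apply/integrableP; split; first exact: measurable_cst.
  rewrite integral_cst//= lte_mul_pinfty ?lee_fin//.
  by rewrite lebesgue_measure_segment ?lerBlDr ?lerDl ?invr_ge0 ?ltry.
have intk n k : mu.-integrable `[(t - n.+1%:R^-1)%R, t] (fun r => `|g r - e k|%:E).
  have [mphi _ lp] := lk k; apply/integrableP; split.
    by apply/measurable_EFinP; exact: measurable_funTS.
  apply: lp => //; exact: segment_compact.
apply/cvgrPdist_le => eps eps0.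
(* With [|g t - e k| < eps / 4] the average of [|g - e k|] is eventually below [eps / 2], and the
   triangle inequality costs another [eps / 4]. *)
have e4 : (0 < eps / 4)%R by rewrite divr_gt0.
have [k ek] := he t _ e4.
have /cvgrPdist_lt/(_ _ e4) := ht k.
apply: filterS => n hn.
have n0 : (0 < n.+1%:R :> R)%R by rewrite ltr0n.
have i0 : (0 < n.+1%:R^-1 :> R)%R by rewrite invr_gt0.
have mg' : measurable_fun `[(t - n.+1%:R^-1)%R, t]%classic (fun r => `|g r - g t|%R).
  by apply: measurable_funTS; exact: nmg.
have isum : mu.-integrable `[(t - n.+1%:R^-1)%R, t] (fun r => (`|g r - e k| + `|g t - e k|)%R%:E).
  have mI : measurable (`[(t - n.+1%:R^-1)%R, t]%classic : set (measurableTypeR R)) by exact: measurable_itv.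
  have := integrableD mI (intk n k) (int_cst n (`|g t - e k|)%R).
  exact: eq_integrable.
have igt : mu.-integrable `[(t - n.+1%:R^-1)%R, t] (fun r => `|g r - g t|%:E).
  apply: (le_integrable _ _ _ isum) => //; first exact/measurable_EFinP.
  move=> r _; rewrite /= lee_fin normr_id [leRHS]ger0_norm ?addr_ge0//.
  by rewrite (le_trans _ (ler_normB _ _))// opprB addrA subrK.
rewrite sub0r normrN ger0_norm; last first.
  by apply: mulr_ge0; [exact: ltW|exact: Rintegral_ge0].
apply: (@le_trans _ _ (n.+1%:R * \int[mu]_(r in `[(t - n.+1%:R^-1)%R, t]) (`|g r - e k| + `|g t - e k|))%R).
  apply: ler_wpM2l; first exact: ltW.
  apply: le_Rintegral => //.
  by move=> r _; rewrite (le_trans _ (ler_normB _ _))// opprB addrA subrK.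
rewrite RintegralD; [|exact: measurable_itv|exact: intk|exact: int_cst].
rewrite Rintegral_cst; last exact: measurable_itv.
rewrite [X in fine X](_ : _ = (n.+1%:R^-1)%:E); last first.
  rewrite [LHS]lebesgue_measure_segment; first by rewrite opprB addrCA subrr addr0.
  by rewrite lerBlDr lerDl ltW.
rewrite /= mulrDr [X in (_ + X)%R]mulrCA divff ?gt_eqF// mulr1.
have := hn; rewrite ltr_distlC => /andP[_ h].
by set x := (n.+1%:R * _)%R in h *; lra.
Qed.

(** Right continuity gives the limit at a prescribed point, as needed at the times 0 and [tau],
    which an almost everywhere statement could miss. *)
Lemma right_average_cvg (phi : R -> R) (t delta M : R) : (0 < delta)%R ->
  measurable_fun setT phi -> (forall r, t <= r <= t + delta -> `|phi r| <= M)%R ->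
  phi r @[r --> t^'+] --> phi t ->
  (n.+1%:R * \int[mu]_(r in `[t, (t + n.+1%:R^-1)%R]) phi r)%R @[n --> \oo] --> phi t.
Proof.
move=> d0 mphi bphi rc; apply/cvgrPdist_le => eps eps0.
have /cvgrPdist_le/(_ _ eps0) := rc.
move=> [d1 /= d10 hd].
near=> n.
have n0 : (0 < n.+1%:R :> R)%R by rewrite ltr0n.
have i0 : (0 < n.+1%:R^-1 :> R)%R by rewrite invr_gt0.
have nd1 : (n.+1%:R^-1 < d1)%R by near: n; exact: (near_infty_natSinv_lt (PosNum d10)).
have nd : (n.+1%:R^-1 < delta)%R by near: n; exact: (near_infty_natSinv_lt (PosNum d0)).
have close r : (t <= r <= t + n.+1%:R^-1)%R -> (`|phi t - phi r| <= eps)%R.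
  move=> /andP[]; rewrite le_eqVlt => /predU1P[<- _|tr rn].
    by rewrite subrr normr0 ltW.
  by apply: hd => //=; rewrite ltr0_norm ?subr_lt0// opprB ltrBlDl (le_lt_trans rn)// ltrD2l.
have mI : mu `[t, (t + n.+1%:R^-1)%R]%classic = (n.+1%:R^-1)%:E.
  by rewrite lebesgue_measure_segment ?lerDl ?ltW// addrAC subrr add0r.
have bint (psi : R -> R) (c : R) : measurable_fun setT psi ->
    (forall r, (t <= r <= t + n.+1%:R^-1)%R -> (`|psi r| <= c)%R) ->
    mu.-integrable `[t, (t + n.+1%:R^-1)%R] (EFin \o psi).
  move=> mpsi bpsi; apply: measurable_bounded_integrable => //.
  - by rewrite [X in X < _]mI ltry.
  - exact: measurable_funTS.
  - exists c; split; first exact: num_real.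
    move=> x cx r /=; rewrite in_itv/= => /bpsi h; exact: le_trans h (ltW cx).
have ip : mu.-integrable `[t, (t + n.+1%:R^-1)%R] (EFin \o phi).
  apply: (bint _ M) => // r /andP[r1 r2]; apply: bphi; rewrite r1/=.
  by rewrite (le_trans r2)// lerD2l ltW.
have ic : mu.-integrable `[t, (t + n.+1%:R^-1)%R] (EFin \o (fun=> phi t)).
  by apply: (bint _ `|phi t|%R) => //; exact: measurable_cst.
have -> : phi t = (n.+1%:R * \int[mu]_(r in `[t, (t + n.+1%:R^-1)%R]) phi t)%R.
  by rewrite Rintegral_cst// [X in fine X]mI mulrCA divff ?gt_eqF// mulr1.
rewrite -mulrBr -RintegralB// normrM gtr0_norm//.
rewrite -(ler_pdivlMl _ _ n0) mulrC.
have id : mu.-integrable `[t, (t + n.+1%:R^-1)%R] (EFin \o (fun r => phi t - phi r)%R).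
  by apply: (bint _ eps) => //; apply: measurable_funB => //; exact: measurable_cst.
apply: (le_trans (le_normr_Rintegral _ _)) => //.
apply: (@le_trans _ _ (\int[mu]_(r in `[t, (t + n.+1%:R^-1)%R]) eps)%R); last first.
  by rewrite Rintegral_cst// [X in fine X]mI.
apply: le_Rintegral => //.
- apply: (bint _ eps).
    by apply: measurableT_comp => //; apply: measurable_funB.
  by move=> r hr; rewrite normr_id close.
- by apply: (bint _ eps) => [|r _]; [exact: measurable_cst|rewrite gtr0_norm].
Unshelve. all: by end_near. Qed.

End averages.

(** * Integrals of sliding windows *)

Section real_integrals.
Context (R : realType).
Local Notation mu := (@lebesgue_measure R).

Lemma ae_le_Rintegral d (T : measurableType d) (m : {measure set T -> \bar R})
    (D : set T) (f g : T -> R) : measurable D ->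
  m.-integrable D (EFin \o f) -> m.-integrable D (EFin \o g) ->
  {ae m, forall x, D x -> f x <= g x} ->
  \int[m]_(x in D) f x <= \int[m]_(x in D) g x.
Proof.
move=> mD iF iG fg; rewrite -subr_ge0 -RintegralB//.
have mgf : measurable_fun D (fun x => g x - f x).
  by apply: measurable_funB; apply/measurable_EFinP; [exact: measurable_int iG|exact: measurable_int iF].
(* The inequality holds only almost everywhere, so the difference is replaced by its positive
   part. *)
rewrite /Rintegral (_ : integral _ _ _ = (\int[m]_(x in D) (Num.max (g x - f x) 0)%:E)%E).
  by apply: fine_ge0; apply: integral_ge0 => x _; rewrite lee_fin le_max lexx orbT.
apply: ae_eq_integral => //.
- exact/measurable_EFinP.
- by apply/measurable_EFinP; apply: measurable_maxr.
- by apply: filterS fg => x /= h Dx; congr EFin; apply/esym/max_idPl; rewrite subr_ge0 h.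
Qed.

Variables (w : R -> R).
Hypothesis mw : measurable_fun setT w.
Hypothesis w0 : forall r, 0 <= w r.
Local Open Scope ereal_scope.

Local Notation RR := (measurableTypeR R * measurableTypeR R)%type.

Let K (h : R) (p : RR) : \bar R := (\1_[set q : RR | q.1 - h <= q.2 <= q.1]%R p * w p.2)%:E.

Let mS (h : R) : measurable [set q : RR | q.1 - h <= q.2 <= q.1]%R.
Proof.
rewrite (_ : mkset _ = [set q : RR | q.1 - h <= q.2]%R `&` [set q : RR | q.2 <= q.1]%R).
  apply: measurableI; apply: measurable_set_bool; apply: measurable_fun_ler => //.
  by apply: measurable_funB.
by apply/seteqP; split => q /= => [/andP[]|[-> ->]].
Qed.

Let mK h : measurable_fun setT (K h).
Proof.
apply/measurable_EFinP; apply: measurable_funM; first exact: measurable_indic.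
exact: measurableT_comp.
Qed.

Let K0 h p : 0 <= K h p.
Proof. by rewrite lee_fin mulr_ge0. Qed.

Let KifE h t r : K h (t, r) = (if (t - h <= r <= t)%R then w r else 0%R)%:E.
Proof.
rewrite /K/= indicE.
have -> : ((t, r) \in [set q : RR | q.1 - h <= q.2 <= q.1]%R) = (t - h <= r <= t)%R.
  by apply/idP/idP; rewrite inE.
by case: ifPn; rewrite ?mul1r ?mul0r.
Qed.

Let KE h t : \int[mu]_(r in `[(t - h)%R, t]) (w r)%:E = \int[mu]_r K h (t, r).
Proof.
rewrite integral_mkcond; apply: eq_integral => r _.
rewrite patchE /K/= indicE mem_setE/=.
have -> : ((t, r) \in [set q : RR | q.1 - h <= q.2 <= q.1]%R) = (t - h <= r <= t)%R.
  by apply/idP/idP; rewrite inE.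
by rewrite in_itv/=; case: ifPn; rewrite ?mul1r ?mul0r.
Qed.

Lemma measurable_left_average (h : R) :
  measurable_fun setT (fun t : R => \int[mu]_(r in `[(t - h)%R, t]) (w r)%:E).
Proof.
apply: (eq_measurable_fun (fun t : R => \int[mu]_r K h (t, r))).
  by move=> t _; rewrite KE.
by apply: (@measurable_fun_fubini_tonelli_F _ _ _ _ _ mu (K h)) => // p; exact: K0.
Qed.

(** By Tonelli: a given [r] belongs to the windows ending in [[r, r + h]], a set of length [h], and
    all windows lie in [[0, b + h]]. *)
Lemma integral_left_average (h b : R) : (0 < h)%R ->
  \int[mu]_(t in `[h, (b + h)%R]) \int[mu]_(r in `[(t - h)%R, t]) (w r)%:E <=
  h%:E * \int[mu]_(r in `[0%R, (b + h)%R]) (w r)%:E.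
Proof.
move=> h0.
pose K' (p : RR) : \bar R := (\1_(`[h, (b + h)%R] : set R) p.1)%:E * K h p.
have mK' : measurable_fun setT K'.
  apply: emeasurable_funM => //; apply/measurable_EFinP.
  by apply: (@measurableT_comp _ _ _ _ _ _ (\1_(`[h, (b + h)%R]%classic : set R) : _ -> R)).
have K'0 p : 0 <= K' p by rewrite mule_ge0// lee_fin.
rewrite integral_mkcond.
rewrite (eq_integral (fun t => \int[mu]_r K' (t, r))); last first.
  move=> t _; rewrite patchE; case: ifPn => tI.
    by rewrite KE; apply: eq_integral => r _; rewrite /K'/= indicE tI mul1e.
  by rewrite integral0_eq// => r _; rewrite /K'/= indicE (negbTE tI) mul0e.
rewrite (@fubini_tonelli _ _ _ _ _ mu mu K')//.
rewrite [in leRHS]integral_mkcond -ge0_integralZl//; last 3 first.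
- by apply/(measurable_restrictT _ _).1 => //; apply/measurable_EFinP; exact: measurable_funTS.
- by move=> r _; apply: erestrict_ge0 => // x _; rewrite lee_fin.
- by rewrite lee_fin ltW.
apply: ge0_le_integral => //.
- by move=> r _; apply: integral_ge0.
- exact: (@measurable_fun_fubini_tonelli_G _ _ _ _ _ mu K').
- apply: emeasurable_funM => //.
  by apply/(measurable_restrictT _ _).1 => //; apply/measurable_EFinP; exact: measurable_funTS.
move=> r _; rewrite patchE.
have bnd : \int[mu]_t K' (t, r) <= \int[mu]_(t in `[r, (r + h)%R]) (w r)%:E.
  rewrite [leRHS]integral_mkcond; apply: ge0_integral_mono => t _ //.
  rewrite /K' KifE/= indicE patchE.
  have [tr|tr] := boolP (t \in `[r, (r + h)%R]%classic).
    by case: (_ \in _); case: ifP => _; rewrite ?mul0e ?mul1e ?mulr0 ?lee_fin.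
  rewrite (_ : (t - h <= r <= t)%R = false) ?mule0//.
  by apply/negbTE/negP => /andP[h1 h2]; move/negP: tr; apply; rewrite inE/= in_itv/= h2 -lerBlDr.
case: ifPn => rI.
  apply: (le_trans bnd); rewrite integral_cst// muleC.
  rewrite [X in X * _](_ : _ = h%:E)// [LHS]lebesgue_measure_segment; first by rewrite addrAC subrr add0r.
  by rewrite lerDl ltW.
rewrite mule0 integral0_eq// => t _; rewrite /K' KifE/= indicE.
have [tI|tI] := boolP (t \in `[h, (b + h)%R]%classic); last by rewrite mul0e.
rewrite (_ : (t - h <= r <= t)%R = false) ?mule0//.
apply/negbTE/negP => /andP[h1 h2]; move/negP: rI; apply; rewrite inE/= in_itv/=.
by move: tI; rewrite inE/= in_itv/= => /andP[t1 t2]; rewrite (le_trans _ h1) ?subr_ge0// (le_trans h2).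
Qed.

End real_integrals.

Section almost_everywhere.
Context (R : realType) (d : measure_display) (T : measurableType d).
Variable mu : {measure set T -> \bar R}.

Lemma ae_imply (P Q : T -> Prop) : (forall x, P x -> Q x) ->
  {ae mu, forall x, P x} -> {ae mu, forall x, Q x}.
Proof. by move=> PQ; apply: filterS. Qed.

Lemma ae_imply2 (P Q S : T -> Prop) : (forall x, P x -> Q x -> S x) ->
  {ae mu, forall x, P x} -> {ae mu, forall x, Q x} -> {ae mu, forall x, S x}.
Proof. by move=> PQ; apply: filterS2. Qed.

Lemma ae_and (P Q : T -> Prop) : {ae mu, forall x, P x} -> {ae mu, forall x, Q x} ->
  {ae mu, forall x, P x /\ Q x}.
Proof. by apply: ae_imply2. Qed.

End almost_everywhere.

Section frequently.
Context (R : realType).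

Lemma limn_einf_le_frequently (u : nat -> \bar R) (z : nat -> R) (l : R) :
  z n @[n --> \oo] --> l ->
  (forall n0, exists2 n, (n0 <= n)%N & (u n <= (z n)%:E)%E) ->
  (limn_einf u <= l%:E)%E.
Proof.
move=> zl fr; rewrite limn_einf_lim; apply: lime_le; first exact: is_cvg_einfs.
apply: nearW => n; apply/lee_addgt0Pr => eps eps0.
have /cvgrPdist_lt/(_ _ eps0)[N _ hN] := zl.
have [m mn um] := fr (maxn n N).
have h := hN m (leq_trans (leq_maxr n N) mn).
apply: (@le_trans _ _ (u m)).
  by apply: ereal_inf_lbound; exists m => //=; exact: leq_trans (leq_maxl n N) mn.
apply: (le_trans um); rewrite -EFinD lee_fin.
by move: h => /=; rewrite ltr_distlC => /andP[_ /ltW].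
Qed.

End frequently.

(** * Fatou's lemma with a convergent majorant *)

Section fatou_average.
Context (R : realType).
Local Notation mu := (@lebesgue_measure R).
Variables (tau delta : R) (q : nat -> R -> R) (p w : R -> R) (D : set R).
Let h (n : nat) : R := n.+1%:R^-1.
Hypothesis delta0 : 0 < delta.
Hypothesis aeD : {ae mu, forall t : R, 0 <= t <= tau + delta -> D t}.
Hypothesis mq : forall n, measurable_fun setT (q n).
Hypothesis mw : measurable_fun setT w.
Hypothesis w0 : forall r, 0 <= w r.
Hypothesis iw : mu.-integrable setT (EFin \o w).
Hypothesis ip : mu.-integrable setT (EFin \o p).
Hypothesis qp : forall t, D t -> 0 < t -> q n t @[n --> \oo] --> p t.
Let A n t : R := \int[mu]_(r in `[t - h n, t]) w r.
Hypothesis qw : forall n t, D t -> h n <= t -> t <= tau + delta ->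
  q n t <= n.+1%:R * A n t + w t.

Let h0 n : 0 < h n. Proof. by rewrite invr_gt0 ltr0n. Qed.

Let iwS (I : set R) : measurable I -> mu.-integrable I (EFin \o w).
Proof. by move=> mI; apply: integrableS iw. Qed.

Let AE n (t : R) : (\int[mu]_(r in `[(t - h n)%R, t]) (w r)%:E = (A n t)%:E)%E.
Proof. by rewrite fineK// integrable_fin_num//; exact: iwS. Qed.

Let mA n : measurable_fun setT (A n).
Proof. by apply: measurableT_comp => //; exact: measurable_left_average. Qed.

(** Majorant minus [q]. The indicator keeps the window [[t - h n, t]] within the nonnegative times;
    the maximum makes [f] nonnegative off [D] as well. *)
Let f n t : R := (\1_(`[h n, +oo[ : set R) t) * Num.max 0 (n.+1%:R * A n t + w t - q n t).

Let mf n : measurable_fun setT (f n).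
Proof.
apply: measurable_funM => //; apply: measurable_maxr => //.
by apply: measurable_funB => //; apply: measurable_funD => //; apply: measurable_funM.
Qed.

Let f0 n t : 0 <= f n t.
Proof. by rewrite mulr_ge0// le_max lexx. Qed.

Let cvg_f : {ae mu, forall t, t \in `]0, tau] -> f n t @[n --> \oo] --> Num.max 0 (w t + w t - p t)}.
Proof.
have lw : locally_integrable setT w by apply: open_integrable_locally => //; exact: openT.
have := left_average_cvg lw; have := aeD; apply: ae_imply2 => t tD lt.
rewrite in_itv/= => /andP[t0 tt].
have Dt : D t by apply: tD; rewrite ltW//= (le_trans tt)// lerDl ltW.
have c1 : n.+1%:R * A n t + w t - q n t @[n --> \oo] --> w t + w t - p t.
  apply: cvgB; last exact: qp.
  by apply: cvgD; [exact: lt|exact: cvg_cst].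
have c2 : Num.max 0 (n.+1%:R * A n t + w t - q n t) @[n --> \oo] --> Num.max 0 (w t + w t - p t).
  have cm : continuous (fun x : R => Num.max 0 x).
    by move=> x; apply: (@continuous_max _ _ (fun=> 0) id x); [exact: cvg_cst|exact: cvg_id].
  exact: (@cvg_comp _ _ _ _ (fun x : R => Num.max 0 x) _ _ _ c1 (cm _)).
apply: cvg_trans c2; apply: near_eq_cvg; near=> n; rewrite /f indicE mem_set ?mul1r//=.
rewrite in_itv/= andbT; near: n; apply: filterS (near_infty_natSinv_lt (PosNum t0)) => n.
exact: ltW.
Unshelve. all: by end_near. Qed.

Let upper n : h n < delta -> mu.-integrable `[h n, tau + h n] (EFin \o q n) ->
  (\int[mu]_(t in `[0%R, tau]) (f n t)%:E <=
   (2 * (\int[mu]_(r in `[0, tau + h n]) w r) - \int[mu]_(t in `[h n, (tau + h n)%R]) q n t)%:E)%E.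
Proof.
move=> hd iqI.
have mI : measurable (`[h n, tau + h n]%classic : set (measurableTypeR R)) by exact: measurable_itv.
have iAn : (\int[mu]_(t in `[h n, (tau + h n)%R]) (A n t)%:E <=
           (h n)%:E * (\int[mu]_(r in `[0, tau + h n]) w r)%:E)%E.
  rewrite [X in (_ * X)%E](_ : _ = \int[mu]_(r in `[0%R, (tau + h n)%R]) (w r)%:E)%E; last first.
    by rewrite fineK// integrable_fin_num//; exact: iwS.
  have := @integral_left_average R w mw w0 (h n) tau (h0 n).
  by under eq_integral do rewrite AE.
have A0 t : 0 <= A n t by apply: Rintegral_ge0.
have iA : mu.-integrable `[h n, tau + h n] (fun t => (n.+1%:R * A n t)%:E).
  have iA1 : mu.-integrable `[h n, tau + h n] (fun t => (A n t)%:E).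
    apply/integrableP; split; first by apply/measurable_EFinP; exact: (measurable_funTS (mA n)).
    under eq_integral do rewrite gee0_abs ?lee_fin//.
    by apply: (le_lt_trans iAn); rewrite -EFinM ltry.
  have := integrableZl mI n.+1%:R iA1; exact: eq_integrable.
have iwI := iwS mI.
have iAw : mu.-integrable `[h n, tau + h n] (fun t => (n.+1%:R * A n t + w t)%:E).
  have := integrableD mI iA iwI; exact: eq_integrable.
have iG : mu.-integrable `[h n, tau + h n] (fun t => (n.+1%:R * A n t + w t - q n t)%:E).
  have := integrableB mI iAw iqI; exact: eq_integrable.
apply: (@le_trans _ _ (\int[mu]_(t in `[h n, (tau + h n)%R]) (Num.max 0 (n.+1%:R * A n t + w t - q n t))%:E)%E).
  rewrite [leLHS]integral_mkcond [leRHS]integral_mkcond.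
  apply: ge0_integral_mono => t _; rewrite patchE.
    by case: ifPn => // _; rewrite lee_fin.
  case: ifPn => tI; last first.
    rewrite patchE; case: ifPn => // _; by rewrite lee_fin le_max lexx.
  rewrite /f indicE; have [ht|ht] := boolP (t \in (`[h n, +oo[%classic : set R)); last first.
    by rewrite mul0r patchE; case: ifPn => // _; rewrite lee_fin le_max lexx.
  rewrite mul1r patchE mem_set//=.
  move: ht; rewrite inE/= in_itv/= andbT => t1.
  move: tI; rewrite inE/= in_itv/= => /andP[_ tt].
  by rewrite in_itv/= t1/= (le_trans tt)// lerDl (ltW (h0 n)).
rewrite (_ : integral _ _ _ = (\int[mu]_(t in `[h n, (tau + h n)%R]) (n.+1%:R * A n t + w t - q n t)%:E)%E); last first.
  apply: ae_eq_integral => //.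
  - apply/measurable_EFinP; apply: measurable_maxr => //; apply/measurable_EFinP.
    exact: measurable_int iG.
  - exact: measurable_int iG.
  apply: ae_imply aeD => t tD /=; rewrite in_itv/= => /andP[t1 t2].
  congr EFin; apply/max_idPr; rewrite subr_ge0; apply: qw => //; last first.
    by rewrite (le_trans t2)// lerD2l ltW.
  by apply: tD; rewrite (le_trans (ltW (h0 n)))//= (le_trans t2)// lerD2l ltW.
have fin1 := integrable_fin_num mI iG.
rewrite -(fineK fin1) lee_fin.
rewrite -[X in X <= _]/(\int[mu]_(t in `[h n, (tau + h n)%R]) (n.+1%:R * A n t + w t - q n t)).
rewrite RintegralB// RintegralD// lerD2r mulr_natl mulr2n; apply: lerD.
  rewrite -lee_fin; apply: (@le_trans _ _ (\int[mu]_(t in `[h n, (tau + h n)%R]) (n.+1%:R * A n t)%:E)%E).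
    by rewrite fineK// integrable_fin_num.
  under eq_integral do rewrite EFinM.
  rewrite ge0_integralZl//; last 2 first.
  - by apply/measurable_EFinP; exact: (measurable_funTS (mA n)).
  - by move=> t _; rewrite lee_fin.
  apply: (le_trans (lee_wpmul2l _ iAn)) => //.
  by rewrite -!EFinM lee_fin mulrA /h divff ?mul1r.
rewrite -lee_fin !fineK; [|exact: integrable_fin_num (iwS _)..].
apply: ge0_subset_integral => //.
- by apply/measurable_EFinP; exact: measurable_funTS.
- by move=> t _; rewrite lee_fin.
- by move=> t /=; rewrite !in_itv/= => /andP[t1 ->]; rewrite (le_trans (ltW (h0 n))).
Qed.

(** Only an upper bound of [q] is available, by a window average of [w] plus [w]. The integrals of
    these majorants converge to twice that of [w], which is also the integral of their limit, so the
    majorant cancels after Fatou. *)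
Lemma fatou_average (y_ : nat -> R) (y : R) : y_ n @[n --> \oo] --> y ->
  (forall n0, exists n, [/\ (n0 <= n)%N, mu.-integrable `[h n, tau + h n] (EFin \o q n) &
     - (\int[mu]_(t in `[h n, (tau + h n)%R]) q n t) <= y_ n]) ->
  - (\int[mu]_(t in `[0, tau]) p t) <= y.
Proof.
move=> yy fr.
pose Z n := \int[mu]_(r in `[0, tau + h n]) w r.
have mI : measurable (`[0, tau]%classic : set (measurableTypeR R)) by exact: measurable_itv.
have mJ n : measurable (`[0, tau + h n]%classic : set (measurableTypeR R)) by exact: measurable_itv.
have h_cvg : h n @[n --> \oo] --> 0 by exact: cvg_harmonic.
have Zcvg : Z n @[n --> \oo] --> \int[mu]_(r in `[0, tau]) w r.
  have iwI := iwS mI.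
  pose wn n (r : R) : \bar R := ((EFin \o w) \_ `[0, tau + h n]%classic) r.
  have mwn n : measurable_fun setT (wn n).
    apply/(measurable_restrictT _ _).1 => //; exact: measurable_int (iwS (mJ n)).
  have mwl : measurable_fun setT ((EFin \o w) \_ `[0, tau]%classic).
    apply/(measurable_restrictT _ _).1 => //; exact: measurable_int iwI.
  have wnl (r : R) : wn n r @[n --> \oo] --> ((EFin \o w) \_ `[0, tau]%classic) r.
    have cond n : (r \in (`[0, tau + h n]%classic : set R)) = (0 <= r <= tau + h n).
      by apply/idP/idP; rewrite inE/= in_itv.
    have condl : (r \in (`[0, tau]%classic : set R)) = (0 <= r <= tau).
      by apply/idP/idP; rewrite inE/= in_itv.
    apply: cvg_near_cst; have [rt|rt] := leP r tau.
      apply: nearW => n; rewrite /wn !patchE cond condl.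
      by rewrite (le_trans rt) ?lerDl ?(ltW (h0 n))// rt.
    have rt' : 0 < r - tau by rewrite subr_gt0.
    apply: filterS (near_infty_natSinv_lt (PosNum rt')) => n /= hn.
    rewrite /wn !patchE cond condl.
    by rewrite [r <= _]leNgt -ltrBrDl hn [r <= tau]leNgt rt.
  have wnb n (r : R) : (`|wn n r| <= (w r)%:E)%E.
    by rewrite /wn patchE; case: ifPn => _; rewrite /= ?lee_fin ?ger0_norm ?normr0.
  have ae1 : {ae mu, forall r : R, setT r -> wn n r @[n --> \oo] --> ((EFin \o w) \_ `[0, tau]%classic) r}.
    by apply: aeW => r _; exact: wnl.
  have ae2 : {ae mu, forall (r : R) n, setT r -> (`|wn n r| <= (w r)%:E)%E}.
    by apply: aeW => r n _; exact: wnb.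
  have [_ _] := @dominated_convergence _ _ R mu setT measurableT wn
    ((EFin \o w) \_ `[0, tau]%classic) (EFin \o w) mwn mwl ae1 iw ae2.
  rewrite -integral_mkcond.
  have -> : (\int[mu]_(x in `[0%R, tau]) (EFin \o w) x)%E = (\int[mu]_(r in `[0, tau]) w r)%:E.
    by rewrite fineK// integrable_fin_num.
  move=> /fine_cvgP[_]; apply: cvg_trans; apply: near_eq_cvg; apply: nearW => n /=.
  by rewrite /Z /Rintegral integral_mkcond.
pose u n := (\int[mu]_(t in `[0%R, tau]) (f n t)%:E)%E.
have mE n : measurable_fun `[0, tau]%classic (fun t => (f n t)%:E).
  by apply/measurable_EFinP; exact: measurable_funTS.
have fat : (\int[mu]_(t in `[0%R, tau]) limn_einf (fun n => (f n t)%:E) <= limn_einf u)%E.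
  by apply: fatou => // n t _; rewrite lee_fin.
have up : (limn_einf u <= (2 * (\int[mu]_(r in `[0, tau]) w r) + y)%:E)%E.
  apply: (@limn_einf_le_frequently _ _ (fun n => 2 * Z n + y_ n)).
    by apply: cvgD => //; apply: cvgMr.
  move=> n0; have [N _ hN] := near_infty_natSinv_lt (PosNum delta0).
  have [n [nn iqn qy]] := fr (maxn n0 N).
  exists n; first exact: leq_trans (leq_maxl _ _) nn.
  have hd : h n < delta by apply: hN; exact: leq_trans (leq_maxr _ _) nn.
  by apply: (le_trans (upper hd iqn)); rewrite lee_fin lerD2l.
have iwI := iwS mI.
have ipI : mu.-integrable `[0, tau] (EFin \o p) by apply: integrableS ip.
have iww : mu.-integrable `[0, tau] (fun t => (w t + w t)%:E).
  have := integrableD mI iwI iwI; exact: eq_integrable.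
have low : ((\int[mu]_(t in `[0, tau]) (w t + w t - p t))%:E <=
   \int[mu]_(t in `[0%R, tau]) limn_einf (fun n => (f n t)%:E))%E.
  have iwwp : mu.-integrable `[0, tau] (fun t => (w t + w t - p t)%:E).
    have := integrableB mI iww ipI; exact: eq_integrable.
  rewrite fineK ?integrable_fin_num//.
  apply: (@le_trans _ _ (\int[mu]_(t in `[0%R, tau]) (Num.max 0 (w t + w t - p t))%:E)%E).
    have mm : measurable_fun `[0, tau]%classic (fun t => (Num.max 0 (w t + w t - p t))%:E).
      apply/measurable_EFinP; apply: measurable_maxr => //; apply/measurable_EFinP.
      exact: measurable_int iwwp.
    apply: le_integral => //; last by move=> t _; rewrite lee_fin le_max lexx orbT.
    apply: (le_integrable _ _ _ iwwp) => // t _; rewrite /= lee_fin.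
    have [h1|h1] := leP 0 (w t + w t - p t); first by rewrite ger0_norm.
    by rewrite normr0.
  rewrite le_eqVlt; apply/orP; left; apply/eqP; apply: ae_eq_integral => //.
  - apply/measurable_EFinP; apply: measurable_maxr => //; apply/measurable_EFinP.
    exact: measurable_int iwwp.
  - rewrite /limn_einf; apply: measurableT_comp => //.
    by apply: measurable_fun_limn_esup => n; exact: measurableT_comp (mE n).
  have := cvg_f; have : {ae mu, forall t, t != 0 :> R}.
    exists [set 0]; split => //; first exact: lebesgue_measure_set1.
    by move=> t /= /negP; rewrite negbK => /eqP.
  apply: ae_imply2 => t t0 ct /=; rewrite in_itv/= => /andP[t1 t2].
  apply/esym; have : t \in `]0, tau] by rewrite in_itv/= t2 andbT lt_neqAle eq_sym t0.
  move=> /ct {}ct.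
  have ct' : (f n t)%:E @[n --> \oo] --> (Num.max 0 (w t + w t - p t))%:E by apply: cvg_EFin => //; exact: nearW.
  by rewrite is_cvg_limn_einfE; [exact: cvg_lim|apply/cvg_ex; eexists; exact: ct'].
have := le_trans low (le_trans fat up).
rewrite lee_fin RintegralB// RintegralD// mulr_natl mulr2n lerD2l.
exact.
Qed.

End fatou_average.

(** * The energy inequality along one path *)

Section energy.
Context (R : realType) (V H : completeNormedModType R) (W : normedModType R).
Variable G : gelfand_triple V H W.
Local Notation mu := (@lebesgue_measure R).
Variables (X M : measurableTypeR R -> H) (a : measurableTypeR R -> W) (v : R -> V).
Variables (Nf : R -> R) (tau delta K c kappa : R) (N1 : set R).
Let h (n : nat) : R := n.+1%:R^-1.
Let p0 t := pairing G (a t) (v t).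
Let b := tau + delta.
Hypothesis tau0 : 0 < tau.
Hypothesis delta0 : 0 < delta.
Hypothesis c0 : 0 < c.
Hypothesis kappa0 : 0 <= kappa.
Hypothesis mX : norm_measurable setT X.
Hypothesis mM : norm_measurable setT M.
Hypothesis XK : forall t : R, 0 <= t <= b -> `|X t| <= K.
Hypothesis rcX0 : X s @[s --> 0^'+] --> X 0.
Hypothesis rcXtau : X s @[s --> tau^'+] --> X tau.
Hypothesis sma : strongly_measurable a.
Hypothesis ia : (\int[mu]_r (`|a r|)%:E < +oo)%E.
Hypothesis Xeq : forall (s t : R) (u : V), 0 <= s -> s <= t -> t <= b ->
  inner G (X t - X s - (M t - M s)) (embV G u) = \int[mu]_(r in `[s, t]) pairing G (a r) u.
Hypothesis mN1 : measurable (N1 : set (measurableTypeR R)).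
Hypothesis N10 : mu N1 = 0%E.
Hypothesis good : forall t, 0 <= t <= b -> ~ N1 t ->
  [/\ X t = embV G (v t), p0 t <= - kappa & - p0 t <= c * (1 + Nf t)].
Hypothesis cross : forall r t, 0 <= r <= b -> ~ N1 r -> 0 <= t <= b -> ~ N1 t ->
  pairing G (a r) (v t) <= c * (1 - p0 r) + c * (1 - p0 t).
Hypothesis Nf0 : forall t, 0 <= Nf t.
Hypothesis iN : (\int[mu]_(t in `[0%R, b]) (Nf t)%:E < +oo)%E.
Hypothesis freq : forall n0, exists n, [/\ (n0 <= n)%N,
  n.+1%:R * (\int[mu]_(s in `[0, tau]) inner G (X s) (M (s + h n) - M s)) <= 2^-1 &
  (n.+1%:R%:E * (\int[mu]_(s in `[0%R, tau]) (`|M (s + h n)%R - M s| ^+ 2)%:E) <= 1)%E].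

Let sepH : separable_space H. Proof. exact: separableH G. Qed.
Let ipP := innerP G.

Let h0 n : 0 < h n. Proof. by rewrite invr_gt0 ltr0n. Qed.

Let K0 : 0 <= K.
Proof. by apply: le_trans (XK (t := 0) _); rewrite ?normr_ge0// lexx /= addr_ge0// ltW. Qed.

Let mshift (Y : measurableTypeR R -> H) (r : R) : norm_measurable setT Y ->
  norm_measurable setT (fun s : measurableTypeR R => Y (s + r : R)).
Proof.
by move=> mY y; exact: (measurableT_comp (mY y) (measurable_addr_cst r)).
Qed.

(** Backward difference quotient of [X - M], tested against [X t]. Where [X t = embV G (v t)] it is
    the mean of [pairing G (a r) (v t)] over the window, hence tends to [p0 t] at Lebesgue points of
    [a]. *)
Let q n (t : R) := n.+1%:R * inner G (X t - X (t - h n) - (M t - M (t - h n))) (X t).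

Let mq n : measurable_fun (setT : set (measurableTypeR R)) (q n).
Proof.
apply: measurable_funM => //; apply: norm_measurable_ip => //.
by apply: norm_measurable_sub => //; apply: norm_measurable_sub => //; exact: mshift.
Qed.

Let pairing_le (w : W) (u : V) : `|pairing G w u| <= `|u| * `|w|.
Proof. by rewrite mulrC; exact: dual_norm_ub (pairingP G) _ _. Qed.

Let pairingB (w w' : W) (u : V) : pairing G (w - w') u = pairing G w u - pairing G w' u.
Proof.
have := dual_linear (pairingP G) (-1) w' w u.
by rewrite scaleN1r mulN1r addrC => ->; rewrite addrC.
Qed.

Let mpair (u : V) : measurable_fun setT (fun r => pairing G (a r) u).
Proof.
apply: (strongly_measurable_functional (phi := fun w => pairing G w u) sma).
move=> w; apply/cvgrPdist_le => eps eps0; near=> z.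
rewrite -pairingB; apply: (le_trans (pairing_le _ _)).
have u1 : 0 < `|u| + 1 by rewrite ltr_wpDl.
apply: (@le_trans _ _ (`|u| * (eps / (`|u| + 1)))).
  apply: ler_wpM2l => //; near: z; apply: cvgr_dist_le; first exact: cvg_id.
  by rewrite divr_gt0.
by rewrite mulrA ler_pdivrMr// mulrC ler_wpM2l ?lerDl// ltW.
Unshelve. all: by end_near. Qed.

Let ipair (u : V) (I : set (measurableTypeR R)) : measurable I ->
  mu.-integrable I (fun r => (pairing G (a r) u)%:E).
Proof.
move=> mI; apply: (integrableS measurableT) => //.
have iau : mu.-integrable setT (fun r => (`|u| * `|a r|)%:E).
  have ia1 : mu.-integrable setT (fun r => (`|a r|)%:E).
    apply/integrableP; split.
      apply/measurable_EFinP; apply: norm_measurable_norm.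
      exact: strongly_measurable_norm_measurable.
    by under eq_integral do rewrite gee0_abs ?lee_fin//.
  have := integrableZl measurableT `|u| ia1; exact: eq_integrable.
apply: (le_integrable _ _ _ iau) => //; first by apply/measurable_EFinP; exact: mpair.
by move=> r _; rewrite /= lee_fin [leRHS]ger0_norm ?mulr_ge0//; exact: pairing_le.
Qed.

Let lebesgue_null : exists N2 : set (measurableTypeR R), [/\ measurable N2, mu N2 = 0%E &
  forall t : R, ~ N2 t ->
    (n.+1%:R * \int[mu]_(r in `[t - n.+1%:R^-1, t]) `|a r - a t|) @[n --> \oo] --> 0].
Proof.
have [N2 [mN2 N20 hN2]] := left_average_cvg0 sma ia.
exists N2; split => // t nt; apply: contrapT => ht; apply: nt; exact: hN2.
Qed.

Let segment_measurable (x y : R) : measurable (`[x, y]%classic : set (measurableTypeR R)).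
Proof. exact: measurable_itv. Qed.

Let mX2 : measurable_fun (setT : set (measurableTypeR R)) (fun r => `|X r| ^+ 2).
Proof. by apply: measurable_funX; exact: norm_measurable_norm. Qed.

Let integrable_cst_segment (x y k : R) : x <= y -> mu.-integrable `[x, y] (fun=> k%:E).
Proof.
move=> xy; apply/integrableP; split; first exact: measurable_cst.
by rewrite integral_cst//= [X in (_ * X)%E]lebesgue_measure_segment// -EFinM ltry.
Qed.

Let iX2 (x y : R) : 0 <= x -> x <= y -> y <= b ->
  mu.-integrable `[x, y] (EFin \o (fun r => `|X r| ^+ 2)).
Proof.
move=> x0 xy yb.
have mI := segment_measurable x y.
apply: (@le_integrable _ _ _ mu _ mI _ (fun=> (K ^+ 2)%:E)).
- by apply/measurable_EFinP; exact: measurable_funTS.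
- move=> r /=; rewrite in_itv/= => /andP[r1 r2]; rewrite lee_fin.
  rewrite !ger0_norm ?sqr_ge0// lerXn2r ?nnegrE// XK//.
  by rewrite (le_trans x0)//= (le_trans r2).
- exact: integrable_cst_segment.
Qed.

(** Integrated over [[0, tau]], the increments of [|X|^2] telescope to its averages just after [tau]
    and just after 0. *)
Let energy_frequent n : h n < delta ->
  n.+1%:R * (\int[mu]_(s in `[0, tau]) inner G (X s) (M (s + h n) - M s)) <= 2^-1 ->
  (n.+1%:R%:E * (\int[mu]_(s in `[0%R, tau]) (`|M (s + h n)%R - M s| ^+ 2)%:E) <= 1)%E ->
  mu.-integrable `[h n, tau + h n] (EFin \o q n) /\
  n.+1%:R * (\int[mu]_(r in `[tau, tau + h n]) `|X r| ^+ 2) -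
    n.+1%:R * (\int[mu]_(r in `[0, 0 + h n]) `|X r| ^+ 2) <=
  2 * (\int[mu]_(t in `[h n, (tau + h n)%R]) q n t) + 2.
Proof.
move=> hd f1 f2.
have hn0 := h0 n.
have mJ := segment_measurable 0 tau.
pose m (s : measurableTypeR R) := M (s + h n : R) - M s.
have mm : norm_measurable setT m by apply: norm_measurable_sub => //; exact: mshift.
have m2oo : (\int[mu]_(s in `[0%R, tau]) (`|m s| ^+ 2)%:E < +oo)%E.
  rewrite ltey; apply/eqP => E.
  by move: f2; rewrite [X in (_ * X)%E]E mulry gtr0_sg ?ltr0n// mul1e leye_eq.
have mm2 : measurable_fun setT (fun s => `|m s| ^+ 2).
  by apply: measurable_funX; exact: norm_measurable_norm.
have im2 : mu.-integrable `[0, tau] (fun s => (`|m s| ^+ 2)%:E).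
  apply/integrableP; split; first by apply/measurable_EFinP; exact: measurable_funTS.
  by under eq_integral do rewrite gee0_abs ?lee_fin ?sqr_ge0//.
have im (k1 k2 : R) : mu.-integrable `[0, tau] (fun s => (k1 + k2 * `|m s| ^+ 2)%:E).
  have := integrableD mJ (integrable_cst_segment k1 (ltW tau0)) (integrableZl mJ k2 im2).
  exact: eq_integrable.
have m_le s : `|m s| <= 1 + `|m s| ^+ 2.
  by have := sqr_ge0 (`|m s| - 1); have := normr_ge0 (m s); nra.
have Xs s : 0 <= s <= tau -> `|X s| <= K.
  by move=> /andP[s1 s2]; apply: XK; rewrite s1 (le_trans s2)// lerDl ltW.
have Xsh (s : R) : 0 <= s <= tau -> `|X (s + h n)| <= K.
  move=> /andP[s1 s2]; apply: XK; rewrite addr_ge0 ?(ltW hn0)//=.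
  by apply: lerD => //; exact: ltW.
have ixm : mu.-integrable `[0, tau] (fun s => (inner G (X s) (m s))%:E).
  apply: (@le_integrable _ _ _ mu _ mJ _ (fun s => (K + K * `|m s| ^+ 2)%:E)) => //.
    by apply/measurable_EFinP; apply: measurable_funTS; exact: norm_measurable_ip.
  move=> s /=; rewrite in_itv/= => sI; rewrite lee_fin.
  rewrite (le_trans (ip_le ipP _ _))// [leRHS]ger0_norm ?addr_ge0 ?mulr_ge0 ?sqr_ge0//.
  apply: (@le_trans _ _ (K * (1 + `|m s| ^+ 2))); last by rewrite mulrDr mulr1.
  by apply: ler_pM => //; exact: Xs.
pose qs (s : R) := q n (s + h n).
have qsE s : qs s = n.+1%:R * inner G (X (s + h n) - X s - m s) (X (s + h n)).
  by rewrite /qs /q addrK.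
have iqs : mu.-integrable `[0, tau] (EFin \o qs).
  apply: (@le_integrable _ _ _ mu _ mJ _
     (fun s => (n.+1%:R * (2 * K + 1) * K + n.+1%:R * K * `|m s| ^+ 2)%:E)) => //.
    apply/measurable_EFinP; apply: measurable_funTS.
    exact: (measurableT_comp (mq n) (measurable_addr_cst (h n))).
  move=> s /=; rewrite in_itv/= => sI; rewrite lee_fin qsE normrM ger0_norm//.
  rewrite [leRHS]ger0_norm; last by rewrite addr_ge0 ?mulr_ge0 ?sqr_ge0 ?addr_ge0 ?mulr_ge0.
  rewrite -mulrA -(mulrA n.+1%:R K) -mulrDr ler_wpM2l//.
  apply: (le_trans (ip_le ipP _ _)).
  have h1 : `|X (s + h n) - X s - m s| <= 2 * K + 1 + `|m s| ^+ 2.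
    apply: (le_trans (ler_normB _ _)); rewrite -addrA; apply: lerD => //.
    apply: (le_trans (ler_normB _ _)); rewrite mulr_natl mulr2n.
    by apply: lerD; [exact: Xsh|exact: Xs].
  have h2 := Xsh _ sI.
  apply: (@le_trans _ _ ((2 * K + 1 + `|m s| ^+ 2) * K)).
    by apply: ler_pM.
  by rewrite mulrDl (mulrC (`|m s| ^+ 2)).
have iq : mu.-integrable `[h n, tau + h n] (EFin \o q n).
  have := @integrable_shift R qs (h n) (tau + h n) (- h n).
  rewrite subrr addrK => /(_ iqs); apply: eq_integrable => // t _ /=.
  by rewrite /qs subrK.
split => //.
have hb : h n <= b by rewrite /b (le_trans (ltW hd))// lerDr ltW.
have thb : tau + h n <= b by rewrite lerD2l ltW.
have iX2s : mu.-integrable `[0, tau] (fun s => (`|X (s + h n : R)| ^+ 2)%:E).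
  apply: (@integrable_shift R (fun r => `|X r| ^+ 2)); rewrite add0r.
  by apply: iX2 => //; [exact: ltW|rewrite lerDr ltW].
have iX20 : mu.-integrable `[0, tau] (EFin \o (fun r => `|X r| ^+ 2)).
  by apply: iX2 => //; [exact: ltW|rewrite lerDl ltW].
have iL : mu.-integrable `[0, tau] (fun s => (`|X (s + h n : R)| ^+ 2 - `|X s| ^+ 2)%:E).
  have := integrableB mJ iX2s iX20; exact: eq_integrable.
have i1 : mu.-integrable `[0, tau] (fun s => (2 * h n * qs s)%:E).
  have := integrableZl mJ (2 * h n) iqs; exact: eq_integrable.
have i2 : mu.-integrable `[0, tau] (fun s => (2 * inner G (X s) (m s))%:E).
  have := integrableZl mJ 2 ixm; exact: eq_integrable.
have i12 : mu.-integrable `[0, tau] (fun s => (2 * h n * qs s + 2 * inner G (X s) (m s))%:E).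
  have := integrableD mJ i1 i2; exact: eq_integrable.
have i123 : mu.-integrable `[0, tau] (fun s =>
    (2 * h n * qs s + 2 * inner G (X s) (m s) + `|m s| ^+ 2)%:E).
  have := integrableD mJ i12 im2; exact: eq_integrable.
(* For [x = X s], [y = X (s + h n)] and [z = m s] the right side minus the left side is exactly
   [|y - x - z|^2]. *)
have step s : `[0, tau]%classic s -> `|X (s + h n : R)| ^+ 2 - `|X s| ^+ 2 <=
    2 * h n * qs s + 2 * inner G (X s) (m s) + `|m s| ^+ 2.
  move=> _; rewrite qsE mulrA -(mulrA 2 (h n)) mulVf ?pnatr_eq0// mulr1.
  move: (X s) (X (s + h n)) (m s) => x y z.
  have : 0 <= `|y - x - z| ^+ 2 by exact: sqr_ge0.
  rewrite -!(ip_norm ipP) !(ipBl ipP) !(ipBr ipP).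
  rewrite (ip_sym ipP x y) (ip_sym ipP z y) (ip_sym ipP z x); lra.
have := le_Rintegral mJ iL i123 step.
rewrite RintegralB// RintegralD// RintegralD// RintegralZl// RintegralZl//.
have mXI : measurable_fun `[0 + h n, tau + h n]%classic (fun r => `|X r| ^+ 2).
  exact: (measurable_funTS mX2).
have mqI : measurable_fun `[0 + h n, tau + h n]%classic (q n).
  exact: (measurable_funTS (mq n)).
rewrite (integral_shift mXI) (integral_shift mqI) !add0r.
have iX0 : mu.-integrable `[0, tau + h n] (EFin \o (fun r => `|X r| ^+ 2)).
  by apply: iX2 => //; rewrite addr_ge0// ltW.
(* Both integrals of [|X|^2] are compared with the one over [[0, tau + h n]], which also covers the
   case [h n > tau]. *)
have S1 := @Rintegral_itvB R _ (BLeft 0) (BRight (tau + h n)) tau iX0.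
have S2 := @Rintegral_itvB R _ (BLeft 0) (BRight (tau + h n)) (h n) iX0.
rewrite !bnd_simp in S1 S2.
have {}S1 := S1 (ltW tau0) ltac:(by rewrite lerDl ltW).
have {}S2 := S2 (ltW hn0) ltac:(by rewrite lerDr ltW).
rewrite Rintegral_itv_obnd_cbnd in S1; last first.
  by apply: integrableS iX0 => //; apply: subset_itvr; rewrite bnd_simp ltW.
rewrite Rintegral_itv_obnd_cbnd in S2; last first.
  by apply: integrableS iX0 => //; apply: subset_itvr; rewrite bnd_simp ltW.
have C2 : n.+1%:R * (\int[mu]_(s in `[0, tau]) `|m s| ^+ 2) <= 1.
  have fin2 := integrable_fin_num mJ im2.
  by move: f2; rewrite -(fineK fin2) -EFinM lee_fin.
have nh : n.+1%:R * h n = 1 by rewrite divff// pnatr_eq0.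
have n1 : 0 < n.+1%:R :> R by rewrite ltr0n.
(* The constant 2 in the conclusion is [2 * 2^-1 + 1], from the two noise bounds. *)
have alg (k hh c1 c2 bq b0 b1 b2 b3 b4 : R) : k * c1 <= 2^-1 -> k * c2 <= 1 ->
    b0 - b1 = b2 -> b0 - b3 = b4 -> k * hh = 1 -> 0 < k ->
    b4 - b1 <= 2 * hh * bq + 2 * c1 + c2 -> k * b2 - k * b3 <= 2 * bq + 2.
  move=> hc1 hc2 <- <- kh k0 main.
  have -> : k * (b0 - b1) - k * b3 = k * (b0 - b3 - b1) by ring.
  apply: le_trans (ler_wpM2l (ltW k0) main) _.
  have -> : k * (2 * hh * bq + 2 * c1 + c2) = 2 * bq * (k * hh) + 2 * (k * c1) + k * c2 by ring.
  by rewrite kh mulr1; lra.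
exact: (alg _ _ _ _ _ _ _ _ _ _ f1 C2 S1 S2 nh n1).
Qed.

(** Fatou replaces the difference quotients by [p0], which is at most [- kappa], while the averages
    of [|X|^2] converge at both end times by right continuity. *)
Lemma energy_inequality : `|X tau| ^+ 2 <= `|X 0| ^+ 2 - 2 * kappa * tau + 2.
Proof.
have [N2 [mN2 N20 leb]] := lebesgue_null.
have b0 : 0 < b by rewrite addr_gt0.
pose D : set (measurableTypeR R) := `]0, b]%classic `\` (N1 `|` N2).
have mD : measurable D by apply: measurableD; [exact: measurable_itv|exact: measurableU].
have D_b t : D t -> 0 <= t <= b.
  by move=> [+ _] => /=; rewrite in_itv/= => /andP[/ltW -> ->].
have D_N1 t : D t -> ~ N1 t by move=> [_ n12] n1; apply: n12; left.
have D_pos t : D t -> 0 < t by move=> [+ _] => /=; rewrite in_itv/= => /andP[].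
have aeD : {ae mu, forall t : R, 0 <= t <= tau + delta -> D t}.
  exists ([set 0] `|` (N1 `|` N2)); split.
  - by apply: measurableU => //; exact: measurableU.
  - have N120 : mu (N1 `|` N2) = 0%E.
      by apply/eqP; rewrite -measure_le0; apply: le_trans (measureU2 _ _ _) _ => //; rewrite [X in (X + _)%E]N10 [X in (_ + X)%E]N20 adde0.
    apply/eqP; rewrite -measure_le0; apply: le_trans (measureU2 _ _ _) _ => //; first exact: measurableU.
    by rewrite [X in (_ + X)%E]N120 [X in (X + _)%E]lebesgue_measure_set1 adde0.
  move=> t /= ht; apply: contrapT => h'; apply: ht => /andP[t1 t2]; split.
    rewrite /= in_itv/= t2 andbT lt_neqAle t1 andbT; apply/eqP => t0; apply: h'; left; exact/esym.
  by move=> n12; apply: h'; right.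
have qE n t : D t -> h n <= t ->
    q n t = n.+1%:R * \int[mu]_(r in `[t - h n, t]) pairing G (a r) (v t).
  move=> Dt ht; have [XV _ _] := good (D_b _ Dt) (D_N1 _ Dt).
  rewrite /q [in X in inner G _ X]XV Xeq ?subr_ge0//.
  - by rewrite gerBl ltW.
  - by have /andP[] := D_b _ Dt.
have qp t : D t -> 0 < t -> q n t @[n --> \oo] --> p0 t.
  move=> Dt t0.
  have nt : ~ N2 t by move=> n2; apply: Dt.2; right.
  apply/subr_cvg0; apply/norm_cvg0P.
  have cl : `|v t| * (n.+1%:R * \int[mu]_(r in `[t - n.+1%:R^-1, t]) `|a r - a t|) @[n --> \oo] --> 0.
    by rewrite -(mulr0 `|v t|); apply: cvgMr; exact: leb.
  apply: (@squeeze_cvgr _ _ _ _ (fun=> 0) _ _ _ _ (cvg_cst _) cl).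
  apply: filterS (near_infty_natSinv_lt (PosNum t0)) => n /= /ltW hn.
  rewrite normr_ge0/= qE//.
  have mI : measurable (`[t - h n, t]%classic : set (measurableTypeR R)) by exact: measurable_itv.
  have muI : mu `[t - h n, t]%classic = (h n)%:E.
    by rewrite lebesgue_measure_segment ?gerBl ?(ltW (h0 n))// opprB addrCA subrr addr0.
  have ic (k : R) : mu.-integrable `[t - h n, t] (fun=> k%:E).
    apply/integrableP; split; first exact: measurable_cst.
    by rewrite integral_cst//= [X in (_ * X)%E]muI -EFinM ltry.
  have -> : p0 t = n.+1%:R * \int[mu]_(r in `[t - h n, t]) p0 t.
    by rewrite Rintegral_cst// [X in fine X]muI /= mulrCA divff ?mulr1// pnatr_eq0.
  rewrite -mulrBr -RintegralB//; [|exact: ipair|exact: ic].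
  rewrite normrM ger0_norm// mulrCA ler_wpM2l//.
  have ina : mu.-integrable `[t - h n, t] (fun r => (`|a r - a t|)%:E).
    have ia1 : mu.-integrable `[t - h n, t] (fun r => (`|a r|)%:E).
      apply: (integrableS measurableT) => //; apply/integrableP; split.
        apply/measurable_EFinP; apply: norm_measurable_norm.
        exact: strongly_measurable_norm_measurable.
      by under eq_integral do rewrite gee0_abs ?lee_fin//.
    have isum : mu.-integrable `[t - h n, t] (fun r => (`|a r| + `|a t|)%:E).
      have := integrableD mI ia1 (ic `|a t|); exact: eq_integrable.
    apply: (le_integrable _ _ _ isum) => //.
      apply/measurable_EFinP; apply: measurable_funTS.
      exact: (strongly_measurable_norm_measurable sma).
    by move=> r _; rewrite /= lee_fin normr_id [leRHS]ger0_norm ?addr_ge0// ler_normB.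
  have idiff : mu.-integrable `[t - h n, t] (fun r => (pairing G (a r) (v t) - p0 t)%:E).
    have := integrableB mI (ipair (v t) mI) (ic (p0 t)); exact: eq_integrable.
  apply: (le_trans (le_normr_Rintegral _ idiff)) => //.
  rewrite -RintegralZl//; apply: le_Rintegral => //.
  - have := integrable_norm idiff; exact: eq_integrable.
  - have := integrableZl mI `|v t| ina; exact: eq_integrable.
  - by move=> r _; rewrite -pairingB; exact: pairing_le.
(* The map [v] is not known to be measurable; [p] is measurable as a limit built from the [q n]. *)
pose p t := \1_D t * p0 t.
have mp : measurable_fun (setT : set (measurableTypeR R)) p.
  apply: (@measurable_fun_cvg _ _ _ _ (fun n t => \1_D t * q n t)).
    by move=> n; apply: measurable_funM => //; exact: measurable_indic.
  move=> t _; rewrite /p indicE; have [Dt|Dt] := pselect (D t).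
    by rewrite mem_set//; apply: cvgMr; apply: qp => //; exact: D_pos.
  by rewrite memNset//; under eq_fun do rewrite mul0r; rewrite mul0r; exact: cvg_cst.
have pD t : D t -> p t = p0 t by move=> Dt; rewrite /p indicE mem_set// mul1r.
have pnD t : ~ D t -> p t = 0 by move=> Dt; rewrite /p indicE memNset// mul0r.
have p_le0 t : p t <= 0.
  have [Dt|Dt] := pselect (D t); last by rewrite pnD.
  by have [_ h1 _] := good (D_b _ Dt) (D_N1 _ Dt); rewrite pD// (le_trans h1)// oppr_le0.
have ip : mu.-integrable setT (EFin \o p).
  (* Measurability of [Nf] is not known either. The function [m] is measurable and lies below [Nf]
     on [[0, b]], so a comparison of lower integrals bounds its integral. *)
  pose m t := Num.max 0 (- p t / c - 1).
  have mm : measurable_fun (setT : set (measurableTypeR R)) m.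
    apply: measurable_maxr => //; apply: measurable_funB => //.
    by apply: measurable_funM => //; exact: measurableT_comp.
  have m0 t : 0 <= m t by rewrite le_max lexx.
  have im : mu.-integrable setT (EFin \o m).
    apply/integrableP; split; first exact/measurable_EFinP.
    apply: le_lt_trans iN; rewrite [leRHS]integral_mkcond.
    apply: ge0_integral_mono => t _ //; rewrite patchE /= ger0_norm//.
    have [Dt|Dt] := pselect (D t); last first.
      rewrite /m pnD// oppr0 mul0r sub0r (max_idPl _) ?oppr_le0//.
      by case: ifPn => _; rewrite ?lee_fin.
    rewrite mem_set/= ?in_itv/= ?D_b// lee_fin /m ge_max Nf0/= pD//.
    have [_ _ h1] := good (D_b _ Dt) (D_N1 _ Dt).
    by rewrite lerBlDl ler_pdivrMr// mulrC.
  have iI : mu.-integrable setT (fun t => (c * \1_(`[0, b]%classic) t)%:E).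
    have i1 : mu.-integrable setT (fun t => (\1_(`[0, b]%classic : set (measurableTypeR R)) t)%:E).
      apply/integrableP; split; first by apply/measurable_EFinP; exact: measurable_indic.
      under eq_integral do rewrite gee0_abs ?lee_fin//.
      by rewrite integral_indic// setIT [X in (X < _)%E]lebesgue_measure_segment ?ltry// ltW.
    have := integrableZl measurableT c i1; exact: eq_integrable.
  have icm : mu.-integrable setT (fun t => (c * m t)%:E).
    have := integrableZl measurableT c im; exact: eq_integrable.
  have isum : mu.-integrable setT (fun t => (c * m t + c * \1_(`[0, b]%classic) t)%:E).
    have := integrableD measurableT icm iI; exact: eq_integrable.
  apply: (le_integrable _ _ _ isum) => //; first exact/measurable_EFinP.
  move=> t _; rewrite /= lee_fin [leRHS]ger0_norm; last first.
    by rewrite addr_ge0// mulr_ge0// ?(ltW c0)// indicE ler0n.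
  have [Dt|Dt] := pselect (D t); last first.
    by rewrite pnD// normr0 addr_ge0// mulr_ge0// ?(ltW c0)// indicE ler0n.
  rewrite indicE mem_set/= ?in_itv/= ?D_b// mulr1 ler0_norm//.
  have : - p t / c - 1 <= m t by rewrite le_max lexx orbT.
  by rewrite lerBlDr ler_pdivrMr// mulrDl mul1r mulrC.
(* With this [w] the hypothesis [cross] reads [pairing G (a r) (v t) <= w r + w t]; averaging over
   [r] gives the majorant for Fatou. *)
pose w t := \1_D t * (c * (1 - p0 t)).
have wD t : D t -> w t = c * (1 - p0 t) by move=> Dt; rewrite /w indicE mem_set// mul1r.
have wE t : w t = c * (\1_D t - p t).
  by rewrite /w /p mulrCA mulrBr mulr1.
have w0 t : 0 <= w t.
  have [Dt|Dt] := pselect (D t); last by rewrite /w indicE memNset// mul0r.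
  rewrite wD// mulr_ge0 ?(ltW c0)// -pD//.
  by rewrite subr_ge0 (le_trans (p_le0 t)).
have mw : measurable_fun (setT : set (measurableTypeR R)) w.
  rewrite (_ : w = fun t => c * (\1_D t - p t)); last by apply/funext.
  by apply: measurable_funM => //; apply: measurable_funB => //; exact: measurable_indic.
have iw : mu.-integrable setT (EFin \o w).
  have i1 : mu.-integrable setT (fun t => (\1_D t)%:E).
    apply/integrableP; split; first by apply/measurable_EFinP; exact: measurable_indic.
    under eq_integral do rewrite gee0_abs ?lee_fin//.
    rewrite integral_indic// setIT.
    apply: (@le_lt_trans _ _ (mu `[0, b]%classic)); last first.
      by rewrite lebesgue_measure_segment ?ltry// ltW.
    apply: le_measure; [by rewrite inE|by rewrite inE; exact: segment_measurable|].
    by move=> t /D_b /=; rewrite in_itv.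
  have := integrableZl measurableT c (integrableB measurableT i1 ip).
  by apply: eq_integrable => // t _; rewrite /= wE.
have qw n t : D t -> h n <= t -> t <= tau + delta ->
    q n t <= n.+1%:R * (\int[mu]_(r in `[t - h n, t]) w r) + w t.
  move=> Dt ht tb; rewrite qE//.
  have mI : measurable (`[t - h n, t]%classic : set (measurableTypeR R)) by exact: measurable_itv.
  have muI : mu `[t - h n, t]%classic = (h n)%:E.
    by rewrite lebesgue_measure_segment ?gerBl ?(ltW (h0 n))// opprB addrCA subrr addr0.
  have ic : mu.-integrable `[t - h n, t] (fun=> (w t)%:E).
    apply/integrableP; split; first exact: measurable_cst.
    by rewrite integral_cst//= [X in (_ * X)%E]muI -EFinM ltry.
  have iwI : mu.-integrable `[t - h n, t] (EFin \o w) by apply: integrableS iw.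
  have -> : w t = n.+1%:R * \int[mu]_(r in `[t - h n, t]) w t.
    by rewrite Rintegral_cst// [X in fine X]muI /= mulrCA divff ?mulr1// pnatr_eq0.
  rewrite -mulrDr ler_wpM2l// -RintegralD//.
  apply: ae_le_Rintegral => //.
  - exact: ipair.
  - have := integrableD mI iwI ic; exact: eq_integrable.
  apply: ae_imply aeD => r Dr /=; rewrite in_itv/= => /andP[r1 r2].
  have {}Dr : D r by apply: Dr; rewrite (le_trans _ r1) ?subr_ge0//= (le_trans r2).
  by rewrite !wD//; apply: cross; [exact: D_b|exact: D_N1|exact: D_b|exact: D_N1].
pose u n := n.+1%:R * (\int[mu]_(r in `[tau, tau + h n]) `|X r| ^+ 2) -
            n.+1%:R * (\int[mu]_(r in `[0, 0 + h n]) `|X r| ^+ 2).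
have X2K t : 0 <= t <= b -> `| `|X t| ^+ 2 | <= K ^+ 2.
  by move=> tb; rewrite ger0_norm ?sqr_ge0// lerXn2r ?nnegrE// XK.
have sq_cvg (t : R) : X s @[s --> t^'+] --> X t -> `|X s| ^+ 2 @[s --> t^'+] --> `|X t| ^+ 2.
  move=> ct; have ct' : `|X s| @[s --> t^'+] --> `|X t| by apply: cvg_norm.
  have FF : Filter (t^'+) by exact: at_right_proper_filter.
  have := cvgM ct' ct'; rewrite -expr2 => /(_ FF); apply: cvg_trans.
  by apply: near_eq_cvg; apply: nearW => s; rewrite expr2.
have ucvg : u n @[n --> \oo] --> `|X tau| ^+ 2 - `|X 0| ^+ 2.
  apply: cvgB.
    apply: (@right_average_cvg _ (fun r => `|X r| ^+ 2) tau delta (K ^+ 2)) => //.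
      by move=> r /andP[r1 r2]; rewrite X2K// r2 (le_trans (ltW tau0)).
    exact: sq_cvg.
  apply: (@right_average_cvg _ (fun r => `|X r| ^+ 2) 0 b (K ^+ 2)) => //.
    by move=> r; rewrite add0r; exact: X2K.
  exact: sq_cvg.
pose y_ n := (2 - u n) / 2.
have ycvg : y_ n @[n --> \oo] --> (2 - (`|X tau| ^+ 2 - `|X 0| ^+ 2)) / 2.
  by apply: cvgMl; apply: cvgB => //; exact: cvg_cst.
have fr n0 : exists n, [/\ (n0 <= n)%N, mu.-integrable `[h n, tau + h n] (EFin \o q n) &
    - (\int[mu]_(t in `[h n, (tau + h n)%R]) q n t) <= y_ n].
  have [N _ hN] := near_infty_natSinv_lt (PosNum delta0).
  have [n [nn f1 f2]] := freq (maxn n0 N).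
  have hd : h n < delta by apply: hN; exact: leq_trans (leq_maxr _ _) nn.
  have [iqn mainq] := energy_frequent hd f1 f2.
  exists n; split => //; first exact: leq_trans (leq_maxl _ _) nn.
  have : u n <= 2 * (\int[mu]_(t in `[h n, (tau + h n)%R]) q n t) + 2 by exact: mainq.
  by rewrite /y_; lra.
have qp' t : D t -> 0 < t -> q n t @[n --> \oo] --> p t by move=> Dt t0; rewrite pD//; exact: qp.
have fat := fatou_average delta0 aeD mq mw w0 iw ip qp' qw ycvg fr.
have mI : measurable (`[0, tau]%classic : set (measurableTypeR R)) by exact: measurable_itv.
have muI : mu `[0, tau]%classic = tau%:E by rewrite lebesgue_measure_segment ?ltW// subr0.
have : \int[mu]_(t in `[0, tau]) p t <= \int[mu]_(t in `[0, tau]) (- kappa).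
  apply: ae_le_Rintegral => //.
  - exact: integrableS ip.
  - apply/integrableP; split; first exact: measurable_cst.
    by rewrite integral_cst//= [X in (_ * X)%E]muI -EFinM ltry.
  apply: ae_imply aeD => t Dt /=; rewrite in_itv/= => /andP[t1 t2].
  have {}Dt : D t by apply: Dt; rewrite t1 (le_trans t2)// lerDl ltW.
  by rewrite pD//; have [] := good (D_b _ Dt) (D_N1 _ Dt).
rewrite Rintegral_cst// [X in fine X]muI /=.
set P := \int[mu]_(t in `[0, tau]) p t in fat *.
by move: fat; lra.
Qed.

End energy.

(** * Compensated Poisson measures *)

Section quadratic_form.
Context (R : realType) (H : normedModType R) (ip : H -> H -> R).
Hypothesis ipP : is_inner_product ip.
Context (d : measure_display) (T : measurableType d) (mu : {measure set T -> \bar R}).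
Local Open Scope ereal_scope.

(** Applied twice with the same matrix [k], to indicators under the intensity and to compensated
    counts under [Q]; the isometry is the equality of the two results. *)
Lemma integral_sqr_norm_sum n (x : 'I_n -> T -> R) (v : 'I_n -> H) (k : 'I_n -> 'I_n -> R) :
  (forall i j, mu.-integrable setT (fun w => (x i w * x j w)%:E)) ->
  (forall i j, \int[mu]_w (x i w * x j w)%:E = (k i j)%:E) ->
  \int[mu]_w (`|\sum_(i < n) x i w *: v i|%R ^+ 2)%:E =
  (\sum_(i < n) \sum_(j < n) ip (v i) (v j) * k i j)%R%:E.
Proof.
move=> ix kx.
have E w : (`|\sum_(i < n) x i w *: v i|%R ^+ 2)%:E =
    \sum_(i < n) \sum_(j < n) (ip (v i) (v j))%:E * (x i w * x j w)%:E.
  rewrite -(ip_norm ipP) ip_suml// -sumEFin; apply: eq_bigr => i _.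
  rewrite (ipZl ipP) ip_sumr// mulr_sumr -sumEFin; apply: eq_bigr => j _.
  by rewrite (ipZr ipP) -EFinM; congr EFin; ring.
under eq_integral do rewrite E.
have ixx i j : mu.-integrable setT (fun w => (ip (v i) (v j))%:E * (x i w * x j w)%:E).
  exact: integrableZl.
rewrite integral_sum//; last by move=> i; apply: integrable_sum.
rewrite -sumEFin; apply: eq_bigr => i _.
rewrite integral_sum// -sumEFin; apply: eq_bigr => j _.
by rewrite integralZl// kx -EFinM.
Qed.

End quadratic_form.

Section compensated.
Context (R : realType) (H : normedModType R) (ip : H -> H -> R).
Hypothesis ipP : is_inner_product ip.
Context (d : measure_display) (Omega : measurableType d) (Q : probability Omega R).
Context (d' : measure_display) (S : measurableType d') (m : {measure set S -> \bar R}).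
Variable N : Omega -> {measure set S -> \bar R}.
Local Open Scope ereal_scope.

Definition admissible (Gam B : set S) := [/\ measurable B, B `<=` Gam & m B < +oo].

(** The part of the Poisson property that second moments require, relative to [Gam], so that it
    survives conditioning on an event about the region outside [Gam]. Independence is asked of pairs
    only. *)
Record poisson_on (Gam : set S) : Prop := PoissonOn {
  po_measurable : forall B C, admissible Gam B -> measurable C ->
    measurable [set w | C (N w B)] ;
  po_law : forall B, admissible Gam B -> forall n : nat,
    Q [set w | N w B = (n%:R)%:E] = poisson_prob (fine (m B)) n [set n] ;
  po_independent : forall B B' C C', admissible Gam B -> admissible Gam B' ->
    B `&` B' = set0 -> measurable C -> measurable C' ->
    Q ([set w | C (N w B)] `&` [set w | C' (N w B')]) =
    Q [set w | C (N w B)] * Q [set w | C' (N w B')]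
}.

Variable Gam : set S.
Hypothesis po : poisson_on Gam.
Local Notation adm := (admissible Gam).

Definition count (B : set S) (w : Omega) : R := fine (N w B).

Definition compensated (B : set S) (w : Omega) : R := (count B w - fine (m B))%R.

Lemma measurable_count B : adm B -> measurable_fun setT (count B).
Proof.
move=> aB _ C mC; rewrite setTI.
apply: (po_measurable po (C := fine @^-1` C) aB).
by rewrite -[X in measurable X]setTI; exact: fine_measurable.
Qed.

Lemma measurable_compensated B : adm B -> measurable_fun setT (compensated B).
Proof. by move=> aB; apply: measurable_funB => //; exact: measurable_count. Qed.

(** The Poisson probabilities of the finite values add up to 1. *)
Lemma count_fin B : adm B -> {ae Q, forall w, N w B \is a fin_num}.
Proof.
move=> aB; pose D (n : nat) := [set w | N w B = (n%:R)%:E].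
have mD n : measurable (D n).
  by apply: (po_measurable po (C := [set (n%:R)%:E]) aB); exact: emeasurable_set1.
have tD : trivIset setT D.
  apply/trivIsetP => i j _ _ ij; apply/seteqP; split => // w [/= h1 h2].
  have := etrans (esym h1) h2 => -[] /eqP; by rewrite eqr_nat (negbTE ij).
have mU : measurable (\bigcup_n D n) by exact: bigcup_measurable.
have PD : Q (\bigcup_n D n) = 1.
  rewrite measure_bigcup//= [LHS](@eq_eseriesl _ _ predT); last by move=> n; rewrite mem_set.
  transitivity (poisson_prob (fine (m B)) 0 setT); last exact: probability_setT.
  rewrite (_ : setT = \bigcup_(n in setT) [set n]); last first.
    by apply/seteqP; split => // n _; exists n.
  rewrite measure_bigcup//=; last first.
    by apply/trivIsetP => i j _ _ ij; apply/seteqP; split => // n [/= -> /eqP]; rewrite (negbTE ij).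
  rewrite [RHS](@eq_eseriesl _ _ predT); last by move=> n; rewrite mem_set.
  by apply: eq_eseriesr => n _; rewrite /D (po_law po aB).
exists (~` (\bigcup_n D n)); split; first exact: measurableC.
- by rewrite probability_setC ?PD ?subee.
- by move=> w /= hw [n _ /= Yn]; apply: hw; rewrite Yn.
Qed.

Lemma count_law B : adm B -> forall n : nat,
  Q [set w | count B w = n%:R] = poisson_prob (fine (m B)) n [set n].
Proof.
move=> aB n; rewrite -(po_law po aB).
have mD : measurable [set w | N w B = (n%:R)%:E].
  by apply: (po_measurable po (C := [set (n%:R)%:E]) aB); exact: emeasurable_set1.
have mc : measurable [set w | count B w = n%:R].
  rewrite -[X in measurable X]setTI; exact: (measurable_count aB measurableT (measurable_set1 n%:R)).
(* Since [fine] sends an infinite count to 0, the two events may differ, but only on the null set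
   [Z]. *)
have [Z [mZ Z0 hZ]] := count_fin aB.
have ZE (A : set Omega) : measurable A -> Q A = Q (A `\` Z).
  move=> mA; rewrite -{1}(setDUK (A := Z `&` A) (B := A)); last by move=> ? [].
  rewrite measureU//; [|exact: measurableI|by apply: measurableD => //; exact: measurableI|]; last first.
    by apply/seteqP; split => // w [[? ?] [_]]; apply.
  rewrite [X in X + _](_ : _ = 0) ?add0e.
    by congr (Q _); apply/seteqP; split => w [Aw h]; split => // Zw; apply: h => //; case: Zw.
  by apply/eqP; rewrite -measure_le0 -[X in _ <= X]Z0; apply: le_measure; rewrite ?inE//; exact: measurableI.
rewrite (ZE _ mD) (ZE _ mc); congr (Q _); apply/seteqP; split => w /= [h Zw]; split => //.
  have fin : N w B \is a fin_num by apply: contrapT => nf; apply: Zw; exact: hZ.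
  by rewrite -(fineK fin); congr EFin; exact: h.
by rewrite /count h.
Qed.

Let fine_m_ge0 B : (0 <= fine (m B))%R. Proof. exact: fine_ge0. Qed.

Let count_integrable B : adm B -> Q.-integrable setT (EFin \o count B).
Proof.
by move=> aB; apply: (poisson_integrable (measurable_count aB) (fine_m_ge0 B) (count_law aB)).
Qed.

Lemma compensated_integrable B : adm B -> Q.-integrable setT (EFin \o compensated B).
Proof.
move=> aB; have ic : Q.-integrable setT (fun=> (fine (m B))%:E) by exact: finite_measure_integrable_cst.
by have := integrableB measurableT (count_integrable aB) ic; exact: eq_integrable.
Qed.

Lemma compensated_mean B : adm B -> \int[Q]_w (compensated B w)%:E = 0.
Proof.
move=> aB; have ic : Q.-integrable setT (fun=> (fine (m B))%:E) by exact: finite_measure_integrable_cst.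
have := integralB measurableT (count_integrable aB) ic.
rewrite (poisson_mean (measurable_count aB) (fine_m_ge0 B) (count_law aB)).
rewrite integral_cst// [X in _ * X](probability_setT Q) mule1 subee// => <-.
Qed.

Lemma compensated_variance B : adm B -> \int[Q]_w (compensated B w ^+ 2)%:E = (fine (m B))%:E.
Proof.
by move=> aB; exact: (poisson_variance (measurable_count aB) (fine_m_ge0 B) (count_law aB)).
Qed.

Let mul_integrable (f g : Omega -> R) : measurable_fun setT f -> measurable_fun setT g ->
  \int[Q]_w (f w ^+ 2)%:E < +oo -> \int[Q]_w (g w ^+ 2)%:E < +oo ->
  Q.-integrable setT (EFin \o (f \* g)%R).
Proof.
move=> mf mg f2 g2.
have i2 (k : Omega -> R) : measurable_fun setT k -> \int[Q]_w (k w ^+ 2)%:E < +oo ->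
    Q.-integrable setT (fun w => (k w ^+ 2)%:E).
  move=> mk k2; apply/integrableP; split; first by apply/measurable_EFinP; exact: measurable_funX.
  by under eq_integral do rewrite gee0_abs ?lee_fin ?sqr_ge0//.
have isum := integrableD measurableT (i2 _ mf f2) (i2 _ mg g2).
apply: (le_integrable measurableT _ _ isum).
  by apply/measurable_EFinP; exact: measurable_funM.
move=> w _; rewrite /= lee_fin [leRHS]ger0_norm ?addr_ge0 ?sqr_ge0//.
set x := f w; set y := g w.
have := sqr_ge0 (x - y); have := sqr_ge0 (x + y); rewrite sqrrB sqrrD => *.
by rewrite ler_norml; apply/andP; split; nra.
Qed.

Lemma mul_square_integrable (f g : Omega -> R) : measurable_fun setT f -> measurable_fun setT g ->
  \int[Q]_w (f w ^+ 2)%:E < +oo -> \int[Q]_w (g w ^+ 2)%:E < +oo ->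
  Q.-integrable setT (EFin \o (f \* g)%R).
Proof. exact: mul_integrable. Qed.

Lemma compensated_mul_integrable B B' : adm B -> adm B' ->
  Q.-integrable setT (fun w => (compensated B w * compensated B' w)%:E).
Proof.
move=> aB aB'; apply: (mul_integrable (measurable_compensated aB) (measurable_compensated aB')).
  by rewrite compensated_variance// ltry.
by rewrite compensated_variance// ltry.
Qed.

Lemma compensated_disjoint B B' : adm B -> adm B' -> B `&` B' = set0 ->
  \int[Q]_w (compensated B w * compensated B' w)%:E = 0.
Proof.
move=> aB aB' BB'.
apply: integral_indep_eq0.
- exact: measurable_compensated.
- exact: measurable_compensated.
- move=> A A' mA mA'.
  have mC (X : set S) (Z : set R) : measurable Z ->
      measurable ((fun x => (fine x - fine (m X))%R) @^-1` Z : set (\bar R)).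
    move=> mZ; rewrite -[X in measurable X]setTI.
    by apply: measurable_funB => //; exact: fine_measurable.
  exact: (po_independent po aB aB' BB' (mC B A mA) (mC B' A' mA')).
- exact: compensated_integrable.
- exact: compensated_mul_integrable.
- exact: compensated_mean.
Qed.

Lemma admS B B' : adm B -> measurable B' -> B' `<=` B -> adm B'.
Proof.
move=> [mB BG Boo] mB' BB'; split => //; first exact: subset_trans BG.
by apply: le_lt_trans Boo; apply: le_measure; rewrite ?inE.
Qed.

Lemma compensatedU B B' : adm B -> adm B' -> B `&` B' = set0 ->
  {ae Q, forall w, compensated (B `|` B') w = (compensated B w + compensated B' w)%R}.
Proof.
move=> aB aB' BB'; have [mB _ Boo] := aB; have [mB' _ B'oo] := aB'.
have := count_fin aB'; have := count_fin aB; apply: filterS2 => w f1 f2.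
rewrite /compensated /count !measureU// !fineD//; first by ring.
- by rewrite ge0_fin_numE.
- by rewrite ge0_fin_numE.
Qed.

(** Splitting both sets along their intersection leaves, by independence, only the variance of the
    common part. *)
Lemma compensated_covariance B B' : adm B -> adm B' ->
  \int[Q]_w (compensated B w * compensated B' w)%:E = (fine (m (B `&` B')))%:E.
Proof.
move=> aB aB'; have [mB _ Boo] := aB; have [mB' _ B'oo] := aB'.
have aI : adm (B `&` B') by apply: admS aB _ _; [exact: measurableI|move=> x []].
have aD : adm (B `\` B') by apply: admS aB _ _; [exact: measurableD|move=> x []].
have aD' : adm (B' `\` B) by apply: admS aB' _ _; [exact: measurableD|move=> x []].
have BE : B = (B `&` B') `|` (B `\` B') by rewrite setUIDK.
have B'E : B' = (B `&` B') `|` (B' `\` B) by rewrite setIC setUIDK.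
have dB : (B `&` B') `&` (B `\` B') = set0.
  by apply/seteqP; split => // x [[_ h] [_]].
have dB' : (B `&` B') `&` (B' `\` B) = set0.
  by apply/seteqP; split => // x [[h _] [_]].
have dD : (B `\` B') `&` (B' `\` B) = set0.
  by apply/seteqP; split => // x [[h _] [_]].
pose x1 := compensated (B `&` B'); pose x2 := compensated (B `\` B'); pose x3 := compensated (B' `\` B).
transitivity (\int[Q]_w ((x1 w * x1 w)%:E + (x1 w * x3 w)%:E + ((x2 w * x1 w)%:E + (x2 w * x3 w)%:E))).
  have := compensatedU aI aD' dB'; have := compensatedU aI aD dB.
  rewrite -BE -B'E => h1 h2.
  apply: ae_eq_integral => //.
  - exact: measurable_int (compensated_mul_integrable aB aB').
  - by apply: emeasurable_funD; apply: emeasurable_funD; apply: measurable_int; apply: compensated_mul_integrable.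
  - apply: filterS2 h1 h2 => w -> -> _; rewrite -!EFinD; congr EFin; rewrite /x1 /x2 /x3; ring.
have i11 := compensated_mul_integrable aI aI.
have i13 := compensated_mul_integrable aI aD'.
have i21 := compensated_mul_integrable aD aI.
have i23 := compensated_mul_integrable aD aD'.
rewrite integralD//; [|exact: integrableD..].
rewrite integralD// integralD//.
rewrite (compensated_disjoint aI aD' dB') (compensated_disjoint aD aI); last by rewrite setIC.
rewrite (compensated_disjoint aD aD' dD) !adde0.
by under eq_integral do rewrite -expr2; exact: compensated_variance.
Qed.

(** Both sides are the same quadratic form in the values of [s], whose matrix consists of the
    intensities of pairwise intersections; overlapping sets are thus allowed. *)
Lemma compensated_step_isometry (s : step_fun S H) :
  (forall i : 'I_(step_size s), adm (step_set i)) ->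
  \int[Q]_w (`|step_integral (N w) s - step_integral m s| ^+ 2)%:E =
  \int[m]_p (`|step_eval s p| ^+ 2)%:E.
Proof.
move=> as_.
rewrite (@integral_sqr_norm_sum R H ip ipP _ _ m _ (fun i => \1_(step_set i)) (@step_val _ _ s)
  (fun i j => fine (m (step_set i `&` step_set j)))); last 2 first.
- move=> i j; have [mi _ ioo] := as_ i; have [mj _ joo] := as_ j.
  rewrite (_ : (fun w => _) = (fun w => (\1_(step_set i `&` step_set j) w)%:E)); last first.
    by apply/funext => w; rewrite indicI.
  apply: integrable_step_indic => //; first exact: measurableI.
  by apply: le_lt_trans ioo; apply: le_measure; rewrite ?inE//; exact: measurableI.
- move=> i j; have [mi _ ioo] := as_ i; have [mj _ joo] := as_ j.
  rewrite (_ : (fun w => _) = (fun w => (\1_(step_set i `&` step_set j) w)%:E)); last first.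
    by apply/funext => w; rewrite indicI.
  rewrite integral_indic//; last exact: measurableI.
  rewrite setIT fineK// ge0_fin_numE//.
  by apply: le_lt_trans ioo; apply: le_measure; rewrite ?inE//; exact: measurableI.
rewrite -(@integral_sqr_norm_sum R H ip ipP _ _ Q _ (fun i => compensated (step_set i)) (@step_val _ _ s)).
- apply: eq_integral => w _; rewrite /step_integral -sumrB; congr (`| _ | ^+ 2)%:E.
  by apply: eq_bigr => i _; rewrite scalerBl.
- by move=> i j; exact: compensated_mul_integrable.
- by move=> i j; exact: compensated_covariance.
Qed.

Lemma norm_measurable_compensated_step (s : step_fun S H) : separable_space H ->
  (forall i : 'I_(step_size s), adm (step_set i)) ->
  norm_measurable setT (fun w => step_integral (N w) s - step_integral m s)%R.
Proof.
move=> sepH as_.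
rewrite (_ : (fun w => _) = fun w => (\sum_(i < step_size s) compensated (step_set i) w *: step_val i)%R).
  apply: norm_measurable_sum => // i; apply: norm_measurable_scale.
  exact: measurable_compensated.
apply/funext => w; rewrite /step_integral -sumrB.
by apply: eq_bigr => i _; rewrite scalerBl.
Qed.

End compensated.

(** * Conditioning on an event of positive probability *)

Section conditioning.
Context (R : realType) (d : measure_display) (T : measurableType d).
Variable P : probability T R.
Variable B : set T.
Hypotheses (mB : measurable B) (B0 : (0 < P B)%E).
Local Open Scope ereal_scope.

(** The last argument of [mnormalize] is a fallback for a null event, excluded here by [B0]. *)
Definition conditional : probability T R := mnormalize (mrestr P mB) P.

Lemma conditionalE A : measurable A -> conditional A = P (A `&` B) * (fine (P B))^-1%:E.
Proof.
move=> mA; rewrite /conditional/= /mnormalize/= {1 2}/mrestr !setTI.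
have -> : P B == 0 = false by apply/negbTE; rewrite gt_eqF.
have -> : P B == +oo = false.
  by apply/negbTE; rewrite lt_eqF// (le_lt_trans (probability_le1 P mB))// ltry.
by rewrite /= /mrestr setTI.
Qed.

Lemma conditional_le A : measurable A -> conditional A <= (fine (P B))^-1%:E * P A.
Proof.
move=> mA; rewrite conditionalE// muleC lee_wpmul2l ?lee_fin ?invr_ge0 ?fine_ge0//.
by apply: le_measure; rewrite ?inE//; exact: measurableI.
Qed.

(** The hypothesis is conditional independence with denominators cleared. *)
Lemma conditional_indep A E : measurable A -> measurable E ->
  P (A `&` E `&` B) * P B = P (A `&` B) * P (E `&` B) ->
  conditional (A `&` E) = conditional A * conditional E.
Proof.
move=> mA mE h.
have fB : P B \is a fin_num by exact: fin_num_measure.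
have f1 : P (A `&` E `&` B) \is a fin_num by apply: fin_num_measure; apply: measurableI => //; exact: measurableI.
have f2 : P (A `&` B) \is a fin_num by apply: fin_num_measure; exact: measurableI.
have f3 : P (E `&` B) \is a fin_num by apply: fin_num_measure; exact: measurableI.
rewrite !conditionalE//; last exact: measurableI.
have b0 : (fine (P B) != 0)%R by rewrite gt_eqF// fine_gt0// B0 ltey_eq fB.
move: h; rewrite -(fineK f1) -(fineK f2) -(fineK f3) -{1}(fineK fB) -!EFinM => -[h].
by congr EFin; apply: (mulIf b0); rewrite mulfVK// [RHS](_ : _ = fine (P (A `&` B)) * fine (P (E `&` B)) / fine (P B) * (fine (P B) / fine (P B)))%R; [rewrite -h divff// mulr1 mulfK|ring].
Qed.

Lemma conditional_ae (p : T -> Prop) : {ae P, forall w, p w} -> {ae conditional, forall w, B w /\ p w}.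
Proof.
move=> [Z [mZ Z0 hZ]]; exists (Z `|` ~` B); split.
- by apply: measurableU => //; exact: measurableC.
- rewrite conditionalE; last by apply: measurableU => //; exact: measurableC.
  rewrite setIUl setICl setU0 (_ : P _ = 0) ?mul0e//.
  by apply/eqP; rewrite -measure_le0 -Z0; apply: le_measure; rewrite ?inE//; exact: measurableI.
- move=> w /= /not_andP[nB|np]; [by right|left; exact: hZ].
Qed.

End conditioning.

(** * Strips of marks and times *)

Section strips.
Context (R : realType) (H : completeNormedModType R)
  (nu : {sigma_finite_measure set (borel H) -> \bar R}).
Local Open Scope ereal_scope.

Lemma continuous_borel_measurable (f : H -> R) : continuous f ->
  measurable_fun setT (f : borel H -> R).
Proof.
move=> cf; apply: measurability; [exact: RGenOpens.measurableE|].
move=> _ [_ [a [b ->] <-]]; rewrite setTI; apply: sub_sigma_algebra.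
by apply: open_comp; [move=> x _; exact: cf|exact: interval_open].
Qed.

Lemma norm_measurable_borel : norm_measurable setT (id : borel H -> H).
Proof.
move=> y; apply: (continuous_borel_measurable (f := fun z => `|z - y|%R)) => x.
by apply: cvg_norm; apply: cvgB; [exact: cvg_id|exact: cvg_cst].
Qed.

Lemma norm_measurable_mark : norm_measurable setT (fun p : marks_times H R => p.1 : H).
Proof.
by move=> y; apply: (measurableT_comp (norm_measurable_borel y)); exact: measurable_fst.
Qed.

Definition annulus (I : set R) : set (borel H) := [set z | I `|z : H|%R].

Definition strip (I : set R) (s t : R) : set (marks_times H R) :=
  [set p | I `|p.1 : H|%R /\ (s < p.2 <= t)%R].

Lemma measurable_annulus I : measurable I -> measurable (annulus I).
Proof.
by move=> mI; have := norm_measurable_norm norm_measurable_borel measurableT mI; rewrite setTI.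
Qed.

Lemma stripE I s t : strip I s t = annulus I `*` `]s, t].
Proof. by apply/seteqP; split => p [/= h1]; rewrite /= in_itv/=. Qed.

Lemma measurable_strip I s t : measurable I -> measurable (strip I s t).
Proof. by move=> mI; rewrite stripE; apply: measurableX => //; exact: measurable_annulus. Qed.

Lemma intensity_strip I s t : measurable I -> (s <= t)%R ->
  intensity nu (strip I s t) = nu (annulus I) * (t - s)%:E.
Proof.
move=> mI st; rewrite stripE.
transitivity (nu (annulus I) * (@lebesgue_measure R) `]s, t]).
  by apply: product_measure1E => //; exact: measurable_annulus.
by congr (_ * _); rewrite lebesgue_measure_itv/= lte_fin; case: ltgtP st => // ->; rewrite subrr.
Qed.

Lemma strip_upto I s t t' : (0 <= s)%R -> (t <= t')%R -> strip I s t `<=` @upto R H t'.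
Proof. by move=> s0 tt p [_ /andP[h1 h2]]; rewrite /upto/= (le_trans h2 tt) (le_trans s0 (ltW h1)). Qed.

End strips.

(** * Conditioning on the absence of large jumps *)

Section void_conditioning.
Context (R : realType) (H : completeNormedModType R) (d : measure_display)
  (Omega : measurableType d) (P : probability Omega R)
  (F : R -> set (set Omega)) (hF : usual_conditions P F)
  (nu : {sigma_finite_measure set (borel H) -> \bar R})
  (N : Omega -> {measure set (marks_times H R) -> \bar R})
  (hN : poisson_random_measure P F nu N).
Local Open Scope ereal_scope.
Local Notation m := (intensity nu).
Local Notation upto := (@upto R H).
Local Notation after := (@after R H).

Lemma measurable_upto t : measurable (upto t).
Proof.
rewrite (_ : upto t = setT `*` `[0%R, t]); first exact: measurableX.
by apply/seteqP; split => p /=; rewrite /Defs.upto/= in_itv/= => h //; case: h.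
Qed.

Lemma measurable_after t : measurable (after t).
Proof.
rewrite (_ : after t = setT `*` `]t, +oo[); first exact: measurableX.
by apply/seteqP; split => p /=; rewrite /Defs.after/= in_itv/= andbT => h //; case: h.
Qed.

Lemma upto_nonneg t : upto t `<=` @nonneg_time R H.
Proof. by move=> p /andP[]. Qed.

(** Besides the two sets whose counts are compared, a third one carries the void event. *)
Lemma prm_independent3 (B1 B2 B3 : set (marks_times H R)) (C1 C2 C3 : set (\bar R)) t :
  admissible m (upto t) B1 -> admissible m (upto t) B2 -> admissible m (upto t) B3 ->
  measurable C1 -> measurable C2 -> measurable C3 ->
  B1 `&` B2 = set0 -> B1 `&` B3 = set0 -> B2 `&` B3 = set0 ->
  P ([set w | C1 (N w B1)] `&` [set w | C2 (N w B2)] `&` [set w | C3 (N w B3)]) =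
  P [set w | C1 (N w B1)] * P [set w | C2 (N w B2)] * P [set w | C3 (N w B3)].
Proof.
move=> [m1 u1 _] [m2 u2 _] [m3 u3 _] mC1 mC2 mC3 d12 d13 d23.
pose B (i : 'I_3) := if val i is 0%N then B1 else if val i is 1%N then B2 else B3.
pose C (i : 'I_3) := if val i is 0%N then C1 else if val i is 1%N then C2 else C3.
have := prm_independent hN (B := B) (C := C).
rewrite !big_ord_recl big_ord0 mule1 /= /B /C/= -muleA => <-.
- congr (P _); apply/seteqP; split.
    by move=> w [[h1 h2] h3] [[|[|[|//]]] i3].
  by move=> w h; split; [split|]; [exact: (h ord0)|exact: (h (lift ord0 ord0))|exact: (h (lift ord0 (lift ord0 ord0)))].
- by move=> [[|[|[|//]]] i3] /=; split => //; apply: (subset_trans _ (@upto_nonneg t)).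
- apply/trivIsetP => -[[|[|[|//]]] i3] [[|[|[|//]]] j3] _ _ //= _; by rewrite // setIC.
- by move=> [[|[|[|//]]] i3].
Qed.

Lemma measurable_count_set t B C : (0 <= t)%R -> measurable B -> B `<=` upto t ->
  measurable C -> measurable [set w | C (N w B)].
Proof.
by move=> t0 mB Bt mC; apply: (filt_measurable hF t0); exact: (prm_adapted hN).
Qed.

Lemma admissible0 t : admissible m (upto t) set0.
Proof. by split => //; rewrite measure0. Qed.

Lemma prm_independent2 (B1 B2 : set (marks_times H R)) (C1 C2 : set (\bar R)) t :
  admissible m (upto t) B1 -> admissible m (upto t) B2 ->
  measurable C1 -> measurable C2 -> B1 `&` B2 = set0 ->
  P ([set w | C1 (N w B1)] `&` [set w | C2 (N w B2)]) =
  P [set w | C1 (N w B1)] * P [set w | C2 (N w B2)].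
Proof.
move=> a1 a2 mC1 mC2 d12.
have := prm_independent3 a1 a2 (admissible0 t) mC1 mC2 measurableT d12 (setI0 _) (setI0 _).
by rewrite [X in _ * P X](_ : _ = setT) ?probability_setT ?setIT ?mule1//; exact/seteqP.
Qed.

Lemma prm_poisson_on t : (0 <= t)%R -> poisson_on P m N (upto t).
Proof.
move=> t0; split.
- by move=> B C [mB Bt _] mC; exact: (measurable_count_set t0).
- by move=> B [mB Bt Boo] n; apply: (prm_poisson hN) => //; exact: subset_trans (@upto_nonneg t).
- by move=> B B' C C' aB aB' BB' mC mC'; exact: (prm_independent2 aB aB').
Qed.

Variables (t : R) (D : set (marks_times H R)).
Hypotheses (t0 : (0 <= t)%R) (aD : admissible m (upto t) D).

Definition void_event : set Omega := [set w | N w D = 0].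

Lemma measurable_void_event : measurable void_event.
Proof.
by have [mD Dt _] := aD; apply: (measurable_count_set (C := [set 0]) t0 mD Dt); exact: emeasurable_set1.
Qed.

Lemma void_gt0 : 0 < P void_event.
Proof.
have [mD Dt Doo] := aD.
rewrite (prm_poisson hN mD (subset_trans Dt (@upto_nonneg t)) Doo 0).
rewrite /poisson_prob; case: ifPn => r0; last by rewrite diracE mem_set// lte_fin.
rewrite esum_set1 ?lee_fin ?poisson_pmf_ge0// lte_fin /poisson_pmf r0.
by rewrite expr0 fact0 invr1 !mul1r expR_gt0.
Qed.

Definition void_law : probability Omega R := conditional P measurable_void_event.
Local Notation Q := void_law.

Lemma void_law_le A : measurable A -> Q A <= (fine (P void_event))^-1%:E * P A.
Proof. exact: (conditional_le measurable_void_event void_gt0). Qed.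

(** The count of a set disjoint from [D] is independent of the void event, so conditioning changes
    neither its law nor the independence of two such counts. *)
Lemma void_poisson_on : poisson_on Q m N (upto t `\` D).
Proof.
have [mD Dt Doo] := aD.
have m0 : measurable [set 0 : \bar R] by exact: emeasurable_set1.
have sub B : admissible m (upto t `\` D) B -> admissible m (upto t) B.
  by move=> [mB Bt Boo]; split => //; apply: (subset_trans Bt) => x [].
have dis B : admissible m (upto t `\` D) B -> B `&` D = set0.
  by move=> [_ Bt _]; apply/seteqP; split => // x [/Bt[_]].
have mc B C : admissible m (upto t `\` D) B -> measurable C -> measurable [set w | C (N w B)].
  by move=> /sub [mB Bt _] mC; exact: (measurable_count_set t0).
have QP B C : admissible m (upto t `\` D) B -> measurable C ->
    Q [set w | C (N w B)] = P [set w | C (N w B)].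
  move=> aB mC; rewrite (conditionalE measurable_void_event void_gt0); last exact: mc.
  rewrite (prm_independent2 (sub _ aB) aD mC m0 (dis _ aB)).
  have fB : P void_event \is a fin_num by exact: fin_num_measure measurable_void_event.
  rewrite -muleA -[X in _ * (X * _)](fineK fB) -EFinM mulfV ?mule1//.
  by rewrite gt_eqF// fine_gt0// void_gt0 ltey_eq fB.
split => //.
- move=> B aB n; have [mB Bt _] := sub _ aB.
  rewrite (QP B [set (n%:R)%:E])//.
  by apply: (po_law (prm_poisson_on t0)); exact: sub.
- move=> B B' C C' aB aB' BB' mC mC'.
  apply: (conditional_indep measurable_void_event void_gt0); try exact: mc.
  rewrite (prm_independent3 (sub _ aB) (sub _ aB') aD mC mC' m0 BB' (dis _ aB) (dis _ aB')).
  rewrite (prm_independent2 (sub _ aB) aD mC m0 (dis _ aB)).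
  rewrite (prm_independent2 (sub _ aB') aD mC' m0 (dis _ aB')).
  by rewrite /void_event !muleA; congr (_ * _); rewrite -!muleA; congr (_ * _); exact: muleC.
Qed.

(** The void event is the intersection of [V1], known at time [s], and [V2], which concerns later
    times; every probability in the product formula then factors into past and future. *)
Lemma void_future_indep s A B C : (0 <= s)%R -> (s <= t)%R -> F s A ->
  measurable B -> B `<=` upto t `&` after s -> measurable C ->
  Q (A `&` [set w | C (N w B)]) = Q A * Q [set w | C (N w B)].
Proof.
move=> s0 st FA mB Bs mC; have [mD Dt Doo] := aD.
have m0 : measurable [set 0 : \bar R] by exact: emeasurable_set1.
have mA := filt_measurable hF s0 FA.
have mE : measurable [set w | C (N w B)].
  by apply: (measurable_count_set t0) => // x /Bs[].
pose D1 := D `&` upto s; pose D2 := D `&` after s.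
have mD1 : measurable D1 by apply: measurableI => //; exact: measurable_upto.
have mD2 : measurable D2 by apply: measurableI => //; exact: measurable_after.
pose V1 := [set w | N w D1 = 0]; pose V2 := [set w | N w D2 = 0].
have voidE : void_event = V1 `&` V2.
  have DE : D = D1 `|` D2.
    rewrite -setIUr; apply/esym/setIidPl => p /Dt; rewrite /Defs.upto /Defs.after/= => /andP[-> _] /=.
    by case: (lerP p.2 s); [left|right].
  have D12 : D1 `&` D2 = set0.
    by apply/seteqP; split => // p [[_ /andP[_ h]] [_]]; rewrite /Defs.after/= ltNge h.
  apply/seteqP; split => w; rewrite /void_event /V1 /V2/= {1}DE (measureU _ mD1 mD2 D12).
    by move=> /eqP; rewrite padde_eq0// => /andP[/eqP -> /eqP ->].
  by move=> [h1 h2]; exact: (etrans (congr2 adde h1 h2) (adde0 0)).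
have FV1 : F s V1 by apply: (prm_adapted hN s0 (C := [set 0])) => // x [].
have fut B' C' : measurable B' -> B' `<=` after s -> measurable C' -> future N s [set w | C' (N w B')].
  by move=> mB' Bs' mC'; apply: sub_sigma_algebra; exists B', C'.
have fV2 : future N s V2 by apply: (fut _ [set 0]) => // x [].
have fE : future N s [set w | C (N w B)] by apply: fut => // x /Bs[].
have fEV : future N s ([set w | C (N w B)] `&` V2).
  exact: (@measurableI _ (g_sigma_algebraType _) _ _ fE fV2).
have FAV : F s (A `&` V1).
  have sF := filt_sigma_algebra hF s0.
  rewrite -(sigma_algebra_id sF).
  by apply: (@measurableI _ (g_sigma_algebraType (F s))); apply: sub_sigma_algebra.
have FT : F s setT.
  by have := filt_sigma_algebra hF s0 => -[F0 FC _]; rewrite -(setD0 setT); exact: FC.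
apply: (conditional_indep measurable_void_event void_gt0) => //; rewrite voidE.
have i := prm_future_independent hN s0.
rewrite (_ : A `&` [set w | C (N w B)] `&` (V1 `&` V2) = (A `&` V1) `&` ([set w | C (N w B)] `&` V2)); last first.
  by rewrite setIACA.
rewrite (setIA A) (setICA _ V1).
rewrite (i _ _ FAV fEV) (i _ _ FAV fV2) (i _ _ FV1 fEV) (i _ _ FV1 fV2).
by rewrite muleACA [RHS]muleACA; congr (_ * _); exact: muleC.
Qed.

End void_conditioning.

(** * Integrals over strips and symmetry of the intensity *)

Section strip_integrals.
Context (R : realType) (H : completeNormedModType R)
  (nu : {sigma_finite_measure set (borel H) -> \bar R}).
Local Open Scope ereal_scope.
Local Notation m := (intensity nu).

Lemma integral_strip (g : borel H -> \bar R) I s t : measurable I -> (s <= t)%R ->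
  measurable_fun setT g -> (forall z, 0 <= g z) ->
  \int[m]_(p in strip I s t) g p.1 = (t - s)%:E * \int[nu]_(z in annulus I) g z.
Proof.
move=> mI st mg g0; rewrite integral_mkcond.
pose f (p : marks_times H R) : \bar R := (g \_ (annulus I)) p.1 * (\1_(`]s, t]%classic) p.2 : R)%:E.
have ga0 z : 0 <= (g \_ (annulus I)) z by rewrite patchE; case: ifP.
have mga : measurable_fun setT (g \_ (annulus I)).
  by apply/(measurable_restrictT g (measurable_annulus mI)); exact: measurable_funTS.
have -> : (fun p : marks_times H R => g p.1) \_ (strip I s t) = f.
  apply/funext => p; rewrite /f !patchE stripE indicE.
  have -> : (p \in annulus I `*` `]s, t]) = (p.1 \in annulus I) && (p.2 \in `]s, t]%classic).
    by apply/idP/andP; rewrite !inE.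
  by case: (p.1 \in annulus I) => /=; [case: (p.2 \in _); rewrite ?mule1 ?mule0|rewrite mul0e].
have mf : measurable_fun setT f.
  apply: emeasurable_funM; first by apply: (measurableT_comp mga); exact: measurable_fst.
  by apply/measurable_EFinP; apply: (measurableT_comp _ measurable_snd); exact: measurable_indic.
have f0 p : 0 <= f p by rewrite mule_ge0.
transitivity (\int[nu]_z \int[@lebesgue_measure R]_r f (z, r)).
  exact: (@fubini_tonelli1 _ _ _ _ _ nu (@lebesgue_measure R) f mf f0).
rewrite [in RHS]integral_mkcond -ge0_integralZl//; last by rewrite lee_fin subr_ge0.
apply: eq_integral => z _; rewrite /f/= ge0_integralZl//; last first.
  by apply/measurable_EFinP; exact: measurable_indic.
rewrite muleC; congr (_ * _); rewrite integral_indic// setIT.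
rewrite [LHS](_ : _ = (@lebesgue_measure R) `]s, t])// lebesgue_measure_itv/= lte_fin.
by case: ltgtP st => // ->; rewrite subrr.
Qed.

Hypothesis nu_symmetric : forall B : set (borel H), measurable B ->
  nu B = nu [set - (z : H) | z in B]%R.

Lemma ge0_integral_opp (g : borel H -> \bar R) : measurable_fun setT g -> (forall z, 0 <= g z) ->
  \int[nu]_z g (- (z : H))%R = \int[nu]_z g z.
Proof.
move=> mg g0.
have mo : measurable_fun setT (fun z : borel H => (- (z : H))%R : borel H).
  apply: measurability; first by [].
  move=> _ [U oU <-]; rewrite setTI; apply: sub_sigma_algebra.
  by apply: (open_comp (f := fun z : H => - z)%R) => // z _; exact: opp_continuous.
transitivity (\int[pushforward nu (fun z : borel H => (- (z : H))%R : borel H)]_z g z).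
  by rewrite ge0_integral_pushforward.
apply: eq_measure_integral => B mB _; rewrite /pushforward [RHS]nu_symmetric//.
congr (nu _); apply/seteqP; split => [z Bz|_ [z Bz <-]].
  by exists (- (z : H))%R; rewrite ?opprK.
by rewrite /= opprK.
Qed.

(** Symmetry exchanges the integrals of the positive and negative parts of an odd function;
    integrability makes them finite, so they cancel. *)
Lemma integral_strip_odd (g : H -> R) I s t : measurable I -> (s <= t)%R ->
  measurable_fun setT (g : borel H -> R) -> (forall z, g (- z) = - g z)%R ->
  m.-integrable (strip I s t) (fun p => (g p.1)%:E) ->
  \int[m]_(p in strip I s t) (g p.1)%:E = 0.
Proof.
move=> mI st mg godd ig.
have mE : measurable_fun setT (EFin \o (g : borel H -> R)) by exact/measurable_EFinP.
rewrite integralE.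
have fp := integrable_pos_fin_num (measurable_strip s t mI) ig.
set gp := \int[m]_(p in _) _ in fp *; set gn := \int[m]_(p in _) _.
have gpE : gp = \int[m]_(p in strip I s t) ((EFin \o g)^\+ p.1).
  by apply: eq_integral => p _; rewrite !funeposE.
have gnE : gn = \int[m]_(p in strip I s t) ((EFin \o g)^\- p.1).
  by apply: eq_integral => p _; rewrite !funenegE.
suff gg : gn = gp by rewrite gg subee.
rewrite gpE gnE.
rewrite !integral_strip//; last 2 first.
  - exact: measurable_funepos.
  - exact: measurable_funeneg.
  congr (_ * _); rewrite integral_mkcond [RHS]integral_mkcond.
  rewrite -[RHS]ge0_integral_opp//; last 2 first.
  - apply/(measurable_restrictT _ (measurable_annulus mI)); apply: measurable_funTS.
    exact: measurable_funepos.
  - by move=> z; rewrite patchE; case: ifP.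
  apply: eq_integral => z _; rewrite !patchE.
  have -> : ((- (z : H))%R \in annulus I) = (z \in annulus I).
    by apply/idP/idP; rewrite !inE /annulus/= normrN.
  by rewrite funenegE funeposE /= godd EFinN.
Qed.

End strip_integrals.

(** * Differences and splittings of step functions *)

Section step_calculus.
Context (R : realType) (T : Type) (E : normedModType R).

(** Concatenation of the two families: as step sets may overlap, no common refinement is
    required. *)
Definition step_sub (s s' : step_fun T E) : step_fun T E :=
  @StepFun T E (step_size s + step_size s')
    (fun i => match fintype.split i with inl j => @step_set _ _ s j | inr j => @step_set _ _ s' j end)
    (fun i => match fintype.split i with inl j => @step_val _ _ s j | inr j => - @step_val _ _ s' j end).

Lemma step_eval_sub s s' x : step_eval (step_sub s s') x = step_eval s x - step_eval s' x.
Proof.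
rewrite /step_eval /= big_split_ord/=; congr (_ + _).
  by apply: eq_bigr => i _; rewrite (unsplitK (inl _ i)).
rewrite -sumrN; apply: eq_bigr => i _.
by rewrite (unsplitK (inr _ i)) scalerN.
Qed.

Lemma step_integral_sub mu s s' :
  step_integral mu (step_sub s s') = step_integral mu s - step_integral mu s'.
Proof.
rewrite /step_integral /= big_split_ord/=; congr (_ + _).
  by apply: eq_bigr => i _; rewrite (unsplitK (inl _ i)).
rewrite -sumrN; apply: eq_bigr => i _.
by rewrite (unsplitK (inr _ i)) scalerN.
Qed.

Lemma step_eval0 (s : step_fun T E) x :
  (forall i : 'I_(step_size s), ~ step_set i x) -> step_eval s x = 0.
Proof.
by move=> h; rewrite /step_eval big1// => i _; rewrite indicE memNset ?scale0r.
Qed.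

End step_calculus.

Section compensated_step.
Context (R : realType) (H : normedModType R).
Context (d : measure_display) (Omega : measurableType d) (Q : probability Omega R).
Context (d' : measure_display) (S : measurableType d') (m : {measure set S -> \bar R}).
Variable N : Omega -> {measure set S -> \bar R}.
Local Open Scope ereal_scope.
Variable Gam : set S.
Hypothesis po : poisson_on Q m N Gam.
Local Notation adm := (admissible m Gam).

Definition compensated_step (s : step_fun S H) (w : Omega) : H :=
  (step_integral (N w) s - step_integral m s)%R.

Lemma compensated_stepE s w :
  compensated_step s w = (\sum_(i < step_size s) compensated m N (@step_set _ _ s i) w *: @step_val _ _ s i)%R.
Proof.
by rewrite /compensated_step /step_integral -sumrB; apply: eq_bigr => i _; rewrite -scalerBl.
Qed.

Lemma compensated_step_sub s s' w :
  compensated_step (step_sub s s') w = (compensated_step s w - compensated_step s' w)%R.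
Proof. by rewrite /compensated_step !step_integral_sub !opprD !opprK addrACA. Qed.

(** Counts read as real numbers add up only where they are finite, whence the exceptional null
    set. *)
Lemma compensated_step_split s D : measurable D ->
  (forall i : 'I_(step_size s), adm (step_set i)) ->
  {ae Q, forall w, compensated_step s w =
    (compensated_step (step_restrict s D) w + compensated_step (step_restrict s (~` D)) w)%R}.
Proof.
move=> mD as_.
have : {ae Q, forall w, forall i : 'I_(step_size s), compensated m N (step_set i) w =
    (compensated m N (step_set i `&` D) w + compensated m N (step_set i `&` ~` D) w)%R}.
  apply: filter_forall => i; have [mi _ _] := as_ i.
  have aI E : measurable E -> adm (step_set i `&` E).
    by move=> mE; apply: admS (as_ i) _ _; [exact: measurableI|move=> x []].
  rewrite -[in X in {ae _, forall w, X w = _}](setIT (step_set i)) -(setUv D) setIUr.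
  apply: (compensatedU po (aI _ mD)); first exact/aI/measurableC.
  by rewrite setIACA setICr setI0.
apply: filterS => w h; rewrite !compensated_stepE -big_split/=.
by apply: eq_bigr => i _; rewrite h scalerDl.
Qed.

End compensated_step.

Section lemmas.
Context (R : realType).
Local Open Scope ereal_scope.

Lemma cvge0_lt (u : nat -> \bar R) (e : R) : u n @[n --> \oo] --> 0 -> (0 < e)%R ->
  \forall n \near \oo, u n < e%:E.
Proof.
move=> u0 e0; apply: (u0 [set x | x < e%:E]).
by apply: open_nbhs_nbhs; split; [exact: open_ereal_lt_ereal|rewrite /= lte_fin].
Qed.

Lemma step_in_adm d (T : measurableType d) (E : normedModType R) (mu : {measure set T -> \bar R})
    D Gam (s : step_fun T E) :
  step_in mu D s -> D `<=` Gam -> forall i : 'I_(step_size s), admissible mu Gam (step_set i).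
Proof. by move=> h DG i; have [mi iD ioo] := h i; split => //; exact: subset_trans iD DG. Qed.

Lemma step_in_restrict d (T : measurableType d) (E : normedModType R) (mu : {measure set T -> \bar R})
    D D' D'' (s : step_fun T E) :
  step_in mu D s -> measurable D' -> D `&` D' `<=` D'' -> step_in mu D'' (step_restrict s D').
Proof.
move=> h mD' DG i; have [mi iD ioo] := h i; split => //=; first exact: measurableI.
  by move=> x [/iD ? ?]; apply: DG.
by apply: le_lt_trans ioo; apply: le_measure; rewrite ?inE//; exact: measurableI.
Qed.

Lemma step_eval_norm_measurable d (T : measurableType d) (E : normedModType R)
    (s : step_fun T E) : (forall i : 'I_(step_size s), measurable (step_set i)) ->
  norm_measurable setT (step_eval s).
Proof. by move=> ms y; exact: (measurable_fun_step (fun z => `|z - y|%R)). Qed.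

End lemmas.

(** * Marks bounded away from zero *)

Section big_marks.
Context (R : realType) (H : completeNormedModType R) (ip : H -> H -> R)
  (ipP : is_inner_product ip) (sepH : separable_space H).
Context (nu : {sigma_finite_measure set (borel H) -> \bar R}).
Hypothesis hnu1 : (\int[nu]_z (Num.min (`|z : H| ^+ 2) 1)%R%:E < +oo)%E.
Hypothesis nu_symmetric : forall B : set (borel H), measurable B ->
  nu B = nu [set - (z : H) | z in B]%R.
Local Open Scope ereal_scope.
Local Notation m := (intensity nu).

Lemma measurable_norm_borel : measurable_fun setT (fun z : borel H => `|z : H|%R).
Proof. exact: norm_measurable_norm (@norm_measurable_borel R H). Qed.

(** Chebyshev's inequality for the minimum of [|z|^2] and 1, which is at least [c] on this
    region. *)
Lemma annulus_lt_pinfty (e : R) : (0 < e)%R -> nu (annulus `]e, +oo[) < +oo.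
Proof.
move=> e0; pose c : R := (Num.min (e ^+ 2) 1)%R.
have c0 : (0 < c)%R by rewrite lt_min ltr01 exprn_gt0.
have mA : measurable (annulus (H := H) `]e, +oo[) by exact: measurable_annulus.
have mf : measurable_fun setT (fun z : borel H => (Num.min (`|z : H| ^+ 2) 1)%R%:E).
  apply/measurable_EFinP; apply: measurable_minr => //; apply: measurable_funX.
  exact: measurable_norm_borel.
have : c%:E * nu (annulus `]e, +oo[) < +oo.
  apply: le_lt_trans hnu1; rewrite -integral_cst//.
  apply: (@le_trans _ _ (\int[nu]_(z in annulus `]e, +oo[) (Num.min (`|z : H| ^+ 2) 1)%R%:E)).
    apply: ge0_integral_mono => z; rewrite ?lee_fin ?(ltW c0)//= /annulus/= in_itv/= andbT => ez.
    by rewrite /c le_min !ge_min lexx orbT !andbT lerXn2r ?nnegrE ?(ltW ez)// ltW.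
  by apply: ge0_subset_integral => // z _; rewrite lee_fin le_min sqr_ge0/=.
by case: (nu (annulus `]e, +oo[)) => [r _||_]; rewrite ?ltry ?ltNyr// gt0_muley ?lte_fin.
Qed.

Lemma strip_lt_pinfty (I : set R) (e s t : R) : measurable I -> (0 < e)%R -> (s <= t)%R ->
  I `<=` `]e, +oo[ -> m (strip (H := H) I s t) < +oo.
Proof.
move=> mI e0 st Ie; rewrite intensity_strip//.
have le : nu (annulus I) <= nu (annulus `]e, +oo[).
  apply: le_measure; rewrite ?inE; try exact: measurable_annulus.
  by move=> z; exact: Ie.
rewrite lte_mul_pinfty ?lee_fin ?subr_ge0// ?ltry//.
by rewrite ge0_fin_numE// (le_lt_trans le)//; exact: annulus_lt_pinfty.
Qed.

Lemma integral_strip_ip (c : H) (e s t : R) : (0 < e)%R -> (s <= t)%R ->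
  m.-integrable (strip `]e, 1%R] s t) (fun p => (ip (p.1 : H) c)%:E) /\
  \int[m]_(p in strip `]e, 1%R] s t) (ip (p.1 : H) c)%:E = 0.
Proof.
move=> e0 st.
have mS : measurable (strip (H := H) `]e, 1%R] s t) by exact: measurable_strip.
have Soo : m (strip (H := H) `]e, 1%R] s t) < +oo.
  by apply: (strip_lt_pinfty _ e0) => // x /=; rewrite !in_itv/= => /andP[->].
have mg : measurable_fun setT (fun z : borel H => ip z c).
  have mc : norm_measurable setT (fun _ : borel H => c) by exact: norm_measurable_cst.
  exact: (norm_measurable_ip ipP sepH (@norm_measurable_borel R H) mc).
have ig : m.-integrable (strip `]e, 1%R] s t) (fun p => (ip (p.1 : H) c)%:E).
  have ic : m.-integrable (strip (H := H) `]e, 1%R] s t) (fun=> `|c|%R%:E).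
    apply/integrableP; split; first exact: measurable_cst.
    by rewrite integral_cst//= normr_id lte_mul_pinfty ?lee_fin// ltry.
  apply: (le_integrable mS _ _ ic).
    apply: measurable_funTS; apply/measurable_EFinP.
    exact: (measurableT_comp mg measurable_fst).
  move=> p [/= ]; rewrite in_itv/= => /andP[_ p1] _.
  rewrite lee_fin normr_id (le_trans (ip_le ipP _ _))// ler_piMl//.
split => //; apply: (integral_strip_odd nu_symmetric (g := ip ^~ c)) => //.
by move=> z; exact: (ipNl ipP).
Qed.

(** By symmetry the mark integrates to 0 over the strip, so the integral of [b] is that of [b] minus
    the mark; as the strip has finite intensity, the L^2 error controls it. *)
Lemma step_integral_strip_le (b : step_fun (marks_times H R) H) (e s t : R) : (0 < e)%R -> (s <= t)%R ->
  step_in m (strip `]e, 1%R] s t) b ->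
  (`|step_integral m b| ^+ 2)%:E <=
  (fine (m (strip (H := H) `]e, 1%R] s t)) + 1)%:E *
    \int[m]_(p in strip `]e, 1%R] s t) (`|(p.1 : H) - step_eval b p| ^+ 2)%:E.
Proof.
move=> e0 st sb; set S := strip _ _ _; set c := step_integral m b.
have mS : measurable S by exact: measurable_strip.
have Soo : m S < +oo.
  by apply: (strip_lt_pinfty _ e0) => // x /=; rewrite !in_itv/= => /andP[->].
(* Adding 1 keeps [k] positive on a null strip. *)
set k := (fine (m S) + 1)%R.
have k0 : (0 < k)%R by rewrite ltr_wpDl// fine_ge0.
have [ig1 i1] := integral_strip_ip c e0 st.
have [ig2 i2] := @step_integral_functional _ _ _ _ m S mS b (ip ^~ c) (fun a x y => ip_linear ipP a x y c) sb.
have ig := integrableB mS ig2 ig1.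
have E1 : (`|c| ^+ 2)%:E = \int[m]_(p in S) ((ip (step_eval b p) c)%:E - (ip (p.1 : H) c)%:E).
  by rewrite integralB// i1 i2 sube0 (ip_norm ipP).
pose r p : R := (`|(p.1 : H) - step_eval b p| ^+ 2)%R.
have mr : measurable_fun S (fun p => (r p)%:E).
  apply: measurable_funTS; apply/measurable_EFinP; apply: measurable_funX; apply: norm_measurable_norm.
  apply: norm_measurable_sub => //; first exact: norm_measurable_mark.
  by apply: step_eval_norm_measurable => i; have [] := sb i.
have E2 : (`|c| ^+ 2)%:E <= (2^-1 * k)%:E * \int[m]_(p in S) (r p)%:E + (2^-1 * `|c| ^+ 2)%:E.
  rewrite [leLHS]E1; apply: (le_trans (lee_abs _)).
  apply: (le_trans (le_abse_integral m mS (measurable_int _ ig))).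
  apply: (@le_trans _ _ (\int[m]_(p in S) ((2^-1 * k)%:E * (r p)%:E + (2^-1 * `|c| ^+ 2 / k)%:E))).
    apply: ge0_integral_mono => // p Sp.
    rewrite -EFinB -(ipBl ipP) /= -EFinM -EFinD lee_fin (le_trans (ip_le ipP _ _))//.
    rewrite distrC /r; set x := `| _ |%R; set y := `|c|%R.
    (* Young's inequality with weight [k]. Since [m S <= k], the second term integrates to at most
       [|c|^2 / 2], which the left side absorbs. *)
    have -> : (2^-1 * k * x ^+ 2 + 2^-1 * y ^+ 2 / k = 2^-1 * k * (x - y / k) ^+ 2 + x * y)%R.
      by field; rewrite gt_eqF.
    by rewrite lerDr mulr_ge0 ?sqr_ge0// mulr_ge0// ltW.
  rewrite ge0_integralD//=; last 3 first.
  - by move=> p _; rewrite -EFinM lee_fin !mulr_ge0 ?sqr_ge0 ?(ltW k0).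
  - exact: measurable_funeM.
  - by move=> p _; rewrite lee_fin mulr_ge0 ?mulr_ge0 ?invr_ge0 ?sqr_ge0 ?(ltW k0).
  rewrite ge0_integralZl//; last 2 first.
  - by move=> p _; rewrite lee_fin sqr_ge0.
  - by rewrite lee_fin mulr_ge0// ltW.
  rewrite leeD2l// integral_cst// -(fineK (_ : m S \is a fin_num)) ?ge0_fin_numE//.
  have kf : (k^-1 * fine (m S) <= 1)%R by rewrite mulrC ler_pdivrMr// mul1r /k lerDl.
  rewrite -EFinM lee_fin -(mulrA _ k^-1%R).
  by apply: ler_piMr kf; rewrite mulr_ge0// sqr_ge0.
have I0 : 0 <= \int[m]_(p in S) (r p)%:E by apply: integral_ge0 => p _; rewrite lee_fin sqr_ge0.
move: I0 E2; case: (\int[m]_(p in S) (r p)%:E) => [x|_ _|//].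
  rewrite -!EFinM -EFinD !lee_fin => x0; lra.
by rewrite gt0_muley ?lte_fin// leey.
Qed.

End big_marks.

(** * Increments of the compensated integral *)

(** Bookkeeping for [increment_approx]: [q1] and [q2] are the step integrals up to the earlier time,
    [q3] belongs to the small marks after it and [q4] to the other ones. *)
Lemma increment_identity (V : zmodType) (y1 y2 q1 q2 q3 q4 : V) :
  y1 - y2 - q3 = (y1 - (q1 + (q3 + q4))) - (y2 - q2) + ((q1 - q2) + q4).
Proof.
rewrite !opprD !opprK !addrA [RHS]((@GRing.add V).[ACl 1*5*3*(2*7)*(4*9)*(6*8)]).
by rewrite !addNr !subrr !addr0.
Qed.

Lemma sqr_add_le (R : realDomainType) (x y : R) : (x + y) ^+ 2 <= 2 * (x ^+ 2 + y ^+ 2).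
Proof. have := sqr_ge0 (x - y); nra. Qed.

Section increments.
Context (R : realType) (H : completeNormedModType R) (d : measure_display)
  (Omega : measurableType d) (P : probability Omega R)
  (F : R -> set (set Omega)) (hF : usual_conditions P F)
  (nu : {sigma_finite_measure set (borel H) -> \bar R})
  (N : Omega -> {measure set (marks_times H R) -> \bar R})
  (hN : poisson_random_measure P F nu N).
Context (ip : H -> H -> R) (ipP : is_inner_product ip) (sepH : separable_space H).
Hypothesis hnu1 : (\int[nu]_z (Num.min (`|z : H| ^+ 2) 1)%:E < +oo)%E.
Hypothesis nu_symmetric : forall B : set (borel H), measurable B ->
  nu B = nu [set - (z : H) | z in B]%R.
Local Open Scope ereal_scope.
Local Notation m := (intensity nu).

Variable M : R -> Omega -> H.
Hypothesis mM : forall t, (0 <= t)%R -> norm_measurable setT (M t).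
Hypothesis cM : forall t, (0 <= t)%R ->
  is_compensated_integral P nu N (@small_jumps R H t) (fun p => p.1) (M t).

Variables a eps : R.
Hypotheses (a0 : (0 <= a)%R) (eps0 : (0 < eps)%R) (eps1 : (eps <= 1)%R).

Definition big_strip : set (marks_times H R) := strip `]eps, +oo[ 0 a.

Lemma big_strip_adm : admissible m (@upto R H a) big_strip.
Proof.
split; first exact: measurable_strip.
  exact: strip_upto.
exact: (strip_lt_pinfty hnu1 _ eps0).
Qed.

Definition void_big : probability Omega R := void_law hF hN a0 big_strip_adm.
Local Notation Q := void_big.

Lemma small_jumpsE t : @small_jumps R H t = strip `]0%R, 1%R] 0 t.
Proof. by apply/seteqP; split => p; rewrite /small_jumps /strip/= in_itv. Qed.

Lemma measurable_small_jumps t : measurable (@small_jumps R H t).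
Proof. by rewrite small_jumpsE; exact: measurable_strip. Qed.

Lemma norm_measurable_compensated t (s : step_fun (marks_times H R) H) : (0 <= t)%R ->
  (forall i : 'I_(step_size s), admissible m (@upto R H t) (step_set i)) ->
  norm_measurable setT (compensated_step m N s).
Proof.
move=> t0 as_.
exact: (norm_measurable_compensated_step (prm_poisson_on hF hN t0) sepH as_).
Qed.

Lemma measurable_sqr_norm (f : Omega -> H) : norm_measurable setT f ->
  measurable_fun setT (fun w => (`|f w|%R ^+ 2)%:E).
Proof.
by move=> mf; apply/measurable_EFinP; apply: measurable_funX; exact: norm_measurable_norm.
Qed.

Lemma sqr_norm_sum4 (x y z u : H) :
  (`|x - y + (z + u)| ^+ 2 <= 4 * (`|x| ^+ 2 + `|y| ^+ 2 + `|z| ^+ 2) + 4 * `|u| ^+ 2)%R.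
Proof.
have h : (`|x - y + (z + u)| <= `|x| + `|y| + (`|z| + `|u|))%R.
  by rewrite (le_trans (ler_normD _ _))// lerD ?ler_normB ?ler_normD.
apply: (@le_trans _ _ ((`|x| + `|y| + (`|z| + `|u|)) ^+ 2)%R); first by rewrite lerXn2r ?nnegrE ?addr_ge0.
set A := `|x|%R; set B := `|y|%R; set C := `|z|%R; set D := `|u|%R.
have := sqr_ge0 (A - B); have := sqr_ge0 (A - C); have := sqr_ge0 (A - D).
have := sqr_ge0 (B - C); have := sqr_ge0 (B - D); have := sqr_ge0 (C - D); nra.
Qed.

(* The jumps of norm at most [eps] are kept; on the event that larger ones do
   not occur, what remains of the compensator vanishes by symmetry of [nu]. *)
Lemma increment_approx (s t e : R) : (0 <= s)%R -> (s <= t)%R -> (t <= a)%R -> (0 < e)%R ->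
  exists u : step_fun (marks_times H R) H,
  [/\ step_in m (strip `]0%R, eps] s t) u,
      \int[m]_(p in strip `]0%R, eps] s t) (`|(p.1 : H) - step_eval u p|%R ^+ 2)%:E <= e%:E &
      \int[Q]_w (`|M t w - M s w - compensated_step m N u w|%R ^+ 2)%:E <= e%:E].
Proof.
move=> s0 st ta e0; have t0 := le_trans s0 st.
set S3 := strip (H := H) `]eps, 1%R] s t.
pose k := (fine (m S3) + 1)%R; pose q := (fine (P (void_event N big_strip)))^-1%R.
have k0 : (0 < k)%R by rewrite ltr_wpDl// fine_ge0.
have q0 : (0 <= q)%R by rewrite invr_ge0 fine_ge0.
(* The errors add up to [4 * q * (1 + 1 + 4) * e' + 4 * k * e'], that is [4 * (6 * q + k) * e'];
   here [q] bounds the density of [Q] with respect to [P]. *)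
pose e' := Num.min e (e / (4 * (6 * q + k)))%R.
have e'0 : (0 < e')%R.
  by rewrite lt_min e0 divr_gt0// mulr_gt0// ltr_wpDl// mulr_ge0.
have [s1 [s2 [[in1 in2] [c1 c2] [d1 d2]]]] : exists s1 s2 : step_fun (marks_times H R) H,
    [/\ step_in m (@small_jumps R H t) s1 /\ step_in m (@small_jumps R H s) s2,
       \int[m]_(p in @small_jumps R H t) (`|(p.1 : H) - step_eval s1 p|%R ^+ 2)%:E <= e'%:E /\
       \int[m]_(p in @small_jumps R H s) (`|(p.1 : H) - step_eval s2 p|%R ^+ 2)%:E <= e'%:E &
       \int[P]_w (`|M t w - compensated_step m N s1 w|%R ^+ 2)%:E <= e'%:E /\
       \int[P]_w (`|M s w - compensated_step m N s2 w|%R ^+ 2)%:E <= e'%:E].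
  have [s1 [in1 c1 d1]] := cM t0; have [s2 [in2 c2 d2]] := cM s0.
  near \oo => n; exists (s1 n), (s2 n); split; split => //; apply: ltW; near: n.
  - exact: (cvge0_lt c1 e'0).
  - exact: (cvge0_lt c2 e'0).
  - exact: (cvge0_lt d1 e'0).
  - exact: (cvge0_lt d2 e'0).
have mS1 := measurable_small_jumps s.
pose S1 := @small_jumps R H s; pose S2 := strip (H := H) `]0%R, eps] 0 a.
have mS2 : measurable S2 by exact: measurable_strip.
have S1t : S1 `<=` @small_jumps R H t.
  by move=> p [h1 /andP[h2 h3]]; split => //; rewrite h2 (le_trans h3).
(* The part [v] of [s1] after time [s] is split into small marks [u] and middle marks [b]. The
   discrepancy [r] of the two approximations up to time [s] is small, because both approximate the
   same integrand. *)
pose v := step_restrict s1 (~` S1).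
pose u := step_restrict v S2; pose b := step_restrict v (~` S2).
pose r := step_sub (step_restrict s1 S1) s2.
have inv : step_in m (@small_jumps R H t `\` S1) v.
  by apply: (step_in_restrict in1); [exact: measurableC|].
have inu : step_in m (strip `]0%R, eps] s t) u.
  apply: (step_in_restrict inv) => // p [[[/andP[h1 h2] /andP[h3 h4]] h5] [/= h6 _]].
  split => //=; rewrite h4 andbT ltNge; apply/negP => ps; apply: h5.
  by split; rewrite ?h1 ?h2 ?h3.
have inb : step_in m S3 b.
  apply: (step_in_restrict inv); first exact: measurableC.
  move=> p [[[/andP[h1 h2] /andP[h3 h4]] h5] h6].
  split => /=.
    rewrite in_itv/= h2 andbT ltNge; apply/negP => pe; apply: h6; split; rewrite /= ?in_itv/= ?h1//.
    by rewrite h3 (le_trans h4).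
  by rewrite h4 andbT ltNge; apply/negP => ps; apply: h5; split; rewrite ?h1 ?h2 ?h3.
have uptoS s' : (s' <= a)%R -> @small_jumps R H s' `<=` @upto R H a.
  by rewrite small_jumpsE => h; exact: strip_upto.
have po := prm_poisson_on hF hN a0.
have a1 := step_in_adm in1 (uptoS _ ta); have a2 := step_in_adm in2 (uptoS _ (le_trans st ta)).
have ares (s' : step_fun (marks_times H R) H) D : (forall i : 'I_(step_size s'), admissible m (@upto R H a) (step_set i)) -> measurable D ->
    forall i : 'I_(step_size (step_restrict s' D)), admissible m (@upto R H a) (step_set i).
  by move=> h mD i; apply: admS (h i) _ _ => /=; [apply: measurableI => //; have [] := h i|move=> x []].
have mC D : measurable D -> measurable (~` D : set (marks_times H R)) by exact: measurableC.
have av := ares s1 _ a1 (mC _ mS1); have au := ares v _ av mS2; have ab := ares v _ av (mC _ mS2).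
have a1' := ares s1 _ a1 mS1.
have ar : forall i : 'I_(step_size r), admissible m (@upto R H a) (step_set i).
  by move=> i; rewrite /r/=; case: fintype.split => j; [exact: a1'|exact: a2].
have mcs (s' : step_fun (marks_times H R) H) : (forall i : 'I_(step_size s'), admissible m (@upto R H a) (step_set i)) ->
    norm_measurable setT (compensated_step m N s').
  exact: norm_measurable_compensated.
have zE p : ~ S1 p -> step_eval v p = step_eval s1 p.
  by move=> nS1; rewrite step_eval_restrict indicE mem_set ?scale1r.
have S3C p : S3 p -> ~ S1 p /\ ~ S2 p /\ @small_jumps R H t p.
  rewrite /S3 /strip/= in_itv/= => -[/andP[h1 h2] /andP[h3 h4]]; split; [|split].
  - by move=> [_ /andP[_]]; rewrite leNgt h3.
  - by move=> [/=]; rewrite in_itv/= => /andP[_]; rewrite leNgt h1.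
  - by split; [rewrite h2 (lt_trans eps0)|rewrite h4 (le_lt_trans s0)].
have mdiff (s' : step_fun (marks_times H R) H) D : (forall i : 'I_(step_size s'), admissible m (@upto R H a) (step_set i)) ->
    measurable_fun D (fun p : marks_times H R => (`|(p.1 : H) - step_eval s' p|%R ^+ 2)%:E).
  move=> h; apply: measurable_funTS; apply/measurable_EFinP; apply: measurable_funX.
  apply: norm_measurable_norm; apply: norm_measurable_sub => //; first exact: norm_measurable_mark.
  by apply: step_eval_norm_measurable => i; have [] := h i.
have sq0 (x : H) : 0 <= (`|x|%R ^+ 2)%:E by rewrite lee_fin sqr_ge0.
have mt := measurable_small_jumps t.
exists u; split; [exact: inu| |].
  apply: (@le_trans _ _ e'%:E); last by rewrite lee_fin ge_min lexx.
  apply: le_trans c1.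
  apply: (@le_trans _ _ (\int[m]_(p in strip `]0%R, eps] s t) (`|(p.1 : H) - step_eval s1 p|%R ^+ 2)%:E)).
    apply: ge0_integral_mono => // p [/= h1 /andP[h2 h3]]; rewrite lee_fin.
    rewrite step_eval_restrict indicE mem_set; last first.
      by split => //=; rewrite (le_lt_trans s0 h2) (le_trans h3).
    by rewrite scale1r zE// => -[_ /andP[_]]; rewrite leNgt h2.
  apply: ge0_subset_integral => //; first exact: measurable_strip.
    exact: (mdiff _ _ a1).
  move=> p [/=]; rewrite in_itv/= => /andP[h1 h2] /andP[h3 h4]; split.
    by rewrite h1 (le_trans h2).
  by rewrite h4 (le_lt_trans s0 h3).
pose c := step_integral m b.
have cE : (`|c| ^+ 2 <= k * e')%R.
  rewrite -lee_fin [leRHS]EFinM.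
  apply: (le_trans (step_integral_strip_le ipP sepH hnu1 nu_symmetric eps0 st inb)).
  apply: lee_wpmul2l; first by rewrite lee_fin ltW.
  apply: le_trans c1.
  apply: (@le_trans _ _ (\int[m]_(p in S3) (`|(p.1 : H) - step_eval s1 p|%R ^+ 2)%:E)).
    apply: ge0_integral_mono => // p /S3C[nS1 [nS2 _]]; rewrite lee_fin.
    by rewrite step_eval_restrict indicE mem_set// scale1r zE.
  apply: ge0_subset_integral => //; first exact: measurable_strip.
    exact: (mdiff _ _ a1).
  by move=> p /S3C[_ []].
have rE : \int[P]_w (`|compensated_step m N r w|%R ^+ 2)%:E <= (4 * e')%:E.
  rewrite (compensated_step_isometry ipP po ar).
  pose f1 p := (`|(p.1 : H) - step_eval s1 p|%R ^+ 2)%:E.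
  pose f2 p := (`|(p.1 : H) - step_eval s2 p|%R ^+ 2)%:E.
  apply: (@le_trans _ _ (\int[m]_(p in S1) (2%:E * (f1 p + f2 p)))).
    rewrite [leRHS]integral_mkcond; apply: ge0_integral_mono => // p _; rewrite patchE.
    rewrite step_eval_sub step_eval_restrict indicE; case: ifPn => pS.
      rewrite scale1r /f1 /f2 -EFinD -EFinM lee_fin.
      set x := step_eval s1 p; set y := step_eval s2 p; set z : H := p.1.
      have : (`|x - y| <= `|z - x| + `|z - y|)%R.
        by rewrite -(subrKA z) (le_trans (ler_normD _ _))// distrC.
      set A := `|z - x|%R; set B := `|z - y|%R => h.
      apply: (@le_trans _ _ ((A + B) ^+ 2)%R); first by rewrite lerXn2r ?nnegrE//; apply: addr_ge0; exact: normr_ge0.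
      exact: sqr_add_le.
    rewrite scale0r step_eval0 ?subrr ?normr0 ?expr0n//.
    by move=> i; have [_ iS1 _] := in2 i => /iS1; rewrite notin_setE in pS.
  have mf1 : measurable_fun S1 f1 by exact: (mdiff _ _ a1).
  have mf2 : measurable_fun S1 f2 by exact: (mdiff _ _ a2).
  have f10 p : 0 <= f1 p by exact: sq0.
  have f20 p : 0 <= f2 p by exact: sq0.
  rewrite ge0_integralZl//; last 2 first.
  - exact: emeasurable_funD.
  - by move=> p _; rewrite adde_ge0.
  rewrite ge0_integralD// (_ : (4 * e')%:E = 2%:E * (e'%:E + e'%:E)); last first.
    by rewrite -EFinD -EFinM; congr EFin; ring.
  apply: lee_wpmul2l => //; apply: leeD => //.
  by apply: le_trans c1; apply: ge0_subset_integral => //; exact: (mdiff _ _ a1).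
pose x1 w : H := (M t w - compensated_step m N s1 w)%R.
pose x2 w : H := (M s w - compensated_step m N s2 w)%R.
pose x3 := compensated_step m N r.
have mx1 : norm_measurable setT x1 by exact: (norm_measurable_sub sepH (mM t0) (mcs _ a1)).
have mx2 : norm_measurable setT x2 by exact: (norm_measurable_sub sepH (mM s0) (mcs _ a2)).
have mx3 : norm_measurable setT x3 by exact: (mcs _ ar).
pose g w := (4 * (`|x1 w| ^+ 2 + `|x2 w| ^+ 2 + `|x3 w| ^+ 2))%R%:E.
have g0 w : 0 <= g w by rewrite lee_fin mulr_ge0// !addr_ge0// sqr_ge0.
have mg : measurable_fun setT g.
  apply/measurable_EFinP; apply: measurable_funM => //; apply: measurable_funD; [apply: measurable_funD|];
  by apply: measurable_funX; exact: norm_measurable_norm.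
apply: (@le_trans _ _ (\int[Q]_w (g w + (4 * (k * e'))%:E))).
  apply: ae_ge0_le_integral => //.
  - apply: measurable_sqr_norm.
    exact: (norm_measurable_sub sepH (norm_measurable_sub sepH (mM t0) (mM s0)) (mcs _ au)).
  - by move=> w _; rewrite adde_ge0// lee_fin !mulr_ge0// ltW.
  - exact: emeasurable_funD.
  have s1split := compensated_step_split po mS1 a1.
  have vsplit := compensated_step_split po mS2 av.
  have := conditional_ae (measurable_void_event hF hN a0 big_strip_adm) (void_gt0 hN big_strip_adm)
    (ae_and s1split vsplit).
  apply: ae_imply => w [/= Vw [e1 e2]] _.
  (* On the void event no point of [N w] falls in the sets of [b]; only the compensator is left. *)
  have csb : compensated_step m N b w = (- c)%R.
    rewrite /compensated_step [X in (X - _)%R](_ : _ = 0%R) ?sub0r// /step_integral big1// => i _.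
    rewrite (_ : N w (step_set i) = 0) ?scale0r//.
    have [mi iS3 _] := inb i; have [mB _ _] := big_strip_adm.
    apply/eqP; rewrite -measure_le0 -Vw; apply: le_measure; rewrite ?inE//.
    move=> p /iS3[/=]; rewrite in_itv/= => /andP[h1 _] /andP[h2 h3].
    by split; rewrite /= ?in_itv/= ?h1// (le_lt_trans s0 h2) (le_trans h3).
  rewrite /g -EFinD lee_fin.
  apply: (@le_trans _ _ (4 * (`|x1 w| ^+ 2 + `|x2 w| ^+ 2 + `|x3 w| ^+ 2) + 4 * `|- c| ^+ 2)%R).
    rewrite (_ : (M t w - M s w - compensated_step m N u w)%R = (x1 w - x2 w + (x3 w + - c))%R).
      exact: sqr_norm_sum4.
    rewrite -csb /x1 /x2 /x3 compensated_step_sub e1 e2.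
    exact: increment_identity.
  by rewrite normrN lerD2l ler_pM2l.
rewrite ge0_integralD//; last by move=> w _; rewrite lee_fin !mulr_ge0// ltW.
rewrite integral_cst// [X in _ * X](probability_setT Q) mule1.
have gP : \int[P]_w g w <= (24 * e')%:E.
  have i1 : measurable_fun setT (fun w => (`|x1 w| ^+ 2)%R%:E) by exact: measurable_sqr_norm.
  have i2 : measurable_fun setT (fun w => (`|x2 w| ^+ 2)%R%:E) by exact: measurable_sqr_norm.
  have i3 : measurable_fun setT (fun w => (`|x3 w| ^+ 2)%R%:E) by exact: measurable_sqr_norm.
  rewrite (_ : \int[P]_w g w = 4%:E * (\int[P]_w (`|x1 w| ^+ 2)%R%:E +
    \int[P]_w (`|x2 w| ^+ 2)%R%:E + \int[P]_w (`|x3 w| ^+ 2)%R%:E)); last first.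
    transitivity (\int[P]_w (4%:E * ((`|x1 w| ^+ 2)%R%:E + (`|x2 w| ^+ 2)%R%:E + (`|x3 w| ^+ 2)%R%:E))).
      by apply: eq_integral => w _; rewrite -!EFinD -EFinM.
    rewrite ge0_integralZl//; last 2 first.
    - by apply: emeasurable_funD => //; exact: emeasurable_funD.
    - by move=> w _; rewrite -!EFinD lee_fin !addr_ge0// sqr_ge0.
    rewrite ge0_integralD//; last 2 first.
    - by move=> w _; rewrite -EFinD lee_fin addr_ge0// sqr_ge0.
    - exact: emeasurable_funD.
    by rewrite ge0_integralD// => w _; rewrite lee_fin sqr_ge0.
  rewrite (_ : (24 * e')%:E = 4%:E * (e'%:E + e'%:E + (4 * e')%:E)); last first.
    by rewrite -!EFinD -EFinM; congr EFin; ring.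
  by apply: lee_wpmul2l => //; rewrite !leeD.
have gQ : \int[Q]_w g w <= q%:E * \int[P]_w g w.
  apply: ge0_integral_le_scale => //.
  by move=> A mA; exact: void_law_le.
apply: (@le_trans _ _ (q%:E * (24 * e')%:E + (4 * (k * e'))%:E)).
  by rewrite leeD2r// (le_trans gQ)// lee_wpmul2l.
rewrite -EFinM -EFinD lee_fin.
have : (e' <= e / (4 * (6 * q + k)))%R by rewrite ge_min lexx orbT.
rewrite ler_pdivlMr ?mulr_gt0// ?ltr_wpDl ?mulr_ge0// => h; apply: le_trans h.
by rewrite le_eqVlt; apply/orP; left; apply/eqP; ring.
Unshelve. all: by end_near.
Qed.

End increments.

(** * Moments of the increments under the conditional law *)

Section increment_moments.
Context (R : realType) (H : completeNormedModType R) (d : measure_display)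
  (Omega : measurableType d) (P : probability Omega R)
  (F : R -> set (set Omega)) (hF : usual_conditions P F)
  (nu : {sigma_finite_measure set (borel H) -> \bar R})
  (N : Omega -> {measure set (marks_times H R) -> \bar R})
  (hN : poisson_random_measure P F nu N).
Context (ip : H -> H -> R) (ipP : is_inner_product ip) (sepH : separable_space H).
Hypothesis hnu1 : (\int[nu]_z (Num.min (`|z : H| ^+ 2) 1)%:E < +oo)%E.
Hypothesis nu_symmetric : forall B : set (borel H), measurable B ->
  nu B = nu [set - (z : H) | z in B]%R.
Local Open Scope ereal_scope.
Local Notation m := (intensity nu).

Variable M : R -> Omega -> H.
Hypothesis mM : forall t, (0 <= t)%R -> norm_measurable setT (M t).
Hypothesis cM : forall t, (0 <= t)%R ->
  is_compensated_integral P nu N (@small_jumps R H t) (fun p => p.1) (M t).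

Variables a eps : R.
Hypotheses (a0 : (0 <= a)%R) (eps0 : (0 < eps)%R) (eps1 : (eps <= 1)%R).
Local Notation Q := (void_big hF hN hnu1 a0 eps0).
Local Notation D := (@big_strip R H a eps).
Let Gam : set (marks_times H R) := @upto R H a `\` D.

Let poQ : poisson_on Q m N Gam.
Proof. exact: (void_poisson_on hF hN a0 (big_strip_adm hnu1 a0 eps0)). Qed.

Let strip_Gam (s t : R) : (0 <= s)%R -> (t <= a)%R -> strip (H := H) `]0%R, eps] s t `<=` Gam.
Proof.
move=> s0 ta p [/=]; rewrite in_itv/= => /andP[h1 h2] /andP[h3 h4]; split.
  by rewrite /upto/= (le_trans s0 (ltW h3)) (le_trans h4).
by move=> [/=]; rewrite in_itv/= andbT ltNge h2.
Qed.

Let sq0 (x : H) : 0 <= (`|x|%R ^+ 2)%:E. Proof. by rewrite lee_fin sqr_ge0. Qed.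

Lemma sqr_norm_triangle (x y : H) : (`|x| ^+ 2 <= 2 * `|y - x| ^+ 2 + 2 * `|y| ^+ 2)%R.
Proof.
have h : (`|x| <= `|y - x| + `|y|)%R by rewrite -{1}(subKr y x) (le_trans (ler_normB _ _))// addrC.
apply: (@le_trans _ _ ((`|y - x| + `|y|) ^+ 2)%R); first by rewrite lerXn2r ?nnegrE ?addr_ge0.
by rewrite -mulrDr sqr_add_le.
Qed.

Lemma integral_sqr_triangle d1 (T : measurableType d1) (mu : {measure set T -> \bar R})
    (E : set T) (f g : T -> H) (x y : R) : measurable E ->
  norm_measurable setT f -> norm_measurable setT g ->
  \int[mu]_(w in E) (`|f w - g w|%R ^+ 2)%:E <= x%:E ->
  \int[mu]_(w in E) (`|f w|%R ^+ 2)%:E <= y%:E ->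
  \int[mu]_(w in E) (`|g w|%R ^+ 2)%:E <= (2 * x + 2 * y)%:E.
Proof.
move=> mE mf mg hx hy.
have mfg : measurable_fun E (fun w => (`|f w - g w|%R ^+ 2)%:E).
  apply: measurable_funTS; apply/measurable_EFinP; apply: measurable_funX.
  by apply: norm_measurable_norm; exact: norm_measurable_sub.
have mf' : measurable_fun E (fun w => (`|f w|%R ^+ 2)%:E).
  apply: measurable_funTS; apply/measurable_EFinP; apply: measurable_funX.
  exact: norm_measurable_norm.
apply: (@le_trans _ _ (\int[mu]_(w in E) (2%:E * (`|f w - g w|%R ^+ 2)%:E + 2%:E * (`|f w|%R ^+ 2)%:E))).
  by apply: ge0_integral_mono => // w _; rewrite -!EFinM -EFinD lee_fin sqr_norm_triangle.
rewrite ge0_integralD//; last 2 first.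
- exact: measurable_funeM.
- exact: measurable_funeM.
by rewrite ge0_integralZl// ge0_integralZl// (EFinD (2 * x)%R) (EFinM _ x) (EFinM _ y) leeD// lee_wpmul2l.
Qed.

(** The isometry is applied to the approximating step function. The factor 4 comes from two uses of
    [(x + y)^2 <= 2 x^2 + 2 y^2]. *)
Lemma increment_variance (s t v : R) : (0 <= s)%R -> (s <= t)%R -> (t <= a)%R -> (0 <= v)%R ->
  \int[nu]_(z in annulus `]0%R, eps]) (`|z : H|%R ^+ 2)%:E <= v%:E ->
  \int[Q]_w (`|M t w - M s w|%R ^+ 2)%:E <= (4 * (t - s) * v)%:E.
Proof.
move=> s0 st ta v0 hv; apply/lee_addgt0Pr => e e0.
(* The errors of the two triangle inequalities are [2 * (e / 6)] and [4 * (e / 6)], in sum [e]. *)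
have e6 : (0 < e / 6)%R by rewrite divr_gt0.
have [u [inu cu du]] := increment_approx hF hN ipP sepH hnu1 nu_symmetric mM cM a0 eps0 eps1 s0 st ta e6.
have mI : measurable `]0%R, eps] by [].
have mS := measurable_strip (H := H) s t mI.
have adu := step_in_adm inu (strip_Gam s0 ta).
have hS : \int[m]_(p in strip (H := H) `]0%R, eps] s t) (`|p.1 : H|%R ^+ 2)%:E <= ((t - s) * v)%:E.
  rewrite (@integral_strip R H nu (fun z => (`|z : H|%R ^+ 2)%:E))//.
    by rewrite EFinM lee_wpmul2l// lee_fin subr_ge0.
  by apply/measurable_EFinP; apply: measurable_funX; exact: measurable_norm_borel.
have hu : \int[Q]_w (`|compensated_step m N u w|%R ^+ 2)%:E <= (2 * (e / 6) + 2 * ((t - s) * v))%:E.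
  rewrite (compensated_step_isometry ipP poQ adu).
  rewrite (_ : \int[m]_p _ = \int[m]_(p in strip (H := H) `]0%R, eps] s t) (`|step_eval u p|%R ^+ 2)%:E); last first.
    rewrite [RHS]integral_mkcond; apply: eq_integral => p _; rewrite patchE; case: ifPn => // pS.
    rewrite step_eval0 ?normr0 ?expr0n// => i.
    by have [_ iS _] := inu i => /iS; rewrite notin_setE in pS.
  apply: (integral_sqr_triangle mS _ _ cu hS); first exact: norm_measurable_mark.
  by apply: step_eval_norm_measurable => i; have [] := inu i.
have mcs := norm_measurable_compensated_step poQ sepH adu.
have mMM : norm_measurable setT (fun w => M t w - M s w)%R.
  by apply: norm_measurable_sub => //; [apply: mM; exact: le_trans st|exact: mM].
have du' : \int[Q]_w (`|compensated_step m N u w - (M t w - M s w)|%R ^+ 2)%:E <= (e / 6)%:E.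
  by apply: le_trans du; apply: ge0_integral_mono => // w _; rewrite lee_fin distrC.
apply: (le_trans (integral_sqr_triangle measurableT mcs mMM du' hu)).
by rewrite lee_fin; lra.
Qed.

(** The increment is approximated by compensated counts over times in []s, t]], which under [Q] are
    centred and independent of [F s]. Only inner products of [phi] with fixed vectors enter, hence
    the weak form of its measurability. *)
Lemma increment_orthogonal (s t : R) (phi : Omega -> H) : (0 <= s)%R -> (s <= t)%R -> (t <= a)%R ->
  norm_measurable setT phi ->
  (forall c A, measurable A -> F s ((fun w => ip (phi w) c) @^-1` A)) ->
  \int[Q]_w (`|phi w|%R ^+ 2)%:E < +oo ->
  \int[Q]_w (`|M t w - M s w|%R ^+ 2)%:E < +oo ->
  \int[Q]_w (ip (phi w) (M t w - M s w))%:E = 0.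
Proof.
move=> s0 st ta mphi Fphi phi2 M2.
have mM' : norm_measurable setT (fun w => M t w - M s w)%R.
  by apply: norm_measurable_sub => //; [apply: mM; exact: le_trans st|exact: mM].
have int_ip (f : Omega -> H) : norm_measurable setT f -> \int[Q]_w (`|f w|%R ^+ 2)%:E < +oo ->
    Q.-integrable setT (fun w => (ip (phi w) (f w))%:E).
  move=> mf f2.
  have nf := norm_measurable_norm mf; have np := norm_measurable_norm mphi.
  have := mul_square_integrable np nf phi2 f2; apply: (le_integrable measurableT).
    by apply/measurable_EFinP; exact: (norm_measurable_ip ipP sepH mphi mf).
  move=> w _; rewrite /= lee_fin [leRHS]ger0_norm ?mulr_ge0//; exact: ip_le.
have iM := int_ip _ mM' M2.
set c := fine (\int[Q]_w (`|phi w|%R ^+ 2)%:E).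
have c0 : (0 <= c)%R by rewrite fine_ge0// integral_ge0.
have cE : \int[Q]_w (`|phi w|%R ^+ 2)%:E = c%:E.
  by rewrite /c fineK// ge0_fin_numE// integral_ge0.
suff : `|\int[Q]_w (ip (phi w) (M t w - M s w))%:E| <= 0.
  by move=> h; apply/eqP; rewrite -abse_eq0; rewrite eq_le h abse_ge0.
apply/lee_addgt0Pr => e e0; rewrite add0e.
(* With this weight in Young's inequality and accuracy [e * k], the two error terms are at most
   [k * c / 2 <= e / 2] and [e / 2]. *)
pose k := (e / (c + 1))%R.
have k0 : (0 < k)%R by rewrite divr_gt0// ltr_wpDl.
have ek : (0 < e * k)%R by rewrite mulr_gt0.
have [u [inu cu du]] := increment_approx hF hN ipP sepH hnu1 nu_symmetric mM cM a0 eps0 eps1 s0 st ta ek.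
have adu := step_in_adm inu (strip_Gam s0 ta).
have mcs := norm_measurable_compensated_step poQ sepH adu.
have mdel : norm_measurable setT (fun w => M t w - M s w - compensated_step m N u w)%R.
  exact: norm_measurable_sub.
have idel := int_ip _ mdel (le_lt_trans du (ltry _)).
have term (i : 'I_(step_size u)) :
    Q.-integrable setT (fun w => (ip (phi w) (step_val i) * compensated m N (step_set i) w)%:E) /\
    \int[Q]_w (ip (phi w) (step_val i) * compensated m N (step_set i) w)%:E = 0.
  have mip : measurable_fun setT (fun w => ip (phi w) (step_val i)).
    have mcst : norm_measurable setT (fun _ : Omega => @step_val _ _ u i) by exact: norm_measurable_cst.
    exact: (norm_measurable_ip ipP sepH mphi mcst).
  have mc := measurable_compensated poQ (adu i).
  have ii : Q.-integrable setT (EFin \o ((fun w => ip (phi w) (step_val i)) \* compensated m N (step_set i))%R).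
    apply: mul_square_integrable => //; last first.
      by rewrite (compensated_variance poQ (adu i)) ltry.
    apply: (@le_lt_trans _ _ (\int[Q]_w ((`|step_val i| ^+ 2)%:E * (`|phi w|%R ^+ 2)%:E))).
      apply: ge0_integral_mono => w _; first by rewrite lee_fin sqr_ge0.
      rewrite -EFinM lee_fin -exprMn -real_normK ?num_real// lerXn2r ?nnegrE ?mulr_ge0// mulrC.
      exact: ip_le.
    rewrite ge0_integralZl ?cE ?ltry//.
    exact: measurable_sqr_norm.
  split; first exact: ii.
  apply: integral_indep_eq0 => //; last 2 first.
  - exact: (compensated_integrable poQ (adu i)).
  - exact: (compensated_mean poQ (adu i)).
  move=> A B mA mB; have [mi iS _] := inu i.
  pose C := (fun x : \bar R => (fine x - fine (m (step_set i)))%R) @^-1` B.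
  have mC : measurable C.
    rewrite -[X in measurable X]setTI.
    by apply: measurable_funB => //; exact: fine_measurable.
  apply: (void_future_indep hF hN a0 (big_strip_adm hnu1 a0 eps0) s0 (le_trans st ta) (Fphi _ _ mA) mi _ mC).
  move=> p /iS h; split; first by have [] := strip_Gam s0 ta h.
  by have [_ /andP[]] := h.
have i0 : \int[Q]_w (ip (phi w) (compensated_step m N u w))%:E = 0.
  transitivity (\int[Q]_w \sum_(i < step_size u) (ip (phi w) (step_val i) * compensated m N (step_set i) w)%:E).
    apply: eq_integral => w _; rewrite compensated_stepE (ip_sumr ipP) -sumEFin.
    by apply: eq_bigr => i _; rewrite (ipZr ipP) mulrC.
  rewrite integral_sum//; last by move=> i; have [] := term i.
  by rewrite big1// => i _; have [] := term i.
have ics : Q.-integrable setT (fun w => (ip (phi w) (compensated_step m N u w))%:E).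
  apply: (eq_integrable measurableT (fun w => \sum_(i < step_size u) (ip (phi w) (step_val i) * compensated m N (step_set i) w)%:E)).
    move=> w _; rewrite compensated_stepE (ip_sumr ipP) -sumEFin.
    by apply: eq_bigr => i _; rewrite (ipZr ipP) mulrC.
  by apply: integrable_sum => // i; have [] := term i.
have -> : \int[Q]_w (ip (phi w) (M t w - M s w))%:E =
    \int[Q]_w (ip (phi w) (M t w - M s w - compensated_step m N u w))%:E.
  transitivity (\int[Q]_w ((ip (phi w) (M t w - M s w))%:E - (ip (phi w) (compensated_step m N u w))%:E)).
    by rewrite integralB// i0 sube0.
  by apply: eq_integral => w _; rewrite -EFinB -(ipBr ipP).
apply: (le_trans (le_abse_integral _ measurableT (measurable_int _ idel))).
pose del w := (M t w - M s w - compensated_step m N u w)%R.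
apply: (@le_trans _ _ (\int[Q]_w ((2^-1 * k)%:E * (`|phi w| ^+ 2)%:E + (2^-1 / k)%:E * (`|del w|%R ^+ 2)%:E))).
  apply: ge0_integral_mono => // w _; rewrite /= -!EFinM -EFinD lee_fin.
  apply: (le_trans (ip_le ipP _ _)); rewrite -/(del w); set x := `|phi w|%R; set y := `|del w|%R.
  have -> : (2^-1 * k * x ^+ 2 + 2^-1 / k * y ^+ 2 = 2^-1 * k * (x - y / k) ^+ 2 + x * y)%R.
    by field; rewrite gt_eqF.
  by rewrite lerDr mulr_ge0 ?sqr_ge0// mulr_ge0// ltW.
have k20 : (0 <= 2^-1 * k)%R by rewrite mulr_ge0// ltW.
have k21 : (0 <= 2^-1 / k)%R by rewrite mulr_ge0// invr_ge0 ltW.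
rewrite ge0_integralD//; last 4 first.
- by move=> w _; rewrite mule_ge0// lee_fin.
- by apply: measurable_funeM; exact: measurable_sqr_norm.
- by move=> w _; rewrite mule_ge0// lee_fin.
- by apply: measurable_funeM; exact: measurable_sqr_norm.
rewrite ge0_integralZl//; last exact: measurable_sqr_norm.
rewrite ge0_integralZl//; last exact: measurable_sqr_norm.
rewrite cE; apply: (@le_trans _ _ ((2^-1 * k)%:E * c%:E + (2^-1 / k)%:E * (e * k)%:E)).
  by rewrite leeD2l// lee_wpmul2l ?lee_fin.
rewrite -!EFinM -EFinD lee_fin.
have -> : (2^-1 / k * (e * k) = 2^-1 * e)%R by field; rewrite gt_eqF.
have : (k * c <= e)%R by rewrite /k mulrAC ler_pdivrMr ?ltr_wpDl// ler_pM2l// lerDl.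
lra.
Qed.

End increment_moments.

Section small_variance.
Context (R : realType) (H : completeNormedModType R).
Context (nu : {sigma_finite_measure set (borel H) -> \bar R}).
Hypothesis hnu1 : (\int[nu]_z (Num.min (`|z : H| ^+ 2) 1)%:E < +oo)%E.
Local Open Scope ereal_scope.

(** Dominated convergence along the radii [1 / (n + 1)]: every nonzero [z] leaves the shrinking
    annuli, and they never contain 0. *)
Lemma small_annulus_variance (v : R) : (0 < v)%R -> exists eps : R,
  [/\ (0 < eps)%R, (eps <= 1)%R &
     \int[nu]_(z in annulus `]0%R, eps]) (`|z : H|%R ^+ 2)%:E <= v%:E].
Proof.
move=> v0; pose h n : R := (n.+1%:R^-1)%R.
have h0 n : (0 < h n)%R by rewrite invr_gt0.
have h1 n : (h n <= 1)%R by rewrite invf_le1// ler1n.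
pose A n : set (borel H) := annulus `]0%R, h n].
pose f n (z : borel H) : \bar R := ((\1_(A n) z : R) * `|z : H| ^+ 2)%R%:E.
pose g (z : borel H) : \bar R := (Num.min (`|z : H| ^+ 2) 1)%R%:E.
have mA n : measurable (A n) by exact: measurable_annulus.
have mf n : measurable_fun setT (f n).
  apply/measurable_EFinP; apply: measurable_funM; first exact: measurable_indic.
  by apply: measurable_funX; exact: measurable_norm_borel.
have mg : measurable_fun setT g.
  apply/measurable_EFinP; apply: measurable_minr => //; apply: measurable_funX.
  exact: measurable_norm_borel.
have ig : nu.-integrable setT g.
  apply/integrableP; split => //.
  by rewrite (eq_integral g)// => z _; rewrite gee0_abs// lee_fin le_min sqr_ge0 ler01.
have f0 n z : 0 <= f n z by rewrite lee_fin mulr_ge0// sqr_ge0.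
have fg n z : f n z <= g z.
  rewrite lee_fin indicE; case: (boolP (z \in A n)) => [|_]; last by rewrite mul0r le_min sqr_ge0 ler01.
  rewrite inE /A /annulus/= in_itv/= => /andP[_ z1]; rewrite mul1r le_min lexx/=.
  by rewrite exprn_ile1// (le_trans z1).
have fc z : f n z @[n --> \oo] --> 0.
  have [z0|z0] := eqVneq (z : H) 0%R.
    rewrite (_ : f ^~ z = fun=> 0); first exact: cvg_cst.
    by apply/funext => n; rewrite /f z0 normr0 expr0n mulr0.
  have zp : (0 < `|z : H|)%R by rewrite normr_gt0.
  apply: cvg_near_cst; near=> n.
  rewrite /f indicE memNset ?mul0r// /A /annulus/= in_itv/= => /andP[_]; apply/negP; rewrite -ltNge.
  near: n; exact: (near_infty_natSinv_lt (PosNum zp)).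
have fca : {ae nu, forall z, setT z -> f ^~ z @ \oo --> 0} by apply: aeW => z _; exact: fc.
have fga : {ae nu, forall z n, setT z -> `|f n z| <= g z}.
  by apply: aeW => z n _; rewrite gee0_abs// fg.
have [_ _] := dominated_convergence measurableT mf (measurable_cst 0) fca ig fga.
rewrite integral0 => lim0.
have := cvge0_lt lim0 v0 => -[n0 _ hn0].
exists (h n0); split => //; apply: ltW; apply: le_lt_trans (hn0 n0 _) => //=.
rewrite integral_mkcond; apply: ge0_integral_mono => z _.
  by rewrite patchE; case: ifPn => // _; rewrite lee_fin sqr_ge0.
by rewrite patchE /f indicE /A; case: (_ \in _); rewrite ?mul1r ?mul0r.
Unshelve. all: by end_near.
Qed.

End small_variance.

(** * Adaptedness and the exit from a ball *)

Section adapted_processes.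
Context (R : realType) (H : completeNormedModType R) (d : measure_display)
  (Omega : measurableType d) (P : probability Omega R)
  (F : R -> set (set Omega)) (hF : usual_conditions P F).
Local Notation FT t := (g_sigma_algebraType (F t)).

Lemma filtration_measurable t A : 0 <= t -> measurable (A : set (FT t)) -> F t A.
Proof. by move=> t0; rewrite /measurable/= (sigma_algebra_id (filt_sigma_algebra hF t0)). Qed.

Lemma adapted_norm_measurable (Z : R -> Omega -> H) s t : adapted F Z -> 0 <= s -> s <= t ->
  norm_measurable setT (Z s : FT t -> H).
Proof.
move=> aZ s0 st y _ A mA; rewrite setTI; apply: sub_sigma_algebra.
apply: (filt_mono hF s0 st).
apply: (aZ s s0 ((fun z : borel H => `|z - y|) @^-1` A)).
by rewrite -[X in measurable X]setTI; exact: (norm_measurable_borel y measurableT mA).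
Qed.

Lemma adapted_norm_measurable_total (Z : R -> Omega -> H) s : adapted F Z -> 0 <= s ->
  norm_measurable setT (Z s).
Proof.
move=> aZ s0 y _ A mA; rewrite setTI.
apply: (filt_measurable hF s0); apply: filtration_measurable => //.
by have := adapted_norm_measurable aZ s0 (lexx s) y measurableT mA; rewrite setTI.
Qed.

Variables (X : R -> Omega -> H) (K : R).

(* Right-continuity of the paths lets this countable condition stand for
   [|X r w| <= K] on all of [0, s]. *)
Definition stays (s : R) : set Omega :=
  [set w | `|X s w| <= K /\ forall q : rat, 0 <= (ratr q : R) < s -> `|X (ratr q) w| <= K].

Lemma staysE s : stays s = [set w | `|X s w| <= K] `&`
  \bigcap_(q in [set: rat]) (if 0 <= (ratr q : R) < s then [set w | `|X (ratr q) w| <= K] else setT).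
Proof.
apply/seteqP; split => w [h1 h2]; split => // q.
  by move=> _; case: ifPn => // qs; exact: h2.
by move=> qs; have := h2 q I; rewrite qs.
Qed.

Lemma bigcapT_measurable_rat d' (T : measurableType d') (A : rat -> set T) :
  (forall q, measurable (A q)) -> measurable (\bigcap_q A q).
Proof.
move=> mA; rewrite -[X in measurable X]setCK setC_bigcap; apply: measurableC.
by apply: bigcupT_measurable_rat => q; exact: measurableC.
Qed.

Lemma norm_le_measurable d' (T : measurableType d') (f : T -> H) : norm_measurable setT f ->
  measurable [set w | `|f w| <= K].
Proof.
move=> /norm_measurable_norm mf.
rewrite (_ : [set w | _] = (fun w => `|f w|) @^-1` `]-oo, K]).
  by rewrite -[X in measurable X]setTI; apply: mf => //; exact: measurable_itv.
by apply/seteqP; split => w /=; rewrite in_itv.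
Qed.

Lemma measurable_stays s t : adapted F X -> 0 <= s -> s <= t ->
  measurable (stays s : set (FT t)).
Proof.
move=> aX s0 st; rewrite staysE; apply: measurableI.
  exact: (norm_le_measurable (adapted_norm_measurable aX s0 st)).
apply: bigcapT_measurable_rat => q; case: ifPn => [/andP[q0 qs]|_]; last exact: measurableT.
exact: (norm_le_measurable (adapted_norm_measurable aX q0 (le_trans (ltW qs) st))).
Qed.

(** The constraint [q < s] on the rational times varies with [s]; expressed as a union with the set
    [s <= q], it leaves a countable intersection of product-measurable sets. *)
Lemma measurable_stays_joint : (forall t, norm_measurable setT (X t)) ->
  (forall (t : R) w, X s w @[s --> t^'+] --> X t w) ->
  measurable [set p : measurableTypeR R * Omega | stays p.1 p.2].
Proof.
move=> mX rX.
have mXj := norm_measurable_process mX rX.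
rewrite (_ : [set p | _] = [set p : measurableTypeR R * Omega | `|X p.1 p.2| <= K] `&`
  \bigcap_(q in [set: rat]) (if 0 <= (ratr q : R) then
     [set p : measurableTypeR R * Omega | p.1 <= ratr q] `|` [set p | `|X (ratr q) p.2| <= K] else setT)).
  apply: measurableI; first exact: (norm_le_measurable mXj).
  apply: bigcapT_measurable_rat => q; case: ifPn => // q0.
  apply: measurableU.
    rewrite (_ : [set p | _] = fst @^-1` `]-oo, (ratr q : R)]).
      rewrite -[X in measurable X]setTI; apply: (@measurable_fst _ _ (measurableTypeR R) Omega) => //.
    by apply/seteqP; split => p /=; rewrite in_itv.
  apply: (norm_le_measurable (f := fun p : measurableTypeR R * Omega => X (ratr q) p.2)).
  by move=> y; apply: (measurableT_comp (mX (ratr q) y)); exact: measurable_snd.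
apply/seteqP; split => p [h1 h2]; split => // q.
  move=> _; case: ifPn => // q0 /=; have [|ps] := lerP p.1 (ratr q); first by left.
  by right; apply: h2; rewrite q0.
by move=> /andP[q0 qs]; have := h2 q I; rewrite q0/= => -[|//]; rewrite leNgt qs.
Qed.

End adapted_processes.

Section auxiliary.
Context (R : realType).
Local Open Scope ereal_scope.

(** Expanding the square of the distance to [y] with the inner product leaves only measurable real
    functions. *)
Lemma norm_measurable_scalel (H : normedModType R) (ip : H -> H -> R) d (T : measurableType d)
    (f : T -> R) (X : T -> H) : is_inner_product ip -> separable_space H ->
  measurable_fun setT f -> norm_measurable setT X ->
  norm_measurable setT (fun x => f x *: X x)%R.
Proof.
move=> ipP sepH mf mX y.
have my : norm_measurable setT (fun _ : T => y) by exact: norm_measurable_cst.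
have mip := norm_measurable_ip ipP sepH mX my.
have mn := norm_measurable_norm mX.
rewrite (_ : (fun x => _) = (fun x => Num.sqrt (f x ^+ 2 * `|X x| ^+ 2 - 2 * (f x * ip (X x) y) + `|y| ^+ 2))%R).
  apply: (measurableT_comp (f := @Num.sqrt R)).
    exact: (continuous_measurable_fun (@sqrt_continuous R)).
  apply: measurable_funD => //; apply: measurable_funB.
    by apply: measurable_funM; exact: measurable_funX.
  by apply: measurable_funM => //; exact: measurable_funM.
apply/funext => x; rewrite -[LHS]ger0_norm// -sqrtr_sqr; congr Num.sqrt.
rewrite -!(ip_norm ipP) (ipBl ipP) !(ipBr ipP) !(ipZl ipP) !(ipZr ipP) (ip_sym ipP y); ring.
Qed.

Lemma markov_ge0 d (T : measurableType d) (mu : {measure set T -> \bar R}) (f : T -> \bar R) (c : R) :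
  (0 < c)%R -> measurable_fun setT f -> (forall x, 0 <= f x) ->
  c%:E * mu [set x | c%:E <= f x] <= \int[mu]_x f x.
Proof.
move=> c0 mf f0; have mA : measurable [set x | c%:E <= f x].
  by rewrite -[X in measurable X]setTI; exact: emeasurable_fun_c_infty.
rewrite -integral_cst// [leLHS]integral_mkcond; apply: ge0_integral_mono => x _.
  by rewrite patchE; case: ifPn => // _; rewrite lee_fin ltW.
by rewrite patchE; case: ifPn => //; rewrite inE.
Qed.

(** The integral is by definition the difference of those of the positive and negative parts, each
    measurable by Tonelli. *)
Lemma measurable_fine_integral d (T : measurableType d) (g : R -> T -> R) :
  measurable_fun setT (fun p : measurableTypeR R * T => g p.1 p.2) ->
  measurable_fun setT (fun w => fine (\int[@lebesgue_measure R]_s (g s w)%:E)).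
Proof.
move=> mg; apply: measurableT_comp; first exact: fine_measurable.
have mE : measurable_fun setT (fun p : measurableTypeR R * T => (g p.1 p.2)%:E) by exact/measurable_EFinP.
rewrite (_ : (fun w => _) = (fun w => \int[@lebesgue_measure R]_s ((fun p : measurableTypeR R * T => (g p.1 p.2)%:E)^\+ (s, w)) -
  \int[@lebesgue_measure R]_s ((fun p : measurableTypeR R * T => (g p.1 p.2)%:E)^\- (s, w)))).
  apply: emeasurable_funB.
    apply: (@measurable_fun_fubini_tonelli_G _ _ _ _ _ (@lebesgue_measure R)) => //; exact: measurable_funepos.
  by apply: (@measurable_fun_fubini_tonelli_G _ _ _ _ _ (@lebesgue_measure R)) => //; exact: measurable_funeneg.
apply/funext => w; rewrite integralE; congr (_ - _); apply: eq_integral => s _.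
  by rewrite !funeposE.
by rewrite !funenegE.
Qed.

(** The event that infinitely many [E n] occur is a decreasing limit of unions of probability at
    least 1/2, so it meets every event of probability 1. *)
Lemma frequently_of_half d (T : measurableType d) (Q : probability T R) (E : nat -> set T) (p : T -> Prop) :
  (forall n, measurable (E n)) -> (forall n, 2^-1%:E <= Q (E n)) -> {ae Q, forall w, p w} ->
  exists w, p w /\ forall n0, exists2 n, (n0 <= n)%N & E n w.
Proof.
move=> mE hE [Z [mZ Z0 hZ]].
pose U k := \bigcup_(n in [set n | (k <= n)%N]) E n.
have mU k : measurable (U k) by exact: bigcup_measurable.
have UE k : 2^-1%:E <= Q (U k).
  apply: le_trans (hE k) _; apply: le_measure; rewrite ?inE//.
  by move=> w Ew; exists k => //=.
have cU : Q (U k) @[k --> \oo] --> Q (\bigcap_k U k).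
  apply: nonincreasing_cvg_mu => //.
  - by rewrite (le_lt_trans (probability_le1 Q (mU 0%N)))// ltry.
  - exact: bigcapT_measurable.
  - move=> k l kl; apply/subsetPset => w [n /= ln En]; exists n => //=.
    exact: leq_trans ln.
have hU : 2^-1%:E <= Q (\bigcap_k U k).
  by rewrite -(cvg_lim _ cU)//; apply: lime_ge; [apply/cvg_ex; eexists; exact: cU|exact: nearW].
have [w [Uw nZw]] : (\bigcap_k U k) `\` Z !=set0.
  apply/set0P/negP => /eqP e0.
  have : Q (\bigcap_k U k) <= Q Z.
    apply: le_measure; rewrite ?inE//; first exact: bigcapT_measurable.
    by move=> w Uw; apply: contrapT => nZ; have : ((\bigcap_k U k) `\` Z) w by []; rewrite e0.
  by rewrite Z0 => /(le_trans hU); rewrite lee_fin leNgt invr_gt0 ltr0n.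
exists w; split; first by apply: contrapT => np; apply: nZw; exact: hZ.
by move=> n0; have [n /= h1 h2] := Uw n0 I; exists n.
Qed.

End auxiliary.

(** * Existence of a good path *)

Section good_path.
Context (R : realType) (H : completeNormedModType R) (d : measure_display)
  (Omega : measurableType d) (P : probability Omega R)
  (F : R -> set (set Omega)) (hF : usual_conditions P F)
  (nu : {sigma_finite_measure set (borel H) -> \bar R})
  (N : Omega -> {measure set (marks_times H R) -> \bar R})
  (hN : poisson_random_measure P F nu N).
Context (ip : H -> H -> R) (ipP : is_inner_product ip) (sepH : separable_space H).
Hypothesis hnu1 : (\int[nu]_z (Num.min (`|z : H| ^+ 2) 1)%:E < +oo)%E.
Hypothesis nu_symmetric : forall B : set (borel H), measurable B ->
  nu B = nu [set - (z : H) | z in B]%R.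
Local Open Scope ereal_scope.
Local Notation m := (intensity nu).
Local Notation mu := (@lebesgue_measure R).
Local Notation FT t := (g_sigma_algebraType (F t)).

Variables X M : R -> Omega -> H.
Hypotheses (aX : adapted F X) (aM : adapted F M).
Hypothesis mXt : forall t, norm_measurable setT (X t).
Hypothesis mMt : forall t, norm_measurable setT (M t).
Hypothesis rcX : forall (t : R) w, X s w @[s --> t^'+] --> X t w.
Hypothesis rcM : forall (t : R) w, M s w @[s --> t^'+] --> M t w.
Hypothesis cM : forall t, (0 <= t)%R ->
  is_compensated_integral P nu N (@small_jumps R H t) (fun p => p.1) (M t).

Variables T K v eps : R.
Hypotheses (T0 : (0 < T)%R) (K0 : (0 <= K)%R) (v0 : (0 <= v)%R).
Hypotheses (eps0 : (0 < eps)%R) (eps1 : (eps <= 1)%R).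
Hypothesis hv : \int[nu]_(z in annulus `]0%R, eps]) (`|z : H|%R ^+ 2)%:E <= v%:E.
Hypothesis v_small : ((32 * T * K ^+ 2 + 4 * T) * v <= 2^-1)%R.

Let T1 : (0 <= T + 1)%R. Proof. by rewrite addr_ge0// ltW. Qed.

Local Notation Q := (void_big hF hN hnu1 T1 eps0).

Let h (n : nat) : R := (n.+1%:R^-1)%R.
Let h0 n : (0 < h n)%R. Proof. by rewrite invr_gt0. Qed.
Let h1 n : (h n <= 1)%R. Proof. by rewrite invf_le1// ler1n. Qed.

Let mm n s w : H := (M (s + h n) w - M s w)%R.

(** The indicator of [stays] is known at time [s], so the orthogonality of increments persists, and
    it bounds [|X s|] by [K]. *)
Definition stopped_work n s w : R :=
  (\1_(`[0%R, T]%classic) s * (\1_(stays X K s) w * ip (X s w) (M (s + n.+1%:R^-1) w - M s w)))%R.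
Local Notation g := stopped_work.

Let mstays t : (0 <= t)%R -> measurable (stays X K t).
Proof.
move=> t0; apply: (filt_measurable hF t0); apply: (filtration_measurable hF t0).
exact: (measurable_stays hF K aX t0 (lexx t)).
Qed.

Let mmm n s : norm_measurable setT (mm n s).
Proof. exact: norm_measurable_sub. Qed.

Let mg_s n s : measurable_fun setT (g n s).
Proof.
rewrite /g; have [s0|s0] := lerP 0 s; last first.
  rewrite (_ : (fun w => _) = fun=> 0%R) //.
  apply/funext => w; rewrite indicE memNset ?mul0r//= in_itv/= => /andP[].
  by rewrite leNgt s0.
apply: measurable_funM => //; apply: measurable_funM.
  by apply: measurable_indic; exact: mstays.
exact: (norm_measurable_ip ipP sepH (mXt s) (mmm n s)).
Qed.

Let mM_shift n : norm_measurable setT (fun p : measurableTypeR R * Omega => M (p.1 + h n) p.2).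
Proof.
have jM := norm_measurable_process mMt rcM.
move=> y; pose sh (p : measurableTypeR R * Omega) : measurableTypeR R * Omega := ((p.1 + h n)%R, p.2).
apply: (measurableT_comp (jM y) (_ : measurable_fun setT sh)).
apply: measurable_fun_pair => /=; last exact: measurable_snd.
exact: (measurableT_comp (measurable_addr_cst (h n)) measurable_fst).
Qed.

Let mg_joint n : measurable_fun setT (fun p : measurableTypeR R * Omega => g n p.1 p.2).
Proof.
have jX := norm_measurable_process mXt rcX.
have jM := norm_measurable_process mMt rcM.
have jMh := mM_shift n.
apply: measurable_funM.
  apply: (measurableT_comp (f := \1_(`[0%R, T]%classic) : measurableTypeR R -> R)) => //.
apply: measurable_funM; last first.
  apply: (norm_measurable_ip ipP sepH jX).
  exact: norm_measurable_sub.
rewrite (_ : (fun p => _) = \1_[set p : measurableTypeR R * Omega | stays X K p.1 p.2]).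
  by apply: measurable_indic; exact: measurable_stays_joint.
by apply/funext => p; rewrite !indicE; congr (_%:R : R); congr nat_of_bool; apply/idP/idP; rewrite !inE.
Qed.

Let g_le n s w : (g n s w ^+ 2 <= K ^+ 2 * `|mm n s w| ^+ 2)%R.
Proof.
have r0 : (0 <= K ^+ 2 * `|mm n s w| ^+ 2)%R by rewrite mulr_ge0// sqr_ge0.
rewrite /g !indicE; case: (s \in _); last by rewrite mul0r expr0n.
case: (boolP (w \in _)) => [|_]; last by rewrite mul0r mulr0 expr0n.
rewrite inE => -[XK _]; rewrite !mul1r -exprMn -real_normK ?num_real// lerXn2r ?nnegrE ?mulr_ge0//.
by apply: (le_trans (ip_le ipP _ _)); rewrite ler_wpM2r.
Qed.

Let m2 n s : (0 <= s <= T)%R -> \int[Q]_w (`|mm n s w| ^+ 2)%:E <= (4 * h n * v)%:E.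
Proof.
move=> /andP[s0 sT]; have -> : h n = (s + h n - s)%R by ring.
apply: (increment_variance hF hN ipP sepH hnu1 nu_symmetric (fun t _ => mMt t) cM T1 eps0 eps1 s0 _ _ v0 hv).
- by rewrite lerDl ltW.
- exact: lerD.
Qed.

Let g2 n s : (0 <= s <= T)%R -> \int[Q]_w (g n s w ^+ 2)%:E <= (K ^+ 2 * (4 * h n * v))%:E.
Proof.
move=> sT; apply: (@le_trans _ _ (\int[Q]_w ((K ^+ 2)%:E * (`|mm n s w| ^+ 2)%:E))).
  by apply: ge0_integral_mono => w _; rewrite -?EFinM lee_fin ?sqr_ge0.
rewrite ge0_integralZl//; last 2 first.
- exact: measurable_sqr_norm.
- by rewrite lee_fin sqr_ge0.
by rewrite (EFinM (K ^+ 2)) lee_wpmul2l ?lee_fin ?sqr_ge0// m2.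
Qed.

Let g_out n s w : ~ (0 <= s <= T)%R -> g n s w = 0%R.
Proof. by move=> h'; rewrite /g indicE memNset ?mul0r//= in_itv. Qed.

Let g_orth n s t : (0 <= s)%R -> (s + h n <= t)%R -> (t <= T)%R ->
  \int[Q]_w (g n s w * g n t w)%:E = 0.
Proof.
move=> s0 st tT; have t0 : (0 <= t)%R by rewrite (le_trans _ st)// addr_ge0// ltW.
have st' : (s <= t)%R by rewrite (le_trans _ st)// lerDl ltW.
have hs : (0 <= s <= T)%R by rewrite s0 (le_trans st').
have ht : (0 <= t <= T)%R by rewrite t0.
(* Everything but the later increment is known at time [t], because [s + h n <= t]: this is the
   purpose of the gap [h n]. *)
pose f w : R := (g n s w * \1_(stays X K t) w)%R.
pose phi w := (f w *: X t w)%R.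
transitivity (\int[Q]_w (ip (phi w) (M (t + h n) w - M t w)%R)%:E).
  apply: eq_integral => w _; congr EFin; rewrite /phi (ipZl ipP) /f -(mulrA (g n s w)); congr (_ * _)%R.
  by rewrite /g {1}indicE mem_set ?mul1r//= in_itv.
have mf : measurable_fun setT f.
  by apply: measurable_funM => //; apply: measurable_indic; exact: mstays.
have mfF : measurable_fun setT (f : FT t -> R).
  apply: measurable_funM; last first.
    by apply: measurable_indic; exact: (measurable_stays hF K aX).
  apply: measurable_funM; first exact: measurable_cst.
  apply: measurable_funM.
    by apply: measurable_indic; exact: (measurable_stays hF K aX).
  apply: (norm_measurable_ip (T := FT t) ipP sepH (adapted_norm_measurable hF aX s0 st')).
  apply: (norm_measurable_sub (T := FT t) sepH).
    by apply: (adapted_norm_measurable hF aM _ st); rewrite addr_ge0// ltW.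
  exact: (adapted_norm_measurable hF aM s0 st').
have mphi : norm_measurable setT phi by exact: (norm_measurable_scalel ipP sepH mf (mXt t)).
apply: (increment_orthogonal ipP sepH nu_symmetric (fun r _ => mMt r) cM eps1 t0 _ _ mphi).
- by rewrite lerDl ltW.
- exact: lerD.
- move=> c A mA; apply: (filtration_measurable hF t0).
  have mfc : measurable_fun setT ((fun w => f w * ip (X t w) c)%R : FT t -> R).
    apply: measurable_funM => //.
    have mc : norm_measurable setT (fun _ : FT t => c) by exact: norm_measurable_cst.
    exact: (norm_measurable_ip (T := FT t) ipP sepH (adapted_norm_measurable hF aX t0 (lexx t)) mc).
  have := mfc measurableT A mA; rewrite setTI.
  by rewrite (_ : (fun w => ip (phi w) c) = (fun w => f w * ip (X t w) c)%R)//; apply/funext => w; exact: (ipZl ipP).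
- apply: (@le_lt_trans _ _ (\int[Q]_w ((K ^+ 2)%:E * (g n s w ^+ 2)%:E))).
    apply: ge0_integral_mono => w _; rewrite -?EFinM lee_fin ?sqr_ge0//.
    rewrite /phi normrZ /f exprMn real_normK ?num_real// indicE; case: (boolP (w \in _)) => [|_].
      rewrite inE => -[XK _]; rewrite mulr1 mulrC ler_wpM2r ?sqr_ge0//.
      by rewrite lerXn2r ?nnegrE.
    by rewrite mulr0 expr0n mul0r mulr_ge0// sqr_ge0.
  rewrite ge0_integralZl//; last 3 first.
  - by apply/measurable_EFinP; exact: measurable_funX.
  - by move=> w _; rewrite lee_fin sqr_ge0.
  - by rewrite lee_fin sqr_ge0.
  apply: (@le_lt_trans _ _ ((K ^+ 2)%:E * (K ^+ 2 * (4 * h n * v))%:E)); last by rewrite -EFinM ltry.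
  by rewrite lee_wpmul2l ?lee_fin ?sqr_ge0// g2.
- by apply: le_lt_trans (m2 n ht) _; rewrite ltry.
Qed.

Let I n w : R := fine (\int[mu]_s (g n s w)%:E).
Let V n w : \bar R := \int[mu]_(s in `[0%R, T]) (`|mm n s w| ^+ 2)%:E.

Let mI n : measurable_fun setT (I n).
Proof. exact: measurable_fine_integral (mg_joint n). Qed.

(** One factor [h n] comes from the band around the diagonal and one from the variance of an
    increment; together they offset the division by [h n] in mean square. *)
Let I2 n : \int[Q]_w (I n w ^+ 2)%:E <= (2 * h n * T * (K ^+ 2 * (4 * h n * v)))%:E.
Proof.
apply: (mean_square_time_integral0 T0 _ (h0 n) (mg_joint n)).
- by rewrite !mulr_ge0 ?sqr_ge0// ltW.
- exact: g_out.
- exact: g2.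
- exact: g_orth.
Qed.

Let mm2_joint n : measurable_fun setT
  (fun p : measurableTypeR R * Omega => (\1_(`[0%R, T]%classic) p.1 * `|mm n p.1 p.2| ^+ 2)%R%:E).
Proof.
have jM := norm_measurable_process mMt rcM.
have jMh := mM_shift n.
apply/measurable_EFinP; apply: measurable_funM.
  exact: (measurableT_comp (f := \1_(`[0%R, T]%classic) : measurableTypeR R -> R)).
by apply: measurable_funX; apply: norm_measurable_norm; exact: norm_measurable_sub.
Qed.

Let ind_mm0 n (p : measurableTypeR R * Omega) :
  0 <= (\1_(`[0%R, T]%classic) p.1 * `|mm n p.1 p.2| ^+ 2)%R%:E.
Proof. by rewrite lee_fin mulr_ge0// sqr_ge0. Qed.

Let VE n w : V n w = \int[mu]_s (\1_(`[0%R, T]%classic) s * `|mm n s w| ^+ 2)%R%:E.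
Proof.
rewrite /V integral_mkcond; apply: eq_integral => s _.
by rewrite patchE indicE; case: ifPn => _; rewrite ?mul1r ?mul0r.
Qed.

Let mV n : measurable_fun setT (V n).
Proof.
rewrite (_ : V n = (fun w => \int[mu]_s (\1_(`[0%R, T]%classic) s * `|mm n s w| ^+ 2)%R%:E)).
  exact: (@measurable_fun_fubini_tonelli_G _ _ _ _ _ mu _ (mm2_joint n) (ind_mm0 n)).
by apply/funext => w; exact: VE.
Qed.

Let V1 n : \int[Q]_w V n w <= (4 * h n * v * T)%:E.
Proof.
under eq_integral do rewrite VE.
rewrite -(@fubini_tonelli _ _ _ _ _ mu Q _ (mm2_joint n) (ind_mm0 n)).
apply: (@le_trans _ _ (\int[mu]_(s in `[0%R, T]) (4 * h n * v)%:E)).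
  rewrite [leRHS]integral_mkcond; apply: ge0_integral_mono => s _.
    by apply: integral_ge0 => w _; exact: (ind_mm0 n (s, w)).
  rewrite patchE; case: ifPn => sT.
    under eq_integral do rewrite indicE sT mul1r.
    by apply: m2; move: sT; rewrite inE/= in_itv.
  by rewrite integral0_eq// => w _; rewrite indicE (negbTE sT) mul0r.
have muT : mu `[0%R, T] = T%:E by rewrite lebesgue_measure_segment ?subr0// ltW.
by rewrite integral_cst//= [X in _ * X]muT -EFinM.
Qed.

(** Markov's inequality bounds the probability of failure under [Q] uniformly in [n]. The property
    [p] is left open so as to collect whatever holds almost surely under [P]. *)
Lemma good_path (p : Omega -> Prop) : {ae P, forall w, p w} ->
  exists w, [/\ N w (@big_strip R H (T + 1) eps) = 0, p w &
    forall n0, exists n, [/\ (n0 <= n)%N,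
      (n.+1%:R * fine (\int[mu]_s (g n s w)%:E) <= 2^-1)%R &
      n.+1%:R%:E * \int[mu]_(s in `[0%R, T]) (`|M (s + n.+1%:R^-1)%R w - M s w|%R ^+ 2)%:E <= 1]].
Proof.
move=> hp.
pose E n := [set w | (n.+1%:R * I n w <= 2^-1)%R] `&` [set w | n.+1%:R%:E * V n w <= 1].
have V0 n w : 0 <= V n w by apply: integral_ge0 => s _; rewrite lee_fin sqr_ge0.
have mE n : measurable (E n).
  apply: measurableI.
    rewrite (_ : [set w | _] = (fun w => n.+1%:R * I n w)%R @^-1` `]-oo, 2^-1%R]).
      rewrite -[X in measurable X]setTI.
      by apply: (measurable_funM (measurable_cst _) (mI n)) => //; exact: measurable_itv.
    by apply/seteqP; split => w /=; rewrite in_itv.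
  rewrite -[X in measurable X]setTI.
  by apply: emeasurable_fun_infty_c => //; exact: measurable_funeM.
have nh n : (n.+1%:R * h n = 1 :> R)%R by rewrite mulfV.
have halfE n : 2^-1%:E <= Q (E n).
  (* The threshold 1/4 is the square of [2^-1], so Markov gives [Q B1 <= 32 * T * K^2 * v]; with
     [Q B2 <= 4 * T * v] the sum is what [v_small] bounds by 1/2. *)
  pose B1 := [set w | (4^-1)%R%:E <= ((n.+1%:R * I n w) ^+ 2)%R%:E].
  pose B2 := [set w | 1%R%:E <= n.+1%:R%:E * V n w].
  have mB1f : measurable_fun setT (fun w => ((n.+1%:R * I n w) ^+ 2)%R%:E).
    by apply/measurable_EFinP; apply: measurable_funX; exact: measurable_funM.
  have mB2f : measurable_fun setT (fun w => n.+1%:R%:E * V n w) by exact: measurable_funeM.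
  have mB1 : measurable B1 by rewrite -[X in measurable X]setTI; exact: emeasurable_fun_c_infty.
  have mB2 : measurable B2 by rewrite -[X in measurable X]setTI; exact: emeasurable_fun_c_infty.
  have b1 : (4^-1)%R%:E * Q B1 <= (8 * T * K ^+ 2 * v)%:E.
    apply: le_trans (markov_ge0 Q _ mB1f _) _ => //.
      by move=> w; rewrite lee_fin sqr_ge0.
    apply: (@le_trans _ _ ((n.+1%:R ^+ 2)%R%:E * (2 * h n * T * (K ^+ 2 * (4 * h n * v)))%:E)).
      rewrite [leLHS](_ : _ = (n.+1%:R ^+ 2)%R%:E * \int[Q]_w (I n w ^+ 2)%:E).
        by rewrite lee_wpmul2l// lee_fin sqr_ge0.
      rewrite -ge0_integralZl//; last 2 first.
      - by apply/measurable_EFinP; exact: measurable_funX.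
      - by move=> w _; rewrite lee_fin sqr_ge0.
      by apply: eq_integral => w _; rewrite exprMn EFinM.
    rewrite -EFinM lee_fin.
    rewrite [leLHS](_ : _ = (n.+1%:R * h n) ^+ 2 * (8 * T * K ^+ 2 * v))%R; last by ring.
    by rewrite nh expr1n mul1r.
  have b2 : Q B2 <= (4 * T * v)%:E.
    have := markov_ge0 Q ltr01 mB2f (fun w => mule_ge0 (_ : 0 <= n.+1%:R%:E) (V0 n w)).
    rewrite mul1e => /(_ _)/le_trans; apply; first by rewrite lee_fin.
    rewrite ge0_integralZl ?lee_fin//.
    apply: (@le_trans _ _ (n.+1%:R%:E * (4 * h n * v * T)%:E)).
      by rewrite lee_wpmul2l// lee_fin.
    rewrite -EFinM lee_fin.
    rewrite [leLHS](_ : _ = (n.+1%:R * h n) * (4 * T * v))%R; last by ring.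
    by rewrite nh mul1r.
  have cE : ~` E n `<=` B1 `|` B2.
    move=> w /= /not_andP[/negP|/negP]; rewrite -ltNge => h'.
      left; rewrite /B1/= lee_fin; set y := (_ * _)%R in h' *.
      by rewrite (_ : 4^-1 = 2^-1 ^+ 2)%R ?lerXn2r ?nnegrE ?(ltW h')// ?(le_trans _ (ltW h'))//; field.
    by right; rewrite /B2/= ltW.
  have QC : Q (~` E n) <= 2^-1%R%:E.
    apply: (@le_trans _ _ (Q B1 + Q B2)).
      apply: (@le_trans _ _ (Q (B1 `|` B2))).
        by apply: le_measure; rewrite ?inE//; [exact: measurableC|exact: measurableU].
      exact: measureU2.
    have f1 : Q B1 \is a fin_num by exact: fin_num_measure.
    have f2 : Q B2 \is a fin_num by exact: fin_num_measure.
    move: b1 b2; rewrite -(fineK f1) -(fineK f2) -EFinM -EFinD !lee_fin => b1 b2.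
    move: v_small; lra.
  have := probability_setC Q (mE n).
  move: QC; have f1 : Q (E n) \is a fin_num by exact: fin_num_measure.
  move=> + e; rewrite e -(fineK f1) -EFinB !lee_fin; lra.
have := conditional_ae (measurable_void_event hF hN T1 (big_strip_adm hnu1 T1 eps0))
    (void_gt0 hN (big_strip_adm hnu1 T1 eps0)) hp.
move=> /(frequently_of_half mE halfE)[w [[Nw pw] fw]].
exists w; split => // n0; have [n n0n [e1 e2]] := fw n0.
by exists n; split.
Qed.

End good_path.

(** * Exit time and contradiction *)

Section exit_time.
Context (R : realType) (H : normedModType R) (X : R -> H) (T K : R).
Hypotheses (T0 : 0 < T) (rcX : forall t, X s @[s --> t^'+] --> X t) (X0 : `|X 0| < K).

Lemma right_near_le t c : `|X t| < c ->
  exists2 e, 0 < e & forall s, t <= s -> s <= t + e -> `|X s| <= c.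
Proof.
move=> tc.
have ct : 0 < c - `|X t| by rewrite subr_gt0.
have /cvgrPdist_lt/(_ _ ct) := @rcX t.
move=> /nbhs_ballP[e /= e0 he]; exists (e / 2); first by rewrite divr_gt0.
move=> s; rewrite le_eqVlt => /orP[/eqP <- _|ts se]; first exact: ltW.
have : `|X t - X s| < c - `|X t|.
  apply: he => //; rewrite /ball/= distrC gtr0_norm ?subr_gt0//.
  by rewrite ltrBlDl (le_lt_trans se)// ltrD2l gtr_pMr// invf_lt1// ltr1n.
rewrite ltrBrDl => h; apply/ltW/le_lt_trans/h.
by rewrite -{1}(subKr (X t) (X s)) ler_normB.
Qed.

(** The supremum of the times up to which the path stays in the ball. A jump may carry the path out
    at [tau] itself, so the bound [K] is claimed only before [tau]. *)
Lemma exit_time : exists tau, [/\ 0 < tau <= T, (forall s, 0 <= s -> s < tau -> `|X s| <= K),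
  (forall s, tau < s -> s <= T -> exists2 u, 0 <= u <= s & K < `|X u|) &
  (tau < T -> K <= `|X tau|)].
Proof.
pose S := [set t | 0 <= t <= T /\ forall s, 0 <= s <= t -> `|X s| <= K].
have S0 : S 0.
  split; first by rewrite lexx ltW.
  by move=> s; rewrite -eq_le => /eqP <-; exact: ltW.
have ubS : ubound S T by move=> t [/andP[]].
have hS : has_sup S by split; [exists 0|exists T].
have St : S `<=` [set t | t <= sup S] by move=> t; exact: (ub_le_sup (proj2 hS)).
have supT : sup S <= T by apply: ge_sup => //; exists 0.
have below s : 0 <= s -> s < sup S -> `|X s| <= K.
  move=> s0 ss; have ss' : 0 < sup S - s by rewrite subr_gt0.
  have [t [_ ht] st] := sup_adherent ss' hS.
  by apply: ht; rewrite s0 ltW// -(subKr (sup S) s).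
(* A path strictly inside the ball at [t] stays inside a little longer. This gives both [0 < tau]
   and the bound at the exit. *)
have ext t : 0 <= t -> t < T -> (forall s, 0 <= s < t -> `|X s| <= K) -> `|X t| < K -> t < sup S.
  move=> t0 tT ht Xt; have [e e0 he] := right_near_le Xt.
  pose t' := Num.min T (t + e).
  apply: (@lt_le_trans _ _ t'); first by rewrite lt_min tT ltrDl.
  apply: St; split.
    by rewrite ge_min lexx le_min (ltW T0)/= addr_ge0// ltW.
  move=> s /andP[s0 st]; have [ts|ts] := lerP t s; last by apply: ht; rewrite s0.
  by apply: he => //; rewrite (le_trans st)// ge_min lexx orbT.
exists (sup S); split => //.
- rewrite supT andbT; apply: ext => // s /andP[s0 s1].
  by have := le_lt_trans s0 s1; rewrite ltxx.
- move=> s ss sT; have s0 : 0 <= s by rewrite (le_trans _ (ltW ss))//; exact: St.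
  have nS : ~ S s by move=> /St/=; rewrite leNgt ss.
  apply: contrapT => h; apply: nS; split; first by rewrite s0.
  move=> u us; rewrite leNgt; apply/negP => Xu; apply: h; exists u => //.
- move=> tT; rewrite leNgt; apply/negP => Xt.
  have : sup S < sup S.
    apply: ext => //; first exact: St.
    by move=> s /andP[]; exact: below.
  by rewrite ltxx.
Qed.

End exit_time.

(** * Growth, coercivity and dissipation on balls of H *)

Section work_bounds.
Context (R : realType) (V H : completeNormedModType R) (W : normedModType R)
  (G : gelfand_triple V H W) (A : V -> W).
Variables alpha beta theta C Ct varpi F0 : R.
Hypotheses (halpha : 1 < alpha) (hbeta : 0 <= beta) (htheta : 0 < theta)
  (hC : 0 < C) (hCt : 0 < Ct) (hF0 : 0 < F0).
Hypothesis coercivity : forall v : V,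
  2 * pairing G (A v) v + theta * `|v| `^ alpha <= F0 + C * `|embV G v| ^+ 2.
Hypothesis growth : forall v : V,
  `|A v| `^ (alpha / (alpha - 1)) <= (F0 + C * `|v| `^ alpha) * (1 + `|embV G v| `^ beta).
Hypothesis dissipation : forall v : V,
  2 * pairing G (A v) v + Ct * `|embV G v| `^ varpi <= 0.

Lemma pairing_le0 v : pairing G (A v) v <= 0.
Proof.
have := dissipation v; have : 0 <= Ct * `|embV G v| `^ varpi by rewrite mulr_ge0 ?powR_ge0// ltW.
lra.
Qed.

(** Young's inequality with the conjugate exponents [alpha / (alpha - 1)] and [alpha]; its factors
    below 1 are dropped. *)
Lemma pairing_young (f : W) (u : V) :
  `|pairing G f u| <= `|f| `^ (alpha / (alpha - 1)) + `|u| `^ alpha.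
Proof.
have a0 : 0 < alpha by rewrite (lt_trans ltr01).
have a1 : 0 < alpha - 1 by rewrite subr_gt0.
apply: (le_trans (dual_norm_ub (pairingP G) f u)).
have ap : 0 < alpha / (alpha - 1) by rewrite divr_gt0.
have e1 : (alpha / (alpha - 1))^-1 + alpha^-1 = 1 by field; rewrite !gt_eqF.
apply: (le_trans (conjugate_powR (normr_ge0 f) (normr_ge0 u) ap a0 e1)).
apply: lerD; rewrite ler_pdivrMr// ler_peMr ?powR_ge0//; last exact: ltW.
by rewrite ler_pdivlMr// mul1r gerBl.
Qed.

(** On a ball of [H] coercivity bounds [|v|^alpha] by a multiple of [1 - pairing G (A v) v], and
    growth then bounds the dual norm of [A v] likewise; Young's inequality combines the two at
    different points. *)
Lemma work_bounds K : 0 <= K -> exists c, [/\ 0 < c,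
  (forall v, `|embV G v| <= K -> - pairing G (A v) v <= c * (1 + `|v| `^ alpha)) &
  (forall v u, `|embV G v| <= K -> `|embV G u| <= K ->
     pairing G (A v) u <= c * (1 - pairing G (A v) v) + c * (1 - pairing G (A u) u))].
Proof.
move=> K0; pose B := 1 + K `^ beta; pose E0 := F0 + C * K ^+ 2.
have B0 : 1 <= B by rewrite lerDl powR_ge0.
have E00 : 0 < E0 by rewrite ltr_wpDr// mulr_ge0 ?sqr_ge0// ltW.
have growthK v : `|embV G v| <= K -> `|A v| `^ (alpha / (alpha - 1)) <= (F0 + C * `|v| `^ alpha) * B.
  move=> vK; apply: (le_trans (growth v)); rewrite ler_wpM2l//.
    by rewrite addr_ge0 ?mulr_ge0 ?powR_ge0// ltW.
  by rewrite lerD2l ge0_ler_powR// ?nnegrE.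
have coerK v : `|embV G v| <= K -> `|v| `^ alpha <= (E0 + 2 * - pairing G (A v) v) / theta.
  move=> vK; rewrite ler_pdivlMr// mulrC.
  have : C * `|embV G v| ^+ 2 <= C * K ^+ 2 by rewrite ler_pM2l// lerXn2r ?nnegrE.
  have := coercivity v; rewrite /E0; lra.
pose D := (E0 + 2) / theta.
have D0 : 0 < D by rewrite divr_gt0// addr_gt0.
have coerD v : `|embV G v| <= K -> `|v| `^ alpha <= D * (1 - pairing G (A v) v).
  move=> vK; apply: (le_trans (coerK v vK)).
  rewrite /D mulrAC ler_pM2r ?invr_gt0//; have := pairing_le0 v; nra.
(* One constant for both bounds: it dominates the coefficients [F0 * B] and [C * B + 1] of the
   first, and [F0 * B + C * B * D] and [D] of the second. *)
pose c := F0 * B + C * B + 1 + (C * B + 1) * D.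
have FB0 : 0 < F0 * B by rewrite mulr_gt0// (lt_le_trans ltr01).
have CB0 : 0 < C * B by rewrite mulr_gt0// (lt_le_trans ltr01).
have CBD0 : 0 < (C * B + 1) * D by rewrite mulr_gt0// addr_gt0.
exists c; split; first by rewrite /c !addr_gt0.
- move=> v vK; apply: (le_trans (ler_norm _)); rewrite normrN.
  apply: (le_trans (pairing_young _ _)).
  have := growthK v vK; have := powR_ge0 `|v| alpha.
  set n := `|v| `^ alpha; set q := `|A v| `^ _ => n0 hq.
  have : 0 <= ((C * B + 1) * D + F0 * B) * n by rewrite mulr_ge0// ltW// addr_gt0.
  rewrite /c; nra.
- move=> v u vK uK; apply: (le_trans (ler_norm _)).
  apply: (le_trans (pairing_young _ _)).
  have := growthK v vK; have := coerD v vK; have := coerD u uK.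
  have := pairing_le0 v; have := pairing_le0 u.
  set p := pairing G (A v) v; set p' := pairing G (A u) u.
  set n := `|v| `^ alpha; set n' := `|u| `^ alpha; set q := `|A v| `^ _ => p'0 p0 hn' hn hq.
  have h1 : C * B * n <= C * B * (D * (1 - p)) by rewrite ler_pM2l.
  have h2 : 0 <= (F0 * B + C * B + 1 + D) * (1 - p).
    by rewrite mulr_ge0 ?subr_ge0 ?(le_trans p0)// ltW// !addr_gt0.
  have h3 : 0 <= (C * B + 1 + C * B * D) * (1 - p').
    by rewrite mulr_ge0 ?subr_ge0 ?(le_trans p'0)// ltW// !addr_gt0// mulr_gt0.
  have h4 : 0 <= F0 * B * - p' by rewrite mulr_ge0 ?oppr_ge0// ltW.
  rewrite /c; nra.
Qed.

End work_bounds.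

Section null_bochner.
Context (R : realType) (d : measure_display) (T : measurableType d) (E : normedModType R).

Lemma bochner_null (mu : {measure set T -> \bar R}) D (f : T -> E) y : measurable D ->
  mu D = 0%E -> is_bochner mu D f y -> y = 0.
Proof.
move=> mD D0 [s [ms _ _ sy]].
apply: (@cvg_unique _ _ _ _ _ _ sy); first exact: norm_hausdorff.
rewrite (_ : (fun n => _) = fun=> 0); first exact: cvg_cst.
apply/funext => n; rewrite /step_integral big1// => i _.
have [mi iD _] := ms n i.
rewrite (_ : mu (step_set i) = 0%E) ?scale0r//.
by apply/eqP; rewrite -measure_le0 -D0; apply: le_measure; rewrite ?inE.
Qed.

End null_bochner.

(** * The contradiction along one path *)

Section path.
Context (R : realType) (V H : completeNormedModType R) (W : normedModType R)
  (G : gelfand_triple V H W) (A : V -> W).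
Variables alpha beta theta C Ct varpi F0 : R.
Hypotheses (halpha : 1 < alpha) (hbeta : 0 <= beta) (htheta : 0 < theta)
  (hC : 0 < C) (hCt : 0 < Ct) (hvarpi : 0 < varpi) (hF0 : 0 < F0).
Hypothesis coercivity : forall v : V,
  2 * pairing G (A v) v + theta * `|v| `^ alpha <= F0 + C * `|embV G v| ^+ 2.
Hypothesis growth : forall v : V,
  `|A v| `^ (alpha / (alpha - 1)) <= (F0 + C * `|v| `^ alpha) * (1 + `|embV G v| `^ beta).
Hypothesis dissipation : forall v : V,
  2 * pairing G (A v) v + Ct * `|embV G v| `^ varpi <= 0.
Local Notation mu := (@lebesgue_measure R).

Context (d : measure_display) (Omega : measurableType d).
Variables (X M : R -> Omega -> H) (w : Omega) (x : H) (T K r : R).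
Hypothesis mX : norm_measurable setT (fun s : measurableTypeR R => X s w).
Hypothesis mM : norm_measurable setT (fun s : measurableTypeR R => M s w).
Hypothesis rcX : forall t : R, X s w @[s --> t^'+] --> X t w.
Hypothesis X0 : X 0 w = x.
Hypothesis eqX : forall t, 0 <= t -> t <= T + 1 -> exists I : W,
  is_bochner mu `[0, t] (fun s : R => A (toV G (X s w))) I /\
  embH G (X t w) = embH G x + I + embH G (M t w).
Hypothesis iA : (\int[mu]_(s in `[0%R, (T + 1)%R]) (`|A (toV G (X s w))|)%:E < +oo)%E.
Hypothesis rangeX : {ae mu, forall s : R, 0 <= s <= T + 1 -> range (embV G) (X s w)}.
Hypothesis iN : (\int[mu]_(s in `[0%R, (T + 1)%R]) (`|toV G (X s w)| `^ alpha)%:E < +oo)%E.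
Hypothesis far : {ae mu, forall s : R, 0 <= s -> r <= `|X s w|}.
Hypotheses (T0 : 0 < T) (r0 : 0 < r) (xK : `|x| < K) (hK : `|x| ^+ 2 + 2 < K ^+ 2)
  (hT : `|x| ^+ 2 + 2 < Ct * r `^ varpi * T).
Hypothesis freq : forall n0, exists n, [/\ (n0 <= n)%N,
  n.+1%:R * fine (\int[mu]_s (stopped_work (inner G) X M T K n s w)%:E)%E <= 2^-1 &
  (n.+1%:R%:E * \int[mu]_(s in `[0%R, T]) (`|M (s + n.+1%:R^-1)%R w - M s w|%R ^+ 2)%:E <= 1)%E].

Let ipP := innerP G.
Let sepH : separable_space H. Proof. exact: separableH G. Qed.

Lemma embV_toV h : range (embV G) h -> embV G (toV G h) = h.
Proof. by move=> [v _ vh]; exact: (@xgetPex _ 0 [set v0 : V | embV G v0 = h] (ex_intro _ v vh)). Qed.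

Let K0 : 0 <= K. Proof. by rewrite ltW// (le_lt_trans _ xK). Qed.

(** The indicators of [stays] and of [[0, tau]] agree except perhaps at [s = tau], where a jump may
    occur; one point does not affect the integral. *)
Lemma stopped_work_integral tau n : 0 < tau -> tau <= T ->
  (forall s, 0 <= s -> s < tau -> `|X s w| <= K) ->
  (forall s, tau < s -> s <= T -> exists2 u, 0 <= u <= s & K < `|X u w|) ->
  fine (\int[mu]_s (stopped_work (inner G) X M T K n s w)%:E)%E =
  \int[mu]_(s in `[0, tau]) inner G (X s w) (M (s + n.+1%:R^-1) w - M s w).
Proof.
move=> tau0 tauT below above.
pose g (s : measurableTypeR R) := stopped_work (inner G) X M T K n s w.
pose f (s : measurableTypeR R) := inner G (X s w) (M (s + n.+1%:R^-1) w - M s w).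
pose k (s : measurableTypeR R) : R := \1_(`[0, tau]%classic) s * f s.
have mf : measurable_fun setT f.
  apply: norm_measurable_ip => //; apply: norm_measurable_sub => // y.
  exact: (measurableT_comp (mM y) (measurable_addr_cst n.+1%:R^-1)).
have mk : measurable_fun setT k.
  by apply: measurable_funM => //; apply: measurable_indic; exact: measurable_itv.
have gk s : s != tau -> g s = k s.
  move=> st; rewrite /g /k /stopped_work -/(f s) !indicE.
  case: (boolP (s \in `[0, T]%classic)) => [|sT]; last first.
    rewrite mul0r memNset ?mul0r// => /=; rewrite in_itv/= => /andP[s0 s1].
    by move: sT; rewrite notin_setE/= in_itv/= s0 (le_trans s1).
  rewrite inE/= in_itv/= => /andP[s0 sT]; rewrite mul1r; congr (_%:R * _); congr nat_of_bool.
  have [stau|taus|/eqP] := ltgtP s tau; last by rewrite (negbTE st).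
    rewrite !mem_set//=; first by rewrite in_itv/= s0 ltW.
    split; first exact: below.
    by move=> q /andP[q0 qs]; apply: below => //; exact: lt_trans stau.
  rewrite !memNset//=; first by rewrite in_itv/= s0 leNgt taus.
  move=> [Xs hq]; have [u /andP[u0 us] Ku] := above s taus sT.
  move: us; rewrite le_eqVlt => /orP[/eqP us|us]; first by move: Ku; rewrite us ltNge Xs.
  (* By right continuity the excess over [K] at [u] persists just after [u], hence at a rational
     time before [s], which contradicts membership in [stays]. *)
  have Ku' : 0 < `|X u w| - K by rewrite subr_gt0.
  have /cvgrPdist_lt/(_ _ Ku') := @rcX u.
  move=> /nbhs_ballP[e /= e0 he].
  have ub : u < Num.min s (u + e) by rewrite lt_min us ltrDl.
  have [q /=] := rat_in_itvoo ub; rewrite in_itv/= => /andP[uq].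
  rewrite lt_min => /andP[qs qe].
  have hX : `|X u w - X (ratr q) w| < `|X u w| - K.
    by apply: he => //; rewrite /ball/= distrC gtr0_norm ?subr_gt0// ltrBlDl.
  have := hq q; rewrite qs (le_trans u0 (ltW uq)) => /(_ isT).
  have := lerB_dist (X u w) (X (ratr q) w); move: hX; lra.
have gE : g = (fun s => k s + (g tau - k tau) * \1_[set tau] s).
  apply/funext => s; rewrite indicE; have [->|st] := eqVneq s tau.
    by rewrite mem_set// mulr1; ring.
  by rewrite memNset ?mulr0 ?addr0 ?gk// => /= h; move: st; rewrite h eqxx.
have mg : measurable_fun setT g.
  by rewrite gE; apply: measurable_funD => //; apply: measurable_funM.
rewrite /Rintegral; congr fine; rewrite [RHS]integral_mkcond.
transitivity (\int[mu]_s (k s)%:E)%E; last first.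
  apply: eq_integral => s _; rewrite patchE /k indicE.
  by case: ifPn => _; rewrite ?mul1r ?mul0r.
apply: ae_eq_integral => //; try exact/measurable_EFinP.
exists [set tau]; split; first exact: measurable_set1.
  exact: lebesgue_measure_set1.
move=> s /= hs; apply/eqP/negP => /negP st; apply: hs => _.
by rewrite -/(g s) gk.
Qed.

Let pairingD f g u : pairing G (f + g) u = pairing G f u + pairing G g u.
Proof. by have := dual_linear (pairingP G) 1 f g u; rewrite scale1r mul1r. Qed.

Lemma path_contradiction : False.
Proof.
have X0K : `|X 0 w| < K by rewrite X0.
have [tau [/andP[tau0 tauT] below above exit]] := exit_time T0 rcX X0K.
have tau1 : `|X tau w| < `|X tau w| + 1 by rewrite ltrDl.
have [e e0 he] := right_near_le rcX tau1.
(* The windows reach beyond [tau], so a bound is needed up to [tau + delta]; [K'] absorbs a jump at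
   [tau], and [delta <= 1] keeps all times within [T + 1]. *)
pose delta := Num.min e 1; pose K' := Num.max K (`|X tau w| + 1).
have delta0 : 0 < delta by rewrite lt_min e0 ltr01.
have bT : tau + delta <= T + 1 by rewrite lerD// ge_min lexx orbT.
have K'0 : 0 <= K' by rewrite le_max K0.
have XK' t : 0 <= t <= tau + delta -> `|X t w| <= K'.
  move=> /andP[t0 tb]; rewrite le_max; have [tt|tt] := ltP t tau.
    by rewrite below.
  by rewrite (he t tt) ?orbT// (le_trans tb)// lerD2l ge_min lexx.
have [c [c0 c1 c2]] := work_bounds halpha hbeta htheta hC hCt hF0 coercivity growth dissipation K'0.
have T10 : 0 <= T + 1 by rewrite addr_ge0// ltW.
have [I1 [bI1 _]] := eqX T10 (lexx _).
have mseg (s : R) : measurable (`[0, s]%classic : set (measurableTypeR R)) by exact: measurable_itv.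
have [a [sma [N0 [mN0 N00 aE a0]]]] := bochner_strongly_measurable (mseg _) bI1.
have ia : (\int[mu]_s `|a s|%:E < +oo)%E.
  apply: le_lt_trans iA; rewrite [leRHS]integral_mkcond; apply: ge0_integral_mono => s _.
    by rewrite lee_fin.
  rewrite patchE; case: ifPn => [|sT]; last first.
    by rewrite a0 ?normr0// => -[sD _]; rewrite notin_setE in sT.
  rewrite inE => sD; have [Ns|Ns] := pselect (N0 s); last by rewrite aE.
  by rewrite a0 ?normr0 ?lee_fin// => -[].
have stepI t u : 0 <= t -> t <= T + 1 ->
    mu.-integrable `[0, t] (EFin \o (fun s : R => pairing G (a s) u)) /\
    \int[mu]_(s in `[0, t]) pairing G (a s) u = inner G (X t w - x - M t w) (embV G u).
  move=> t0 tT; have [I [bI eI]] := eqX t0 tT.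
  have aeE : {ae mu, forall s : measurableTypeR R, `[0, t]%classic s -> a s = A (toV G (X s w))}.
    exists N0; split => // s /= hs; apply: contrapT => Ns; apply: hs => st.
    by apply: aE => //=; move: st; rewrite /= !in_itv/= => /andP[-> st]; rewrite (le_trans st).
  have lin (k : R) (f g : W) : pairing G (k *: f + g) u = k * pairing G f u + pairing G g u.
    exact: dual_linear (pairingP G) k f g u.
  have bd (f : W) : `|pairing G f u| <= `|u| * `|f|.
    by rewrite mulrC; exact: dual_norm_ub (pairingP G) f u.
  have [i1 i2] := bochner_functional (mseg _) bI sma aeE lin bd (normr_ge0 u).
  split; first exact: i1.
  rewrite /Rintegral i2 /=.
  have := congr1 (fun f => pairing G f u) eI; rewrite !pairingD !embHE.
  rewrite !(ipBl ipP); lra.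
have Xeq s t u : 0 <= s -> s <= t -> t <= tau + delta ->
    inner G (X t w - X s w - (M t w - M s w)) (embV G u) = \int[mu]_(q in `[s, t]) pairing G (a q) u.
  move=> s0 st tb; have t0 := le_trans s0 st; have tT := le_trans tb bT.
  have [it et] := stepI t u t0 tT; have [is_ es] := stepI s u s0 (le_trans st tT).
  have ist : mu.-integrable `]s, t] (EFin \o (fun q : R => pairing G (a q) u)).
    have mst : measurable (`]s, t]%classic : set (measurableTypeR R)) by exact: measurable_itv.
    apply: (integrableS (mseg t) mst _ it).
    by move=> q /=; rewrite !in_itv/= => /andP[sq ->]; rewrite (le_trans s0 (ltW sq)).
  rewrite -(Rintegral_itv_obnd_cbnd ist).
  rewrite -(Rintegral_itvB (f := fun q => pairing G (a q) u) (a := BLeft 0) (b := BRight t) (x := s) it) ?bnd_simp//.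
  rewrite et es -(ipBl ipP); congr (inner G _ _).
  rewrite !opprD !opprK !addrA [RHS]((@GRing.add H).[ACl 1*4*3*6*(2*5)]).
  by rewrite addNr addr0.
have [N1 [mN1 N10 hN1]] : exists N1 : set R, [/\ measurable (N1 : set (measurableTypeR R)), mu N1 = 0%E &
    forall t, 0 <= t <= T + 1 -> ~ N1 t ->
    [/\ range (embV G) (X t w), r <= `|X t w| & a t = A (toV G (X t w))]].
  have [Na [mNa Na0 hNa]] := rangeX; have [Nb [mNb Nb0 hNb]] := far.
  exists (Na `|` Nb `|` N0); split.
  - by apply: measurableU => //; exact: measurableU.
  - by rewrite !measureU0//; exact: measurableU.
  - move=> t tb /not_orP[/not_orP[nNa nNb] nN0]; split.
    + by apply: contrapT => h; apply: nNa; apply: hNa => /= /(_ tb).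
    + by apply/negP => /negP h; apply: nNb; apply: hNb => /= /(_ (proj1 (andP tb))) h'; move/negP: h.
    + by apply: aE => //=; rewrite in_itv.
pose v t := toV G (X t w); pose Nf t := `|v t| `^ alpha.
(* The dissipation condition bounds twice the pairing, whence the division by 2. *)
pose kappa := Ct * r `^ varpi / 2.
have kappa0 : 0 <= kappa by rewrite /kappa !mulr_ge0 ?powR_ge0// ltW.
have inT t : 0 <= t <= tau + delta -> 0 <= t <= T + 1.
  by move=> /andP[-> tb]; rewrite (le_trans tb).
have vK t : 0 <= t <= tau + delta -> ~ N1 t -> `|embV G (v t)| <= K'.
  by move=> tb Nt; have [rt _ _] := hN1 t (inT t tb) Nt; rewrite embV_toV// XK'.
have := @energy_inequality R V H W G (X ^~ w) (M ^~ w) a v Nf tau delta K' c kappa N1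
  tau0 delta0 c0 kappa0 mX mM XK' (@rcX 0) (@rcX tau) sma ia Xeq mN1 N10.
have good t : 0 <= t <= tau + delta -> ~ N1 t ->
    [/\ X t w = embV G (v t), pairing G (a t) (v t) <= - kappa & - pairing G (a t) (v t) <= c * (1 + Nf t)].
  move=> tb Nt; have [rt frt ->] := hN1 t (inT t tb) Nt; split.
  - by rewrite embV_toV.
  - have := dissipation (v t); rewrite embV_toV//.
    have : Ct * r `^ varpi <= Ct * `|X t w| `^ varpi.
      by rewrite ler_pM2l// ge0_ler_powR ?nnegrE// ltW.
    rewrite /kappa; lra.
  - by apply: c1; exact: vK.
have cross q t : 0 <= q <= tau + delta -> ~ N1 q -> 0 <= t <= tau + delta -> ~ N1 t ->
    pairing G (a q) (v t) <= c * (1 - pairing G (a q) (v q)) + c * (1 - pairing G (a t) (v t)).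
  move=> qb Nq tb Nt; have [_ _ ->] := hN1 q (inT q qb) Nq; have [_ _ ->] := hN1 t (inT t tb) Nt.
  by apply: c2; exact: vK.
have Nf0 t : 0 <= Nf t by exact: powR_ge0.
have iNf : (\int[mu]_(t in `[0%R, (tau + delta)%R]) (Nf t)%:E < +oo)%E.
  apply: le_lt_trans iN; rewrite [leLHS]integral_mkcond [leRHS]integral_mkcond.
  apply: ge0_integral_mono => t _; first by rewrite patchE; case: ifP => // _; rewrite lee_fin.
  rewrite !patchE; case: ifPn => [|_]; last by case: ifP => // _; rewrite lee_fin powR_ge0.
  by rewrite inE/= in_itv/= => /inT tb; rewrite mem_set//= in_itv.
have frq n0 : exists n, [/\ (n0 <= n)%N,
    n.+1%:R * (\int[mu]_(s in `[0, tau]) inner G (X s w) (M (s + n.+1%:R^-1) w - M s w)) <= 2^-1 &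
    (n.+1%:R%:E * \int[mu]_(s in `[0%R, tau]) (`|M (s + n.+1%:R^-1)%R w - M s w|%R ^+ 2)%:E <= 1)%E].
  have [n [n0n f1 f2]] := freq n0; exists n; split => //.
    by rewrite -(stopped_work_integral n tau0 tauT below above).
  apply: le_trans f2; apply: lee_wpmul2l; first by rewrite lee_fin.
  apply: ge0_subset_integral; [exact: measurable_itv|exact: measurable_itv| |by move=> s _; rewrite lee_fin sqr_ge0|].
    apply: measurable_funTS; apply/measurable_EFinP; apply: measurable_funX; apply: norm_measurable_norm.
    apply: norm_measurable_sub => // y.
    exact: (measurableT_comp (mM y) (measurable_addr_cst n.+1%:R^-1)).
  by move=> s /=; rewrite !in_itv/= => /andP[-> st]; rewrite (le_trans st).
move=> /(_ good cross Nf0 iNf frq); rewrite X0 /kappa => en.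
(* If [tau = T] the energy inequality makes a square negative, by [hT]; if [tau < T] the square at
   the exit is at least [K^2], against [hK]. *)
move: tauT; rewrite le_eqVlt => /orP[/eqP tT|tT].
  have := sqr_ge0 `|X tau w|; move: en hT; rewrite tT; nra.
have : K ^+ 2 <= `|X tau w| ^+ 2 by rewrite lerXn2r ?nnegrE// exit.
have : 0 <= Ct * r `^ varpi * tau by rewrite !mulr_ge0 ?powR_ge0// ltW.
move: en hK; lra.
Qed.

End path.

(** * Modification on a null set *)

Section modification.
Context (R : realType) (H : completeNormedModType R) (d : measure_display)
  (Omega : measurableType d) (P : probability Omega R)
  (F : R -> set (set Omega)) (hF : usual_conditions P F).
Variable Z : set Omega.
Hypotheses (mZ : measurable Z) (Z0 : P Z = 0%E).
Local Notation FT t := (g_sigma_algebraType (F t)).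

(** Zero at negative times and on the null set, so that every path is right-continuous on the whole
    line; completeness of [F 0] keeps the process adapted. *)
Definition cutoff (Y : R -> Omega -> H) (t : R) (w : Omega) : H :=
  if (0 <= t) && (w \notin Z) then Y t w else 0.

Lemma cutoffE Y t w : 0 <= t -> ~ Z w -> cutoff Y t w = Y t w.
Proof. by move=> t0 nZ; rewrite /cutoff t0 memNset. Qed.

Lemma cutoff_adapted Y : adapted F Y -> adapted F (cutoff Y).
Proof.
move=> aY t t0 B mB; apply: (filtration_measurable hF t0).
have FZ : measurable (Z : set (FT t)).
  apply: sub_sigma_algebra; apply: (filt_mono hF (lexx 0) t0); apply: (filt_complete hF).
  by exists Z; split.
have FY : measurable (Y t @^-1` B : set (FT t)) by apply: sub_sigma_algebra; exact: aY.
have [B0|B0] := pselect (B 0).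
  rewrite (_ : cutoff Y t @^-1` B = (Y t @^-1` B) `|` Z); first exact: measurableU.
  apply/seteqP; split => w; rewrite /cutoff/= t0/=.
    by case: ifPn => [_|]; [left|rewrite negbK inE; right].
  by case: ifPn => // wZ [//|Zw]; move: wZ; rewrite notin_setE.
rewrite (_ : cutoff Y t @^-1` B = (Y t @^-1` B) `\` Z); first exact: measurableD.
apply/seteqP; split => w; rewrite /cutoff/= t0/=.
  by case: ifPn => // wZ Yw; split => //; rewrite notin_setE in wZ.
by move=> [Yw nZ]; rewrite memNset.
Qed.

Lemma cutoff_norm_measurable Y t : adapted F Y -> norm_measurable setT (cutoff Y t).
Proof.
move=> aY; have [t0|t0] := lerP 0 t.
  exact: (adapted_norm_measurable_total hF (cutoff_adapted aY) t0).
rewrite (_ : cutoff Y t = fun=> 0); first exact: norm_measurable_cst.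
by apply/funext => w; rewrite /cutoff leNgt t0.
Qed.

Lemma cutoff_right_continuous Y : (forall w, ~ Z w -> cadlag (Y ^~ w)) ->
  forall (t : R) w, cutoff Y s w @[s --> t^'+] --> cutoff Y t w.
Proof.
move=> cY t w; have [Zw|nZw] := pselect (Z w).
  rewrite (_ : cutoff Y ^~ w = fun=> 0); last first.
    by apply/funext => s; rewrite /cutoff mem_set// andbF.
  by rewrite /cutoff mem_set// andbF; exact: cvg_cst.
have [t0|t0] := lerP 0 t.
  have [rc _] := cY w nZw.
  rewrite cutoffE//; apply: cvg_trans (rc t t0).
  apply: near_eq_cvg; near=> s; rewrite cutoffE//.
  by rewrite (le_trans t0)//; near: s; exact: nbhs_right_ge.
rewrite {2}/cutoff leNgt t0/=; apply: cvg_near_cst; near=> s.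
rewrite /cutoff ifN// negb_and -ltNge; apply/orP; left.
by near: s; exact: nbhs_right_lt.
Unshelve. all: by end_near.
Qed.

Lemma cutoff_ae (Y : R -> Omega -> H) t : 0 <= t -> {ae P, forall w, cutoff Y t w = Y t w}.
Proof. by move=> t0; exists Z; split => // w /= h; apply: contrapT => nZ; apply: h; exact: cutoffE. Qed.

Context (nu : {sigma_finite_measure set (borel H) -> \bar R})
  (N : Omega -> {measure set (marks_times H R) -> \bar R})
  (hN : poisson_random_measure P F nu N) (sepH : separable_space H).
Local Open Scope ereal_scope.

Lemma cutoff_compensated (Y : R -> Omega -> H) t : (0 <= t)%R -> adapted F Y ->
  is_compensated_integral P nu N (@small_jumps R H t) (fun p => p.1) (Y t) ->
  is_compensated_integral P nu N (@small_jumps R H t) (fun p => p.1) (cutoff Y t).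
Proof.
move=> t0 aY [s [ins cs ds]]; exists s; split => //.
apply: cvg_trans ds; apply: near_eq_cvg; near=> n.
have an := step_in_adm (ins n) (_ : @small_jumps R H t `<=` @upto R H t).
have mcs : norm_measurable setT (compensated_step (intensity nu) N (s n)).
  apply: (norm_measurable_compensated hF hN sepH t0); apply: an.
  by rewrite small_jumpsE; exact: strip_upto.
apply: ae_eq_integral => //.
- apply: measurable_sqr_norm; apply: norm_measurable_sub => //.
  exact: (adapted_norm_measurable_total hF aY t0).
- apply: measurable_sqr_norm; apply: norm_measurable_sub => //.
  exact: cutoff_norm_measurable.
- by apply: ae_imply (cutoff_ae Y t0) => w ->.
Unshelve. all: by end_near.
Qed.

(** At time 0 the region of integration is empty, so all approximating step integrals vanish. This
    serves to read the initial value off the equation. *)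
Lemma compensated_integral_small_jumps0 (Y : Omega -> H) : norm_measurable setT Y ->
  is_compensated_integral P nu N (@small_jumps R H 0) (fun p => p.1) Y ->
  {ae P, forall w, Y w = 0%R}.
Proof.
move=> mY [s [ins _ ds]].
have sj0 : @small_jumps R H 0 = set0.
  by apply/seteqP; split => // p [_ /andP[h1 h2]]; have := lt_le_trans h1 h2; rewrite ltxx.
have sE (m : {measure set (marks_times H R) -> \bar R}) n : step_integral m (s n) = 0%R.
  rewrite /step_integral big1// => i _; have [_ iS _] := ins n i.
  rewrite (_ : step_set i = set0) ?measure0 ?scale0r//.
  by rewrite sj0 in iS; apply/seteqP; split.
have mY2 := measurable_sqr_norm mY.
have Y0 : \int[P]_w `|(`|Y w| ^+ 2)%R%:E| = 0.
  have I0 : 0 <= \int[P]_w `|(`|Y w| ^+ 2)%R%:E| by exact: integral_ge0.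
  apply/eqP; rewrite eq_le I0 andbT; apply/lee_addgt0Pr => e e0; rewrite add0e.
  have [n _ hn] := cvge0_lt ds e0.
  apply: le_trans (ltW (hn n (leqnn n))); apply: ge0_integral_mono => // w _.
  by rewrite !sE subrr subr0 gee0_abs// lee_fin sqr_ge0.
have := (ae_eq_integral_abs P measurableT mY2).1 Y0.
by apply: ae_imply => w /(_ I) /= [] /eqP; rewrite sqrf_eq0 normr_eq0 => /eqP.
Qed.

End modification.

Section density.
Context (R : realType) (V H : completeNormedModType R) (W : normedModType R)
  (G : gelfand_triple V H W).

(** A point [y] of the dense range with [|h - y| < |h|] would give [|h|^2 = (h, h - y) < |h|^2]. It
    turns an identity in [W] into one in [H]. *)
Lemma inner_embV_eq0 h : (forall v, inner G h (embV G v) = 0) -> h = 0.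
Proof.
move=> hv; apply/eqP/negPn/negP => h0.
have nh : 0 < `|h| by rewrite normr_gt0.
have D := @embV_dense R V H W G.
have [y [hy [v _ vy]]] : ball h `|h| `&` range (embV G) !=set0.
  by apply: D; [exists h; exact: ballxx|exact: ball_open].
have {}hy : `|h - y| < `|h| by rewrite -ball_normE in hy.
have := ip_le (innerP G) h (h - y); rewrite (ipBr (innerP G)) -vy hv subr0 (ip_norm (innerP G)).
rewrite ger0_norm ?sqr_ge0// expr2 ler_pM2l// vy leNgt.
by rewrite hy.
Qed.

Lemma eq_bochner d (T : measurableType d) (E : normedModType R) (mu : {measure set T -> \bar R})
    D (f g : T -> E) y : (forall x, D x -> f x = g x) -> is_bochner mu D f y -> is_bochner mu D g y.
Proof.
move=> fg [s [ms sf si sy]]; exists s; split => //.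
  by apply: ae_imply sf => x h Dx; rewrite -fg//; exact: h.
apply: cvg_trans si; apply: near_eq_cvg; near=> n.
by apply: eq_integral => x; rewrite inE => Dx; rewrite fg.
Unshelve. all: by end_near.
Qed.

End density.

(** * Accessibility *)

Section never_near_zero.
Context (R : realType) (H : completeNormedModType R) (d : measure_display)
  (Omega : measurableType d) (P : probability Omega R).
Local Open Scope ereal_scope.
Local Notation mu := (@lebesgue_measure R).

Lemma ge0_integral_eq0_ae d' (T : measurableType d') (m : {measure set T -> \bar R}) (f : T -> \bar R) :
  measurable_fun setT f -> (forall x, 0 <= f x) -> \int[m]_x f x = 0 -> {ae m, forall x, f x = 0}.
Proof.
move=> mf f0 i0; have i0' : \int[m]_x `|f x| = 0.
  by rewrite -i0; apply: eq_integral => x _; rewrite gee0_abs.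
by apply: ae_imply ((ae_eq_integral_abs m measurableT mf).1 i0') => x /(_ I).
Qed.

(** By Tonelli the expected weighted time spent below [r] is at most the vanishing integral, and the
    weight is positive. The comparison with [p] is one of lower integrals. *)
Lemma never_near_zero (Y : R -> Omega -> H) (lam r : R) (p : R -> \bar R) :
  (forall t, norm_measurable setT (Y t)) ->
  (forall (t : R) w, Y s w @[s --> t^'+] --> Y t w) ->
  (forall t, (0 <= t)%R -> P [set w | (`|Y t w|%R < r)%R] <= p t) -> (forall t, 0 <= p t) ->
  \int[mu]_(t in `[0%R, +oo[) ((expR (- lam * t))%:E * p t) = 0 ->
  {ae P, forall w, {ae mu, forall s : R, (0 <= s)%R -> (r <= `|Y s w|)%R}}.
Proof.
move=> mY rY hp p0 i0.
pose D := [set q : measurableTypeR R * Omega | (`|Y q.1 q.2|%R < r)%R].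
have mD : measurable D.
  have := norm_measurable_norm (norm_measurable_process mY rY).
  move=> /(_ measurableT `]-oo, r[%classic (measurable_itv _)); rewrite setTI.
  by rewrite (_ : _ @^-1` _ = D)//; apply/seteqP; split => q /=; rewrite in_itv.
pose I0 : set (measurableTypeR R) := `[0%R, +oo[%classic.
pose f (q : measurableTypeR R * Omega) : \bar R := ((\1_I0 q.1 * expR (- lam * q.1)) * \1_D q)%R%:E.
have mf : measurable_fun setT f.
  apply/measurable_EFinP; apply: measurable_funM; last exact: measurable_indic.
  apply: measurable_funM.
    apply: (measurableT_comp (f := \1_I0 : measurableTypeR R -> R)) => //.
    by apply: measurable_indic; exact: measurable_itv.
  apply: (measurableT_comp (f := @expR R)) => //; apply: measurable_funM => //.
have f0 q : 0 <= f q by rewrite lee_fin !mulr_ge0 ?expR_ge0.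
have ff : \int[P]_w \int[mu]_s f (s, w) = 0.
  rewrite -(@fubini_tonelli _ _ _ _ _ mu P f mf f0).
  apply/eqP; rewrite eq_le; apply/andP; split; last first.
    by apply: integral_ge0 => s _; exact: integral_ge0.
  rewrite -[leRHS]i0 [leRHS]integral_mkcond; apply: ge0_integral_mono => s _; first exact: integral_ge0.
  rewrite patchE; case: ifPn => sI; last first.
    by rewrite integral0_eq// => w _; rewrite /f indicE (negbTE sI) !mul0r.
  have s0 : (0 <= s)%R by move: sI; rewrite inE/= in_itv/= andbT.
  have mDs : measurable [set w | (`|Y s w|%R < r)%R].
    have := norm_measurable_norm (mY s) measurableT (measurable_itv `]-oo, r[).
    by rewrite setTI (_ : _ @^-1` _ = [set w | (`|Y s w|%R < r)%R])//; apply/seteqP; split => w /=; rewrite in_itv.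
  apply: (@le_trans _ _ ((expR (- lam * s))%:E * P [set w | (`|Y s w|%R < r)%R])); last first.
    by rewrite lee_wpmul2l ?lee_fin ?expR_ge0// hp.
  rewrite (_ : \int[P]_w f (s, w) = \int[P]_w ((expR (- lam * s))%:E * (\1_[set w | (`|Y s w|%R < r)%R] w : R)%:E)); last first.
    apply: eq_integral => w _; rewrite /f /= !indicE [_ \in I0]sI mul1r -EFinM.
    have -> : ((s, w) \in D) = (w \in [set w0 | (`|Y s w0|%R < r)%R]); last by [].
    by apply/idP/idP; rewrite !inE.
  rewrite ge0_integralZl//; last by apply/measurable_EFinP; exact: measurable_indic.
  by rewrite integral_indic// setIT.
have G0 w : 0 <= fubini_G mu f w by apply: integral_ge0 => s _; exact: f0.
have := ge0_integral_eq0_ae (@measurable_fun_fubini_tonelli_G _ _ _ _ _ mu f mf f0) G0 ff.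
apply: ae_imply => w hw.
have mfw : measurable_fun setT (fun s : measurableTypeR R => f (s, w)).
  exact: (measurableT_comp mf (pair2_measurable w)).
have := ge0_integral_eq0_ae mfw (fun s => f0 (s, w)) hw.
apply: ae_imply => s fs s0; rewrite leNgt; apply/negP => Ys.
move: fs => /eqP; rewrite /f/= eqe !indicE !mem_set//=; last by rewrite /I0/= in_itv/= s0.
by rewrite mul1r mulr1 gt_eqF// expR_gt0.
Qed.

End never_near_zero.

Theorem proposition3p1 (R : realType)
  (* filtered probability space *)
  (d : measure_display) (Omega : measurableType d) (P : probability Omega R)
  (F : R -> set (set Omega)) (hF : usual_conditions P F)
  (* Gelfand triple, W being the dual of V *)
  (V H : completeNormedModType R) (W : normedModType R)
  (G : gelfand_triple V H W)
  (A : V -> W)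
  (hA : measurable_fun setT (A : borel V -> borel W))
  (nu : {sigma_finite_measure set (borel H) -> \bar R})
  (hnu0 : nu [set (0 : H)] = 0%E)
  (hnu1 : (\int[nu]_z (Num.min (`|z : H| ^+ 2) 1)%:E < +oo)%E)
  (N : Omega -> {measure set (marks_times H R) -> \bar R})
  (hN : poisson_random_measure P F nu N)
  (alpha beta theta C Ct varpi F0 : R)
  (halpha : 1 < alpha) (hbeta : 0 <= beta) (htheta : 0 < theta)
  (hC : 0 < C) (hCt : 0 < Ct) (hvarpi : 0 < varpi) (hF0 : 0 < F0)
  (rho : V -> R)
  (hrho_meas : measurable_fun setT (rho : borel V -> R))
  (hrho_ge0 : forall v : V, 0 <= rho v)
  (hrho_bounded : forall r : R, exists M : R,
     forall v : V, `|v| <= r -> rho v <= M)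
  (hemicontinuity : forall v v1 v2 : V,
     continuous (fun s : R => pairing G (A (v1 + s *: v2)) v))
  (local_monotonicity : forall v1 v2 : V,
     2 * pairing G (A v1 - A v2) (v1 - v2)
       <= (C + rho v2) * `|embV G (v1 - v2)| ^+ 2)
  (coercivity : forall v : V,
     2 * pairing G (A v) v + theta * `|v| `^ alpha
       <= F0 + C * `|embV G v| ^+ 2)
  (growth : forall v : V,
     `|A v| `^ (alpha / (alpha - 1))
       <= (F0 + C * `|v| `^ alpha) * (1 + `|embV G v| `^ beta))
  (rho_bound : forall v : V,
     rho v <= C * (1 + `|v| `^ alpha) * (1 + `|embV G v| `^ beta))
  (dissipation : forall v : V,
     2 * pairing G (A v) v + Ct * `|embV G v| `^ varpi <= 0)
  (nu_symmetric : forall B : set (borel H), measurable B ->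
     nu B = nu [set - (z : H) | z in B])
  (L : R -> Omega -> H) (hL : is_levy_noise P F nu N L)
  (* the solution X^x, with the path regularity from well-posedness *)
  (X : H -> R -> Omega -> H)
  (hX : forall x : H, is_solution G A P F L x (X x))
  (hX_paths : forall x : H, paths_Lloc G P alpha (X x)) :
  accessible P X 0.
Proof.
move=> lam lam0 x U U0 mU.
have sepH : separable_space H := separableH G.
have ipP := innerP G.
rewrite lt_neqAle; apply/andP; split; last first.
  rewrite mule_ge0 ?lee_fin ?(ltW lam0)//; apply: integral_ge0 => t _.
  by rewrite mule_ge0// lee_fin expR_ge0.
apply/negP => /eqP res0.
have int0 : (\int[@lebesgue_measure R]_(t in `[0%R, +oo[)
    ((expR (- lam * t))%:E * P (X x t @^-1` U)) = 0)%E.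
  move/esym/eqP: res0; rewrite /resolvent mule_eq0 eqe gt_eqF//= => /eqP.
  by [].
have [r r0 rU] : exists2 r : R, 0 < r & ball (0 : H) r `<=` U by apply/nbhs_ballP.
have [M [aM cadM cM LM]] := hL.
have [aX cadX _ iA eqX] := hX x.
have M00 : {ae P, forall w, M 0 w = 0}.
  apply: (compensated_integral_small_jumps0 (nu := nu) (N := N)) => //; last exact: cM.
  exact: (adapted_norm_measurable_total hF aM).
(* All almost sure properties are collected in one null set, on which both processes are then
   modified. *)
have [Z [mZ Z0 hZ]] := ae_and cadX (ae_and cadM (ae_and M00 (ae_and LM (ae_and iA (ae_and eqX (hX_paths x)))))).
have good := fun w (nZ : ~ Z w) => contrapT (fun h => nZ (hZ w h)).
pose X' := cutoff Z (X x); pose M' := cutoff Z M.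
have aX' : adapted F X' by exact: (cutoff_adapted hF mZ Z0 aX).
have aM' : adapted F M' by exact: (cutoff_adapted hF mZ Z0 aM).
have mX' t : norm_measurable setT (X' t) by exact: (cutoff_norm_measurable hF mZ Z0 _ aX).
have mM' t : norm_measurable setT (M' t) by exact: (cutoff_norm_measurable hF mZ Z0 _ aM).
have rcX' : forall (t : R) w, X' s w @[s --> t^'+] --> X' t w.
  by apply: cutoff_right_continuous => w /good[].
have rcM' : forall (t : R) w, M' s w @[s --> t^'+] --> M' t w.
  by apply: cutoff_right_continuous => w /good[_ []].
have cM' t : 0 <= t -> is_compensated_integral P nu N (@small_jumps R H t) (fun p => p.1) (M' t).
  by move=> t0; apply: (cutoff_compensated hF mZ Z0 hN sepH) => //; exact: cM.
have far : {ae P, forall w, {ae (@lebesgue_measure R), forall s : R, 0 <= s -> r <= `|X' s w|}}.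
  apply: (never_near_zero mX' rcX' (lam := lam) (p := fun t => P (X x t @^-1` U))) => // t t0.
  have mXU : measurable (X x t @^-1` U) by apply: (filt_measurable hF t0); exact: aX.
  have mXr : measurable [set w | `|X' t w| < r].
    have := norm_measurable_norm (mX' t) measurableT (measurable_itv `]-oo, r[).
    by rewrite setTI (_ : _ @^-1` _ = [set w | `|X' t w| < r])//; apply/seteqP; split => w /=; rewrite in_itv.
  apply: (@le_trans _ _ (P ((X x t @^-1` U) `|` Z))).
    apply: le_measure; rewrite ?inE//; first exact: measurableU.
    move=> w /= Xr; have [Zw|nZ] := pselect (Z w); [by right|left].
    by apply: rU; rewrite -ball_normE /= sub0r normrN; move: Xr; rewrite /X' cutoffE.
  apply: (le_trans (measureU2 _ _ _)) => //.
  by rewrite [X in (_ + X)%E](_ : _ = 0%E) ?adde0.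
(* Here [K^2 = |x|^2 + 4 |x| + 4] exceeds [|x|^2 + 2], and the energy dissipated by time [T] would
   be [|x|^2 + 3]. *)
pose K := `|x| + 2; pose T := (`|x| ^+ 2 + 3) / (Ct * r `^ varpi).
have x0 : 0 <= `|x| by [].
have Cr0 : 0 < Ct * r `^ varpi by rewrite mulr_gt0// powR_gt0.
have T0 : 0 < T by rewrite divr_gt0// ltr_wpDl ?sqr_ge0.
have K0 : 0 <= K by rewrite addr_ge0.
pose v := 2^-1 / (32 * T * K ^+ 2 + 4 * T).
have v1 : 0 < 32 * T * K ^+ 2 + 4 * T.
  apply: ltr_wpDl; last by rewrite mulr_gt0.
  by apply: mulr_ge0; [rewrite mulr_ge0// ltW|exact: sqr_ge0].
have v0 : 0 < v by rewrite divr_gt0.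
have [eps [eps0 eps1 hv]] := small_annulus_variance hnu1 v0.
have v_small : (32 * T * K ^+ 2 + 4 * T) * v <= 2^-1 by rewrite /v mulrC divfK// gt_eqF.
have nZae : {ae P, forall w, ~ Z w} by exists Z; split => // w /= /contrapT.
have [w [Nw [nZw farw] frq]] := good_path hF hN ipP sepH hnu1 nu_symmetric aX' aM' mX' mM' rcX' rcM' cM'
  T0 K0 (ltW v0) eps0 eps1 hv v_small (ae_and nZae far).
have [_ [_ [M0w [LMw [iAw [eqw pathw]]]]]] := good w nZw.
have T10 : 0 <= T + 1 by rewrite addr_ge0// ltW.
have mjoint (Y : R -> Omega -> H) : (forall t, norm_measurable setT (Y t)) ->
    (forall (t : R) w', Y s w' @[s --> t^'+] --> Y t w') ->
    norm_measurable setT (fun s : measurableTypeR R => Y s w).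
  move=> mY rY y; have := norm_measurable_process mY rY y.
  by move=> h; apply: (measurableT_comp h (pair2_measurable w)).
have X'E t : 0 <= t -> X' t w = X x t w by move=> t0; exact: cutoffE.
have M'E t : 0 <= t -> M' t w = M t w by move=> t0; exact: cutoffE.
have mlarge t : measurable (@large_jumps R H t).
  rewrite (_ : large_jumps t = strip `]1, +oo[ 0 t); first exact: measurable_strip.
  by apply/seteqP; split => p; rewrite /large_jumps /strip/= in_itv/= andbT.
(* As [eps <= 1], the void event excludes jumps of norm above 1 up to time [T + 1], so the
   large-jump integral vanishes. *)
have LE t : 0 <= t -> t <= T + 1 -> L t w = M t w.
  move=> t0 tT; have [J [bJ ->]] := LMw t t0.
  rewrite (bochner_null (mlarge t) _ bJ) ?addr0//.
  apply/eqP; rewrite -measure_le0 -Nw; apply: le_measure; rewrite ?inE//.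
    by have [] := big_strip_adm hnu1 (addr_ge0 (ltW T0) ler01) eps0.
  move=> p [p1 /andP[p2 p3]]; split => /=; first by rewrite in_itv/= andbT (le_lt_trans eps1).
  by rewrite p2 (le_trans p3).
(* The initial condition is contained in the equation at time 0, an identity in [W]; testing it on
   the dense range of [V] brings it back to [H]. *)
have X0 : X' 0 w = x.
  rewrite X'E//; have [I [bI eI]] := eqw 0 (lexx 0).
  have I0 : I = 0.
    apply: (bochner_null _ _ bI); first exact: measurable_itv.
    by have := lebesgue_measure_segment (lexx (0 : R)); rewrite subrr.
  apply/eqP; rewrite -subr_eq0; apply/eqP; apply: (inner_embV_eq0 (G := G)) => u.
  rewrite (ipBl ipP) -!embHE eI I0 addr0 LE// M0w.
  have -> : pairing G (embH G x + embH G 0) u = pairing G (embH G x) u + pairing G (embH G 0) u.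
    by have := dual_linear (pairingP G) 1 (embH G x) (embH G 0) u; rewrite scale1r mul1r.
  by rewrite [pairing G (embH G 0) u]embHE (ip0l ipP) addr0 subrr.
apply: (path_contradiction halpha hbeta htheta hC hCt hvarpi hF0 coercivity growth dissipation
  (mjoint _ mX' rcX') (mjoint _ mM' rcM') (fun t => rcX' t w) X0 _ _ _ _ farw T0 r0 _ _ _ frq).
- move=> t t0 tT; have [I [bI eI]] := eqw t t0; exists I; split.
    apply: eq_bochner bI => s /=; rewrite in_itv/= => /andP[s0 _].
    by rewrite X'E.
  by rewrite X'E// M'E// eI LE.
- apply: le_lt_trans (iAw _ T10); apply: ge0_integral_mono => s; first by rewrite lee_fin.
  by rewrite /= in_itv/= => /andP[s0 _]; rewrite X'E.
- have [h _] := pathw _ T10; apply: ae_imply h => s h sT.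
  by rewrite X'E; [exact: h|case/andP: sT].
- have [_ h] := pathw _ T10; apply: le_lt_trans h; apply: ge0_integral_mono => s.
    by rewrite lee_fin powR_ge0.
  by rewrite /= in_itv/= => /andP[s0 _]; rewrite X'E.
- by rewrite /K ltrDl.
- have -> : K ^+ 2 = `|x| ^+ 2 + (4 * `|x| + 4) by rewrite /K; ring.
  by rewrite ltrD2l ltr_wpDl ?mulr_ge0// ltr_nat.
- by rewrite /T mulrC divfK ?gt_eqF// ltrD2l ltr_nat.
Qed.
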